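(* Let $n,d\in\mathbb{N}$, $1<p<\infty$, $p'=p/(p-1)$, and let $\mathscr{D}$ be a dyadic grid in $\mathbb{R}^d$. If $W$ is a matrix A${}_{p,\infty}$ weight on $\mathbb{R}^d$ with values in $\mathcal{M}_n(\mathbb{C})$, and $\{V_I\}_{I\in\mathscr{D}}$ are the associated reducing matrices for $W$ and $p$, then there is a constant $C$, independent of $\vec f$ (but possibly depending on $W$, $n$, $d$, $p$), such that for all $\vec f\in L^{p'}(W^{1-p'})$ $$\left(\int_{\mathbb{R}^d}\left(\sum_{I\in\mathscr{D}}\sum_{\varepsilon\in \mathrm{Sig}_d}\frac{|V_I^{-1}\vec f_I^{\,\varepsilon}|^2}{|I|}\chi_I(x)\right)^{\frac{p'}2}dx\right)^{\frac1{p'}}\le C\,\|\vec f\|_{L^{p'}(W^{1-p'})}.$$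
   Context: $\mathcal{M}_n(\mathbb{C})$ is the algebra of $n\times n$ complex matrices, $|\cdot|$ is the Euclidean norm on $\mathbb{C}^n$ (and Lebesgue measure when applied to sets), and $\chi_I$ is the indicator function of $I$. Haar system: for an interval $I\subset\mathbb{R}$ with left and right halves $I_\ell, I_r$, put $h_I^1=|I|^{-1/2}\chi_I$ and $h_I^0=|I|^{-1/2}(\chi_{I_\ell}-\chi_{I_r})$. For a cube $I=I_1\times\cdots\times I_d$ in a dyadic grid $\mathscr{D}$ of $\mathbb{R}^d$ and $\varepsilon\in\{0,1\}^d$, put $h_I^\varepsilon(x)=\prod_{i=1}^d h_{I_i}^{\varepsilon_i}(x_i)$. Let $\mathrm{Sig}_d=\{0,1\}^d\setminus\{(1,\dots,1)\}$. For $\vec f:\mathbb{R}^d\to\mathbb{C}^n$, $\vec f_I^{\,\varepsilon}=\int_{\mathbb{R}^d}\vec f\,h_I^\varepsilon\,dx\in\mathbb{C}^n$. Weights: let $W:\mathbb{R}^d\to\mathcal{M}_n(\mathbb{C})$ be locally integrable and positive definite a.e. $L^{p'}(W^{1-p'})$ is the space of measurable $\vec f:\mathbb{R}^d\to\mathbb{C}^n$ with $\|\vec f\|_{L^{p'}(W^{1-p'})}^{p'}=\int_{\mathbb{R}^d}|W^{-1/p}(x)\vec f(x)|^{p'}\,dx<\infty$ (note $(W^{1-p'})^{1/p'}=W^{-1/p}$). Reducing matrices: for each cube $I$, $V_I$ is a positive definite matrix with $|I|^{-1/p}\|\chi_I W^{1/p}\vec e\|_{L^p}\approx|V_I\vec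 e|$ for all $\vec e\in\mathbb{C}^n$, where the comparability constants do not depend on $W$, $I$ or $\vec e$ and $\|\cdot\|_{L^p}$ is the norm of $L^p(\mathbb{R}^d;\mathbb{C}^n)$. Such matrices always exist. Matrix A${}_{p,\infty}$: $W$ is a matrix A${}_{p,\infty}$ weight if there is a constant $C_0<\infty$ such that for every cube $I\subset\mathbb{R}^d$ and every nonzero $\vec e\in\mathbb{C}^n$ $$\exp\left(\frac1{|I|}\int_I\log|W^{-1/p}(x)\vec e|\,dx\right)\le C_0\,|V_I^{-1}\vec e|.$$ *)

(* Defs.v *)
From HB Require Import structures.
From mathcomp Require Import all_boot all_order all_algebra.
From mathcomp Require Import all_classical all_reals all_analysis.
From mathcomp Require Import measurable_realfun complex.

Set Implicit Arguments.
Unset Strict Implicit.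
Unset Printing Implicit Defensive.

Import Order.TTheory GRing.Theory Num.Theory.
Import numFieldNormedType.Exports.

Local Open Scope classical_set_scope.
Local Open Scope ring_scope.
Local Open Scope complex_scope.

(* R^d, with the product of the Borel sigma-algebras. *)
Notation Rspace R d := (d.-tuple (measurableTypeR R)).

Section LebesgueMeasure.
Variable R : realType.
Local Notation leb1 := (@lebesgue_measure R).

Definition cons_pt d (z : measurableTypeR R * Rspace R d) : Rspace R d.+1 :=
  [the d.+1.-tuple (measurableTypeR R) of z.1 :: z.2].

Definition uncons_pt d (x : Rspace R d.+1) : measurableTypeR R * Rspace R d :=
  (thead x, [tuple of behead x]).

Lemma measurable_cons_pt d : measurable_fun setT (@cons_pt d).
Proof. by apply: measurable_cons; [exact: measurable_fst|exact: measurable_snd]. Qed.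

Lemma measurable_uncons_pt d : measurable_fun setT (@uncons_pt d).
Proof.
apply/measurable_fun_pairP; split; first exact: measurable_tnth.
exact: measurable_behead.
Qed.

Lemma cons_ptK d : cancel (@cons_pt d) (@uncons_pt d).
Proof. by case=> a t; congr pair; apply: val_inj. Qed.

Section step.
Variables (d : nat) (mu : {sigma_finite_measure set (Rspace R d) -> \bar R}).

Definition leb_step : set (Rspace R d.+1) -> \bar R :=
  pushforward (leb1 \x mu)%E (@cons_pt d).

Lemma leb_step0 : leb_step set0 = 0%E.
Proof. by rewrite /leb_step /pushforward preimage_set0 measure0. Qed.

Lemma leb_step_ge0 A : (0 <= leb_step A)%E.
Proof. exact: (@measure_ge0 _ _ _ (leb1 \x mu)%E). Qed.

Lemma leb_step_sigma_additive : semi_sigma_additive leb_step.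
Proof.
pose m : {measure set _ -> \bar R} := (leb1 \x mu)%E.
move=> F mF tF mUF; rewrite /leb_step /pushforward preimage_bigcup.
have mpre A : measurable A -> measurable (@cons_pt d @^-1` A).
  move=> mA; rewrite -[X in measurable X]setTI.
  exact: measurable_cons_pt.
apply: (@measure_semi_sigma_additive _ _ _ m).
- by move=> n; exact: mpre.
- apply/trivIsetP => /= i j _ _ ij; rewrite -preimage_setI.
  by move/trivIsetP : tF => /(_ _ _ _ _ ij) ->//; rewrite preimage_set0.
- by rewrite -preimage_bigcup; exact: mpre.
Qed.

HB.instance Definition _ := isMeasure.Build _ _ _
  leb_step leb_step0 leb_step_ge0 leb_step_sigma_additive.

Lemma leb_step_sigma_finite : sigma_finite setT leb_step.
Proof.
have /sigma_finiteP[F [TF ndF Foo]] := sigma_finiteT leb1.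
have /sigma_finiteP[G [TG ndG Goo]] := sigma_finiteT mu.
exists (fun k => @uncons_pt d @^-1` (F k `*` G k)).
  rewrite -preimage_bigcup (_ : \bigcup_k _ = setT) ?preimage_setT//.
  rewrite -setXTT TF TG predeqE => -[x y]; split.
    by move=> [k _ []/= ? ?]; split; exists k.
  move=> [/= [k _ Fkx] [l _ Gly]]; exists (maxn k l) => //; split.
  - by move: x Fkx; exact/subsetPset/ndF/leq_maxl.
  - by move: y Gly; exact/subsetPset/ndG/leq_maxr.
move=> k; have [mF Fk] := Foo k; have [mG Gk] := Goo k; split.
  rewrite -[X in measurable X]setTI.
  by apply: measurable_uncons_pt => //; exact: measurableX.
rewrite /leb_step /pushforward -comp_preimage.
rewrite (_ : _ \o _ = id); last by apply/funext => z; exact: cons_ptK.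
rewrite preimage_id product_measure1E//.
by rewrite lte_mul_pinfty// ge0_fin_numE.
Qed.

HB.instance Definition _ := @Measure_isSigmaFinite.Build _ _ _
  leb_step leb_step_sigma_finite.

End step.

Fixpoint leb d : {sigma_finite_measure set (Rspace R d) -> \bar R} :=
  match d with
  | 0 => [the {sigma_finite_measure set (Rspace R 0) -> \bar R} of dirac [tuple]]
  | d'.+1 => [the {sigma_finite_measure set (Rspace R d'.+1) -> \bar R} of
       leb_step (leb d')]
  end.

End LebesgueMeasure.

Section Cubes.
Variables (R : realType) (d : nat).

(* A cube is given by its lower corner and its side length; as a point set it
   is half-open, so that the cubes of one generation of a dyadic grid
   partition R^d. *)
Definition cube := (Rspace R d * {posnum R})%type.

Implicit Type I : cube.

Definition corner I (i : 'I_d) : R := tnth I.1 i.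
Definition side I : R := I.2%:num.

Definition cubeset I : set (Rspace R d) :=
  [set x | forall i, corner I i <= (tnth x i : R) < corner I i + side I].

Definition vol I : R := fine (leb R d (cubeset I)).

Definition dyadic_grid (D : set cube) : Prop :=
  [/\ forall I, D I -> exists k : int, side I = 2 ^ k,
      forall (k : int) (x : Rspace R d),
        exists! I : cube, [/\ D I, side I = 2 ^ k & cubeset I x]
    & forall I J, D I -> D J ->
        [\/ cubeset I `&` cubeset J = cubeset I,
            cubeset I `&` cubeset J = cubeset J
          | cubeset I `&` cubeset J = set0]].

(* h_J^eps for the interval J = [a, a + l[, with eps = true standing for 1. *)
Definition haar1 (a l : R) (eps : bool) (t : R) : R :=
  (Num.sqrt l)^-1 *
  (if eps then \1_(`[a, a + l[) t
   else \1_(`[a, a + l / 2[) t - \1_(`[a + l / 2, a + l[) t).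

Definition haar I (eps : {ffun 'I_d -> bool}) (x : Rspace R d) : R :=
  \prod_(i < d) haar1 (corner I i) (side I) (eps i) (tnth x i).

Definition Sig : pred {ffun 'I_d -> bool} := fun eps => eps != [ffun=> true].

(* Lebesgue (rather than only Borel) measurability. On such functions the
   integral of the library, a supremum over Borel simple functions, is still
   the Lebesgue integral, since they are a.e. equal to Borel functions. *)
Definition Lebesgue_measurable (g : Rspace R d -> R) : Prop :=
  forall Y : set R, measurable Y -> completed_algebra_gen (leb R d) (g @^-1` Y).

Definition Lebesgue_measurable_mx m k (F : Rspace R d -> 'M[R[i]]_(m, k)) : Prop :=
  forall i j, Lebesgue_measurable (fun x => complex.Re (F x i j)) /\
              Lebesgue_measurable (fun x => complex.Im (F x i j)).

End Cubes.

Section Matrices.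
Variables (R : realType) (n : nat).

Definition cnorm (v : 'cV[R[i]]_n) : R :=
  Num.sqrt (\sum_(i < n) ComplexField.Normc.normc (v i 0) ^+ 2).

(* The strict order of R[i] forces v^* A v to be real. *)
Definition posdefmx (A : 'M[R[i]]_n) : Prop :=
  A \is hermsymmx /\
  forall v : 'cV[R[i]]_n, v != 0 -> 0 < (v^t*%sesqui *m A *m v) 0 0.

(* A^s by functional calculus on the spectral decomposition of A. *)
Definition powmx (A : 'M[R[i]]_n) (s : R) : 'M[R[i]]_n :=
  let P := spectralmx A in
  invmx P *m
  diag_mx (map_mx (fun z => (complex.Re z `^ s)%:C) (spectral_diag A)) *m P.

End Matrices.

Section Weights.
Variables (R : realType) (n d : nat).
Local Notation mu := (leb R d).
Implicit Types (W : Rspace R d -> 'M[R[i]]_n) (f : Rspace R d -> 'cV[R[i]]_n).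

(* Local integrability is tested on cubes, which exhaust bounded sets. *)
Definition matrix_weight W : Prop :=
  [/\ Lebesgue_measurable_mx W,
      forall (I : cube R d) i j,
        (\int[mu]_(x in cubeset I) (ComplexField.Normc.normc (W x i j))%:E < +oo)%E
    & {ae mu, forall x, posdefmx (W x)}].

Definition Lnorm_vec (p : R) f : \bar R :=
  ((\int[mu]_x (cnorm (f x) `^ p)%:E) `^ p^-1)%E.

(* The norm of L^{p'}(W^{1-p'}), where p' = p / (p - 1). *)
Definition dual_weight_norm (p : R) W f : \bar R :=
  Lnorm_vec (p / (p - 1)) (fun x => powmx (W x) (- p^-1) *m f x).

Definition dual_weight_space (p : R) W f : Prop :=
  Lebesgue_measurable_mx f /\ (dual_weight_norm p W f < +oo)%E.

Definition reducing_matrices (p c1 c2 : R) W (V : cube R d -> 'M[R[i]]_n) : Prop :=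
  forall I, posdefmx (V I) /\
    forall e : 'cV[R[i]]_n,
      let N := ((vol I `^ (- p^-1))%:E *
        Lnorm_vec p
          (fun x => (\1_(cubeset I) x : R)%:C *: (powmx (W x) p^-1 *m e)))%E in
      ((c1 * cnorm (V I *m e))%:E <= N <= (c2 * cnorm (V I *m e))%:E)%E.

(* The exponent is an extended real: log |W^{-1/p} e| has an integrable
   negative part on cubes, but its integral may be +oo. *)
Definition matrix_Apinfty (p : R) W (V : cube R d -> 'M[R[i]]_n) : Prop :=
  exists C0 : R, forall (I : cube R d) (e : 'cV[R[i]]_n), e != 0 ->
    (expeR ((vol I)^-1%:E *
       \int[mu]_(x in cubeset I) (ln (cnorm (powmx (W x) (- p^-1) *m e)))%:E)
     <= (C0 * cnorm (invmx (V I) *m e))%:E)%E.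

Definition haar_coef f (I : cube R d) (eps : {ffun 'I_d -> bool}) : 'cV[R[i]]_n :=
  \col_j ((\int[mu]_x (complex.Re (f x j 0) * haar I eps x))
          +i* (\int[mu]_x (complex.Im (f x j 0) * haar I eps x))).

Definition square_sum (V : cube R d -> 'M[R[i]]_n) (D : set (cube R d)) f
    (x : Rspace R d) : \bar R :=
  (\esum_(I in D) \sum_(eps | Sig eps)
     (cnorm (invmx (V I) *m haar_coef f I eps) ^+ 2 / vol I
      * \1_(cubeset I) x)%:E)%E.

End Weights.

Lemma leb_cubeset (R : realType) (d : nat) (I : cube R d) :
  leb R d (cubeset I) = (side I ^+ d)%:E.
Proof.
case: I => a l; rewrite /cubeset /corner /side /=.
elim: d a => [|d IH] a.
  rewrite expr0 /= diracE mem_set//= => -[]//.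
rewrite /= /leb_step /pushforward.
rewrite (_ : _ @^-1` _ = `[thead a, thead a + l%:num[%classic `*`
   [set x | forall i, tnth [tuple of behead a] i <= (tnth x i : R)
                    < tnth [tuple of behead a] i + l%:num]); last first.
  apply/seteqP; split => -[t x] /=.
    move=> H; split.
      by have := H ord0; rewrite in_itv /= tnth0.
    move=> i; have := H (lift ord0 i); rewrite tnthS/=.
    by rewrite [in X in X -> _](tuple_eta a) tnthS.
  rewrite in_itv /= => -[H0 H] i; case: (unliftP ord0 i) => [j|] ->.
    by have := H j; rewrite [in X in _ -> X](tuple_eta a) !tnthS.
  by rewrite tnth0.
rewrite product_measure1E /=; [|exact: measurable_itv|]; last first.
  rewrite (_ : mkset _ = \bigcap_(i in [set: 'I_d])
     ((fun x : Rspace R d => tnth x i) @^-1`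
      `[tnth [tuple of behead a] i, tnth [tuple of behead a] i + l%:num[)).
    apply: fin_bigcap_measurable => // i _; rewrite -[X in measurable X]setTI.
    by apply: measurable_tnth => //; exact: measurable_itv.
  apply/seteqP; split => x /= H i; first by move=> _; rewrite /= in_itv /=.
  by have := H i Logic.I; rewrite /= in_itv.
rewrite IH lebesgue_measure_itv /= lte_fin ltrDl gt0//.
by rewrite -EFinB addrAC subrr add0r -EFinM exprS.
Qed.

(* Main.v *)
Require Import Defs.
From HB Require Import structures.
From mathcomp Require Import all_boot all_order all_algebra.
From mathcomp Require Import all_classical all_reals all_analysis.
From mathcomp Require Import measurable_realfun complex ring lra zify.

(** Write g = |W^(-1/p) f|, so that the right-hand side is the L^(p') norm of g.
    The sums over the generations -k..k of the grid increase to the full square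
    sum, and the cubes of one generation partition space. Hence it suffices to
    bound, uniformly in a cube K and a depth m, the integral over K of the
    (p'/2)-th power of the sum over the cubes of the first m generations below
    K by C times the integral of g^(p') over K (local_square_estimate,
    grid_integral_le). Below K the cubes form a 2^d-ary tree and all functions
    enter through their averages, which are martingales on the tree. The local
    estimate is therefore a statement about finite trees, and inductions on the
    depth replace maximal functions and differentiation theorems.

    The A_(p,infinity) condition enters twice, both times through the pairing
    |<e,v>| <= |W^(-1/p) e| |W^(1/p) v|. First, it reverses Jensen's inequality
    for the logarithm of each scalar weight |W^(1/p) v|^p, up to a constant that
    does not depend on v; a Bellman function then gives all these weights a
    reverse Hoelder inequality with one common exponent 1+del
    (tree_reverse_hoelder, reverse_hoelder_posnorm). Secondly, log |V_K^(-1) e|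
    is at most the average of log |W^(-1/p) e| over K, up to a constant. For an
    ancestor J of K, the matrix V_K^(-1) is therefore dominated by V_J^(-1)
    unless the average over K of sum_i |log |W^(-1/p) V_J e_i|| is large; this
    average is a nonnegative martingale bounded at J, so it gets large only on a
    small portion of J (invV_comparison, logosc_root, path_avg_comparison).

    With V_J in place of V_K, the coefficients are the martingale differences
    of the entries of V_J^(-1) f, which are bounded by
    Psi = sum_j |W^(1/p) V_J^(-1) e_j| g. The weak type (1,1) bound for the
    martingale square function controls their sum through the average of Psi
    over J (weak_type_square). Hoelder's inequality with the exponent p(1+del)
    on the first factor, and the reverse Hoelder inequality, bound that average
    by the average of g^r to the power 1/r for some r < p' (majorant_root); at
    depth m, the average of g^r is replaced by the larger mean, over the m-th
    generation, of the averages of g^(p') to the power r/p'.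
    Altogether, for every J the square sum below J exceeds a constant times the
    2/r-th power of the average of g^r only on an arbitrarily small portion of
    J (exceed_small).

    Such information at all cubes implies the strong bound: one stops at the
    first cubes at which the sum exceeds the threshold and repeats the argument
    there. Since r < p' and the stopped cubes are sparse, twice the p'/r-th power
    of the average of g^r over a cube is at most the mean of the same quantity
    over its stopped cubes plus a constant times the mass of g^(p') outside
    them. Summed over all the rounds, these powers therefore add up to at most
    a constant times the mass of g^(p') (sparse_gain, stopping_iteration). *)

Set Implicit Arguments.
Unset Strict Implicit.
Unset Printing Implicit Defensive.

Import Order.TTheory GRing.Theory Num.Theory.
Import numFieldNormedType.Exports.

Local Open Scope classical_set_scope.
Local Open Scope ring_scope.
Local Open Scope complex_scope.

(** * Averages over the nodes of a tree *)

Section TreeAverages.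
Variables (R : realType) (T : finType) (C : Type) (ch : T -> C -> C).
Hypothesis T_gt0 : (0 < #|T|)%N.

Definition avg (F : T -> R) : R := (\sum_c F c) / #|T|%:R.

Let N_gt0 : 0 < #|T|%:R :> R. Proof. by rewrite ltr0n. Qed.
Let N_neq0 : #|T|%:R != 0 :> R. Proof. by rewrite gt_eqF. Qed.

Lemma ler_avg (F G : T -> R) : (forall c, F c <= G c) -> avg F <= avg G.
Proof. by move=> FG; rewrite /avg ler_pM2r ?invr_gt0//; apply: ler_sum. Qed.

Lemma eq_avg (F G : T -> R) : F =1 G -> avg F = avg G.
Proof. by move=> FG; congr (_ / _); apply: eq_bigr => c _; exact: FG. Qed.

Lemma avg_cst (a : R) : avg (fun=> a) = a.
Proof. by rewrite /avg sumr_const -[X in X / _]mulr_natr mulfK. Qed.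

Lemma avgD (F G : T -> R) : avg (fun c => F c + G c) = avg F + avg G.
Proof. by rewrite /avg big_split mulrDl. Qed.

Lemma avgZ a (F : T -> R) : avg (fun c => a * F c) = a * avg F.
Proof. by rewrite /avg -mulr_sumr mulrA. Qed.

Lemma avgN (F : T -> R) : avg (fun c => - F c) = - avg F.
Proof. by rewrite /avg sumrN mulNr. Qed.

Lemma avgB (F G : T -> R) : avg (fun c => F c - G c) = avg F - avg G.
Proof. by rewrite avgD avgN. Qed.

Lemma avg_sumr (I : finType) (F : I -> T -> R) :
  avg (fun c => \sum_i F i c) = \sum_i avg (F i).
Proof. by rewrite /avg exchange_big /= mulr_suml. Qed.

Lemma avg_ge0 (F : T -> R) : (forall c, 0 <= F c) -> 0 <= avg F.
Proof. by move=> F0; rewrite -(avg_cst 0); apply: ler_avg. Qed.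

Lemma le_card_avg (F : T -> R) c : (forall c, 0 <= F c) -> F c <= #|T|%:R * avg F.
Proof.
move=> F0; rewrite /avg mulrCA divff// mulr1 (bigD1 c)//= lerDl.
exact: sumr_ge0.
Qed.

(** The example to keep in mind: X K is the average over the dyadic cube K of a
    locally integrable function. *)
Definition martingale (X : C -> R) := forall K, X K = avg (fun c => X (ch c K)).

Fixpoint level_avg m (F : C -> R) K : R :=
  if m is m'.+1 then avg (fun c => level_avg m' F (ch c K)) else F K.

Lemma ler_level_avg m (F G : C -> R) K : (forall K, F K <= G K) -> level_avg m F K <= level_avg m G K.
Proof. by move=> FG; elim: m K => [|m IH] K //=; apply: ler_avg => c; exact: IH. Qed.

Lemma level_avgD m (F G : C -> R) K :
  level_avg m (fun K => F K + G K) K = level_avg m F K + level_avg m G K.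
Proof.
elim: m K => [//|m IH] K /=; rewrite -avgD; apply: eq_avg => c; exact: IH.
Qed.

Lemma level_avgZ m a (F : C -> R) K : level_avg m (fun K => a * F K) K = a * level_avg m F K.
Proof.
elim: m K => [//|m IH] K /=; rewrite -avgZ; apply: eq_avg => c; exact: IH.
Qed.

Lemma level_avg_sumr m (I : finType) (F : I -> C -> R) K :
  level_avg m (fun K => \sum_i F i K) K = \sum_i level_avg m (F i) K.
Proof.
elim: m K => [//|m IH] K /=; rewrite -avg_sumr; apply: eq_avg => c; exact: IH.
Qed.

Lemma level_avg_martingale m (X : C -> R) K : martingale X -> level_avg m X K = X K.
Proof.
by move=> addX; elim: m K => [//|m IH] K /=; rewrite [RHS]addX; apply: eq_avg.
Qed.

Lemma level_avg_gt0 m (F : C -> R) K : (forall K, 0 < F K) -> 0 < level_avg m F K.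
Proof.
move=> F0; elim: m K => [//|m IH] K /=.
rewrite /avg divr_gt0//; have /card_gt0P[c _] := T_gt0.
rewrite (bigD1 c)//= ltr_wpDr ?IH// sumr_ge0// => i _; exact/ltW/IH.
Qed.

Section Paths.
Variable (b : C -> R).

(** With an indicator for F this is the distribution of the sum of b along a
    random branch below K, and with a power its moment. The accumulated sum t is an argument because
    inductions restart at inner nodes. *)
Fixpoint path_avg (F : R -> R) m t K : R :=
  if m is m'.+1 then avg (fun c => path_avg F m' (t + b K) (ch c K))
  else F (t + b K).

Lemma path_avg_le1 (P : R -> bool) m t K : path_avg (fun u => (P u)%:R) m t K <= 1.
Proof.
elim: m t K => [|m IH] t K /=; first by case: (P _).
by rewrite -[leRHS]avg_cst; apply: ler_avg.
Qed.

(** Phi is collected at the first node of each branch at which the running sum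
    exceeds h; its first argument is the depth that remains below that node. *)
Fixpoint stopsum h (Phi : nat -> C -> R) m v K : R :=
  if h < v + b K then Phi m K
  else if m is m'.+1 then avg (fun c => stopsum h Phi m' (v + b K) (ch c K))
  else 0.

Hypothesis b_ge0 : forall K, 0 <= b K.

Lemma path_avg_exceed h m v K : h < v + b K ->
  path_avg (fun u => (h < u)%R%:R) m v K = 1.
Proof.
elim: m v K => [|m IH] v K hv /=; first by rewrite hv.
rewrite -[RHS]avg_cst; apply: eq_avg => c; apply: IH.
by rewrite (lt_le_trans hv)// lerDl.
Qed.

Lemma stopsum1 h m v K :
  stopsum h (fun _ _ => 1) m v K = path_avg (fun u => (h < u)%R%:R) m v K.
Proof.
elim: m v K => [|m IH] v K /=; first by case: ifP.
case: ifPn => [hv|_]; last by apply: eq_avg => c; exact: IH.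
rewrite -[LHS]avg_cst; apply: eq_avg => c; rewrite path_avg_exceed//.
by rewrite (lt_le_trans hv)// lerDl.
Qed.

Lemma stopsumD h P Q m v K :
  stopsum h (fun m K => P m K + Q m K) m v K =
  stopsum h P m v K + stopsum h Q m v K.
Proof.
elim: m v K => [|m IH] v K /=; case: ifPn => // _; first by rewrite addr0.
by rewrite -avgD; apply: eq_avg => c; exact: IH.
Qed.

Lemma stopsumZ h a P m v K :
  stopsum h (fun m K => a * P m K) m v K = a * stopsum h P m v K.
Proof.
elim: m v K => [|m IH] v K /=; case: ifPn => // _; first by rewrite mulr0.
by rewrite -avgZ; apply: eq_avg => c; exact: IH.
Qed.

Lemma ler_stopsum h P Q m v K : (forall m K, P m K <= Q m K) ->
  stopsum h P m v K <= stopsum h Q m v K.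
Proof.
move=> PQ; elim: m v K => [|m IH] v K /=; case: ifPn => // _.
by apply: ler_avg => c; exact: IH.
Qed.

End Paths.

Section WeakType.
Variables (L : finType) (Psi : C -> R) (phi : L -> C -> R) (b : C -> R) (A : R).
Hypotheses (b_ge0 : forall K, 0 <= b K) (A_ge0 : 0 <= A).
Hypotheses (Psi_ge0 : forall K, 0 <= Psi K) (addPsi : martingale Psi).
Hypotheses (addphi : forall l, martingale (phi l)).
Hypothesis phi_le : forall l K, `|phi l K| <= Psi K.
Hypothesis b_le : forall K,
  b K <= A * \sum_l avg (fun c => (phi l (ch c K) - phi l K) ^+ 2).

Lemma avg_sqrB l K : avg (fun c => (phi l (ch c K) - phi l K) ^+ 2) =
  avg (fun c => phi l (ch c K) ^+ 2) - phi l K ^+ 2.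
Proof.
rewrite (eq_avg (G := fun c => phi l (ch c K) ^+ 2 +
    ((- 2 * phi l K) * phi l (ch c K) + phi l K ^+ 2))); last by move=> c; ring.
rewrite avgD avgD avg_cst avgZ -addphi; ring.
Qed.

(** Weak type (1,1) of the martingale square function. Psi
    exceeds h on a portion at most Psi(K)/h. Elsewhere u = 2 N h |L| Psi - sum_l phi_l^2 is a nonnegative potential: its
    drop from a node to the average over the children is the sum of the squared
    martingale differences, so u(K) bounds the mean of the square sum up to the
    first time that Psi exceeds h. The factor N = #|T| covers the overshoot, as
    Psi at a child is at most N times Psi at its parent. *)
Lemma weak_type_square m K h t : 0 < h -> 0 < t ->
  path_avg b (fun u => (t < u)%R%:R) m 0 K <=
  Psi K / h + A / t * (2 * #|T|%:R * h * #|L|%:R * Psi K).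
Proof.
move=> h0 t0; set N : R := #|T|%:R; set M : R := #|L|%:R.
have M0 : 0 <= M by rewrite ler0n.
have N1 : 1 <= N by rewrite ler1n.
have Nh0 : 0 <= N * h by rewrite mulr_ge0// ltW.
pose S K : R := \sum_l phi l K ^+ 2.
pose D K : R := \sum_l avg (fun c => (phi l (ch c K) - phi l K) ^+ 2).
pose u K : R := 2 * N * h * M * Psi K - S K.
have S_ge0 K' : 0 <= S K' by apply: sumr_ge0 => l _; exact: sqr_ge0.
have S_le K' : S K' <= M * Psi K' ^+ 2.
  rewrite /S /M mulr_natl -sumr_const; apply: ler_sum => l _.
  by rewrite -real_normK ?num_real// lerXn2r ?nnegrE.
have D_ge0 K' : 0 <= D K'.
  by apply: sumr_ge0 => l _; apply: avg_ge0 => c; exact: sqr_ge0.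
have u_ge0 K' : Psi K' <= N * h -> 0 <= u K'.
  move=> PK; rewrite /u subr_ge0 (le_trans (S_le K'))//.
  rewrite (_ : 2 * N * h * M * _ = M * (2 * (N * h) * Psi K')); last by ring.
  rewrite ler_wpM2l// expr2 ler_wpM2r//.
  by rewrite (le_trans PK)// ler_peMl// ler1n.
have avgu K' : avg (fun c => u (ch c K')) = u K' - D K'.
  rewrite /u avgB avgZ -addPsi /S avg_sumr /D.
  rewrite [X in _ = _ - X](eq_bigr _ (fun l _ => avg_sqrB l K')) sumrB; ring.
have At0 : 0 <= A / t by rewrite divr_ge0// ltW.
have Psi_ch K' c : Psi K' <= h -> Psi (ch c K') <= N * h.
  move=> Kh; apply: (le_trans (le_card_avg c (F := fun c => Psi (ch c K')) _)) => //.
  by rewrite -addPsi ler_pM2l.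
have uD K' : Psi K' <= h -> D K' <= u K'.
  by move=> Kh; rewrite -subr_ge0 -avgu; apply: avg_ge0 => c; exact/u_ge0/Psi_ch.
have vb v K' : (v + b K') / t <= v / t + A / t * u K' - (A / t * (u K' - D K')).
  rewrite -addrA -mulrBr opprB addrCA subrr addr0 mulrDl lerD2l.
  by rewrite mulrAC ler_pM2r ?invr_gt0.
have big m' v K' : 0 <= v -> Psi K' <= N * h -> h < Psi K' ->
    path_avg b (fun u => (t < u)%R%:R) m' v K' <= Psi K' / h + v / t + A / t * u K'.
  move=> v0 PK hK; apply: le_trans (path_avg_le1 _ _ _ _ _) _.
  have : 1 <= Psi K' / h by rewrite ler_pdivlMr// mul1r ltW.
  have : 0 <= v / t by rewrite divr_ge0// ltW.
  have : 0 <= A / t * u K' by rewrite mulr_ge0// u_ge0.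
  lra.
have P_ge0 K' : 0 <= Psi K' / h by rewrite divr_ge0// ltW.
have claim m' v K' : 0 <= v -> Psi K' <= N * h ->
    path_avg b (fun u => (t < u)%R%:R) m' v K' <= Psi K' / h + v / t + A / t * u K'.
  elim: m' v K' => [|m' IH] v K' v0 PK.
    have [hK|Kh] := ltP h (Psi K'); first exact: big.
    have u1 : 0 <= A / t * (u K' - D K') by rewrite mulr_ge0// subr_ge0 uD.
    move: (vb v K') (P_ge0 K'); rewrite /=.
    case: ltP => [tv|_] vb' P0; last first.
      by rewrite -addrA addr_ge0// addr_ge0 ?divr_ge0 ?(ltW t0)// mulr_ge0// u_ge0.
    have {}tv : 1 <= (v + b K') / t by rewrite ler_pdivlMr// mul1r ltW.
    by apply: (le_trans tv); move: vb'; lra.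
  have [hK|Kh] := ltP h (Psi K'); first exact: big.
  apply: (@le_trans _ _ (avg (fun c => Psi (ch c K') / h + (v + b K') / t +
      A / t * u (ch c K')))).
    by apply: ler_avg => c; apply: IH; [rewrite addr_ge0|exact: Psi_ch].
  rewrite avgD avgZ avgD avg_cst.
  rewrite (eq_avg (G := fun c => h^-1 * Psi (ch c K'))); last by move=> c; rewrite mulrC.
  rewrite avgZ -addPsi avgu mulrC.
  move: (vb v K'); lra.
have [hK|Kh] := ltP h (Psi K).
  apply: le_trans (path_avg_le1 _ _ _ _ _) _.
  have : 1 <= Psi K / h by rewrite ler_pdivlMr// mul1r ltW.
  have : 0 <= A / t * (2 * N * h * M * Psi K).
    by rewrite !mulr_ge0 ?invr_ge0 ?(ltW t0)// ltW.
  lra.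
have PN : Psi K <= N * h by rewrite (le_trans Kh)// ler_peMl// ltW.
apply: (le_trans (claim m 0 K (lexx _) PN)).
rewrite mul0r addr0 lerD2l ler_wpM2l// /u gerBl//.
Qed.

End WeakType.

Section Comparison.
Variables (b b' y : C -> R) (lam Ly : R).
Hypotheses (b_ge0 : forall K, 0 <= b K) (b'_ge0 : forall K, 0 <= b' K).
Hypotheses (lam_gt0 : 0 < lam) (Ly_gt0 : 0 < Ly).
Hypotheses (y_ge0 : forall K, 0 <= y K) (addy : martingale y).
Hypothesis b_le : forall K, y K < Ly -> b K <= lam * b' K.

(** As long as y < Ly the coefficients b are bounded by lam b', and y, being a
    nonnegative martingale, reaches Ly on a portion at most y(K)/Ly only. *)
Lemma path_avg_comparison m K t :
  path_avg b (fun u => (t < u)%R%:R) m 0 K <=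
  y K / Ly + path_avg b' (fun u => (t / lam < u)%R%:R) m 0 K.
Proof.
have y0 K' : 0 <= y K' / Ly by rewrite divr_ge0// ltW.
have pos m' v K' : 0 <= path_avg b' (fun u => (t / lam < u)%R%:R) m' v K'.
  elim: m' v K' => [|m' IH] v K' /=; first by rewrite ler0n.
  by apply: avg_ge0 => c; exact: IH.
have big m' v v' K' : Ly <= y K' ->
    path_avg b (fun u => (t < u)%R%:R) m' v K' <=
    y K' / Ly + path_avg b' (fun u => (t / lam < u)%R%:R) m' v' K'.
  move=> yK; apply: le_trans (path_avg_le1 _ _ _ _ _) _; apply: ler_wpDr => //.
  by rewrite ler_pdivlMr// mul1r.
have claim m' v v' K' : v <= lam * v' ->
    path_avg b (fun u => (t < u)%R%:R) m' v K' <=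
    y K' / Ly + path_avg b' (fun u => (t / lam < u)%R%:R) m' v' K'.
  elim: m' v v' K' => [|m' IH] v v' K' vv'.
    have [yK|Ky] := leP Ly (y K'); first exact: big.
    rewrite /=; case: ltP => [tv|_]; last by rewrite addr_ge0// ler0n.
    suff -> : t / lam < v' + b' K' by rewrite lerDr.
    rewrite ltr_pdivrMr// (lt_le_trans tv)// mulrC mulrDr lerD//.
    exact: b_le.
  have [yK|Ky] := leP Ly (y K'); first exact: big.
  rewrite /=; apply: (@le_trans _ _ (avg (fun c => Ly^-1 * y (ch c K') +
      path_avg b' (fun u => (t / lam < u)%R%:R) m' (v' + b' K') (ch c K')))).
    apply: ler_avg => c; rewrite [Ly^-1 * _]mulrC; apply: IH.
    by rewrite mulrDr lerD// b_le.
  by rewrite avgD avgZ -addy mulrC.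
by apply: claim; rewrite mulr0.
Qed.

End Comparison.

End TreeAverages.

(** * Power inequalities and the reverse Hoelder inequality on a tree *)

Section PowerInequalities.
Variable R : realType.
Implicit Types (a t s d r N : R).

(** Young's inequality, read as: the graph of the s-th power lies above its
    tangent at t. *)
Lemma powR_tangent a t s : 0 <= a -> 0 <= t -> 1 < s ->
  s * t `^ (s - 1) * a - (s - 1) * t `^ s <= a `^ s.
Proof.
move=> a0 t0 s1.
have s0 : 0 < s by rewrite (lt_trans _ s1).
have s10 : 0 < s - 1 by rewrite subr_gt0.
have q0 : 0 < s / (s - 1) by rewrite divr_gt0.
have sq : s^-1 + (s / (s - 1))^-1 = 1.
  by rewrite invf_div; field; rewrite gt_eqF.
have := conjugate_powR a0 (powR_ge0 t (s - 1)) s0 q0 sq.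
rewrite -powRrM mulrCA divff ?gt_eqF// mulr1 invf_div => H.
have {H} := ler_wpM2l (ltW s0) H.
rewrite (_ : s * (_ + _) = a `^ s + (s - 1) * t `^ s); last first.
  by field; rewrite gt_eqF.
lra.
Qed.

Lemma powR_le_affine r d : 0 <= r -> 0 < d < 1 -> r `^ d <= 1 + d * (r - 1).
Proof.
move=> r0 /andP[d0 d1].
have q0 : 0 < (1 - d)^-1 by rewrite invr_gt0 subr_gt0.
have dv0 : 0 < d^-1 by rewrite invr_gt0.
have dq : d^-1^-1 + (1 - d)^-1^-1 = 1 by rewrite !invrK addrC subrK.
have := conjugate_powR (powR_ge0 r d) ler01 dv0 q0 dq.
by rewrite -powRrM divff ?gt_eqF// powRr1// powR1 !invrK mulr1; lra.
Qed.

(** With r = u^2 one has ln r = 2 ln u <= 2 (u - 1), and r - 1 - 2 (u - 1) is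
    (u - 1)^2 = (r - 1)^2 / (u + 1)^2, where (u + 1)^2 <= 4 N. *)
Lemma ln_le_quadratic r N : 0 < r -> r <= N -> 1 <= N ->
  ln r <= r - 1 - (r - 1) ^+ 2 / (4 * N).
Proof.
move=> r0 rN N1.
set t := Num.sqrt r.
have t0 : 0 < t by rewrite sqrtr_gt0.
have rt : r = t ^+ 2 by rewrite sqr_sqrtr// ltW.
have -> : ln r = 2 * ln t by rewrite rt lnXn// mulr_natl.
have lnt : ln t <= t - 1.
  by rewrite -[X in ln X](subrK 1) [in leLHS]addrC le_ln1Dx// ltrBrDl subrr.
apply: (@le_trans _ _ (2 * (t - 1))); first by rewrite ler_pM2l.
rewrite -subr_ge0.
have -> : r - 1 - (r - 1) ^+ 2 / (4 * N) - 2 * (t - 1) =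
    (t - 1) ^+ 2 * (1 - (t + 1) ^+ 2 / (4 * N)).
  by rewrite rt; field; rewrite gt_eqF// (lt_le_trans _ N1).
rewrite mulr_ge0 ?sqr_ge0// subr_ge0 ler_pdivrMr ?mulr_gt0 ?(lt_le_trans _ N1)//.
rewrite mul1r; move: rN; rewrite rt => tN.
have := sqr_ge0 (t - 1); move: tN N1; rewrite !expr2; lra.
Qed.

(** The coefficient 3/2 has to exceed 1, and 5/4 times it has to be at most 2 for
    the iteration to close. *)
Lemma powRD_quasi (k : R) : 0 < k -> exists2 c, 0 <= c &
  forall t v, 0 <= t -> 0 <= v -> (t + v) `^ k <= 3 / 2 * t `^ k + c * v `^ k.
Proof.
move=> k0.
have [e e0 ek] : exists2 e : R, 0 < e & (1 + e) `^ k = 3 / 2.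
  have h1 : 1 < 3 / 2 :> R by lra.
  exists ((3 / 2) `^ k^-1 - 1).
    have := @gt0_ltr_powR R k^-1; rewrite invr_gt0 => /(_ k0 1 (3 / 2)).
    by rewrite !nnegrE powR1 subr_gt0; apply => //; lra.
  by rewrite addrC subrK -powRrM mulVf ?gt_eqF// powRr1//; lra.
have e1 : 0 <= 1 + e by lra.
have e2 : 0 <= e^-1 + 1 by rewrite addr_ge0// invr_ge0 ltW.
exists ((e^-1 + 1) `^ k) => [|t v t0 v0]; first exact: powR_ge0.
have [ve|ev] := leP v (e * t).
  apply: (@le_trans _ _ (((1 + e) * t) `^ k)).
    apply: ge0_ler_powR; rewrite ?nnegrE ?(ltW k0) ?addr_ge0 ?mulr_ge0//.
    by rewrite mulrDl mul1r lerD2l.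
  by rewrite powRM// ek lerDl mulr_ge0// powR_ge0.
apply: (@le_trans _ _ (((e^-1 + 1) * v) `^ k)).
  apply: ge0_ler_powR; rewrite ?nnegrE ?(ltW k0) ?addr_ge0 ?mulr_ge0//.
  by rewrite mulrDl mul1r lerD2r mulrC ler_pdivlMr// mulrC ltW.
by rewrite powRM// lerDr mulr_ge0// powR_ge0.
Qed.

(** For a martingale X below a node, x is a mean of X^(1/s), Sx and Sxs are the
    parts of the means of X^(1/s) and of its s-th power carried by stopped
    nodes, sg is their portion and RX is the mass of X outside them. The two
    families of tangent inequalities express Hoelder's inequality
    Sx^s <= Sxs sg^(s-1) and (x - Sx)^s <= RX. If Sx is at least x/2, the
    smallness of sg makes Sxs much larger than x^s; otherwise RX is at least
    (x/2)^s. *)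
Lemma sparse_gain (s x sg Sx Sxs RX eta: R) : 1 < s -> 0 <= x -> sg <= eta ->
  (s - 1) * (6 `^ (s - 1)^-1) `^ s * eta <= 1 ->
  (forall t, 0 <= t -> s * t `^ (s - 1) * Sx - (s - 1) * t `^ s * sg <= Sxs) ->
  (forall t, 0 <= t -> s * t `^ (s - 1) * (x - Sx) - (s - 1) * t `^ s <= RX) ->
  2 * x `^ s <= Sxs + 2 * 2 `^ s * RX.
Proof.
move=> s1 x0 sge Ls Hs HR; set L := 6 `^ (s - 1)^-1.
have s10 : 0 < s - 1 by rewrite subr_gt0.
have L0 : 0 <= L by exact: powR_ge0.
have s0 : 0 < s by lra.
have RX0 : 0 <= RX.
  by have := HR 0 (lexx _); rewrite !powR0 ?gt_eqF//; lra.
have Sxs0 : 0 <= Sxs.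
  by have := Hs 0 (lexx _); rewrite !powR0 ?gt_eqF//; lra.
have p2 : 0 < 2 `^ s :> R by rewrite powR_gt0.
have xs0 : 0 <= x `^ s by rewrite powR_ge0.
have [xS|Sx'] := leP (x / 2) Sx.
  (* L^(s-1) = 6 makes the linear term at least 3 x^s *)
  have := Hs (L * x) (mulr_ge0 L0 x0).
  rewrite !powRM// {1}/L -powRrM mulVf ?gt_eqF// powRr1//.
  have h1 : (s - 1) * (L `^ s * x `^ s) * sg <= x `^ s.
    apply: (@le_trans _ _ ((s - 1) * (L `^ s * x `^ s) * eta)).
      by rewrite ler_wpM2l// !mulr_ge0 ?powR_ge0// ltW.
    by rewrite -[leRHS]mul1r mulrA mulrAC ler_wpM2r.
  have h2 : 3 * x `^ s <= s * (6 * x `^ (s - 1)) * Sx.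
    apply: (@le_trans _ _ (s * (6 * x `^ (s - 1)) * (x / 2))); last first.
      by rewrite ler_wpM2l// !mulr_ge0 ?powR_ge0// ltW.
    rewrite (_ : s * _ * _ = s * (3 * (x * x `^ (s - 1)))); last by field.
    by rewrite mulr_powRB1// ler_peMl ?mulr_ge0// ltW.
  have h3 : 0 <= 2 * 2 `^ s * RX by rewrite !mulr_ge0// ltW.
  lra.
have x20 : 0 <= x / 2 by rewrite divr_ge0.
have := HR (x / 2) x20.
have : s * (x / 2) `^ (s - 1) * (x / 2) <= s * (x / 2) `^ (s - 1) * (x - Sx).
  by rewrite ler_wpM2l ?mulr_ge0 ?powR_ge0 ?(ltW s0)//; lra.
rewrite -mulrA [_ * (x / 2)]mulrC mulr_powRB1//.
rewrite powRM ?invr_ge0// => h1 h2.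
have {h1 h2} h : x `^ s * 2^-1 `^ s <= RX by lra.
have : 2 * 2 `^ s * (x `^ s * 2^-1 `^ s) <= 2 * 2 `^ s * RX.
  by rewrite ler_wpM2l// mulr_ge0// ltW.
have -> : 2 * 2 `^ s * (x `^ s * 2^-1 `^ s) = 2 * x `^ s * (2 * 2^-1) `^ s.
  by rewrite [(2 * 2^-1) `^ s]powRM ?invr_ge0 ?ler0n//; ring.
by rewrite divff// powR1 mulr1; lra.
Qed.

End PowerInequalities.

Section TreeTheorems.
Variables (R : realType) (T : finType) (C : Type) (ch : T -> C -> C).
Hypothesis T_gt0 : (0 < #|T|)%N.
Local Notation N := (#|T|%:R : R).

(** Up to the constant c, x is the exponential of the martingale y. The Bellman
    function 2 x^(1+d) - e^(2y) x^(d-1) lies between x^(1+d) and 2 x^(1+d), and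
    its average over the children does not exceed its value: the convexity
    defect of x^(1+d) is at most d x^(1+d) times the variance of the ratio of x
    at the children to x at the node, while the second term gains a multiple of
    this variance that stays away from 0 as d tends to 0, because y is a
    martingale and ln is strictly concave. *)
Lemma tree_reverse_hoelder (x y : C -> R) (c d : R) :
  martingale ch x -> martingale ch y -> (forall K, 0 < x K) ->
  (forall K, y K <= ln (x K) <= c + y K) ->
  0 < d <= 2^-1 -> d * (16 * N * expR (2 * c)) <= 1 ->
  forall m K, level_avg ch m (fun K => x K `^ (1 + d)) K <= 2 * x K `^ (1 + d).
Proof.
move=> addx addy x0 xy /andP[d0 d12] dN.
have N1 : 1 <= N by rewrite ler1n.
have N0 : 0 < N by rewrite (lt_le_trans _ N1).
(* F is the Bellman function, and E the logarithm of its second term *)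
pose E K := 2 * y K - (1 - d) * ln (x K).
pose F K := 2 * x K `^ (1 + d) - expR (E K).
have xE K : x K `^ (1 + d) = expR ((1 + d) * ln (x K)) by rewrite /powR gt_eqF.
have F_ge K : x K `^ (1 + d) <= F K.
  suff : expR (E K) <= x K `^ (1 + d) by rewrite /F; lra.
  by rewrite xE ler_expR /E; have := xy K; lra.
have F_avg K : avg (fun c => F (ch c K)) <= F K.
  pose r c := x (ch c K) / x K.
  have r0 c' : 0 < r c' by rewrite divr_gt0.
  have rN c' : r c' <= N.
    rewrite ler_pdivrMr// [X in _ * X]addx.
    by apply: (le_card_avg T_gt0 c' (F := fun c => x (ch c K))) => c''; exact: ltW.
  have avgr : avg r = 1.
    rewrite (eq_avg (G := fun c => (x K)^-1 * x (ch c K))); last by move=> ?; rewrite mulrC.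
    by rewrite avgZ -addx mulVf ?gt_eqF.
  set P := x K `^ (1 + d).
  have P0 : 0 < P by rewrite powR_gt0.
  pose D := avg (fun c => (r c - 1) ^+ 2).
  have D0 : 0 <= D by apply: avg_ge0 => // ?; exact: sqr_ge0.
  have xP c' : x (ch c' K) `^ (1 + d) <= P * (r c' + d * ((r c' - 1) + (r c' - 1) ^+ 2)).
    have -> : x (ch c' K) = x K * r c' by rewrite /r mulrCA divff ?gt_eqF// mulr1.
    rewrite powRM ?(ltW (r0 _)) ?(ltW (x0 _))// ler_pM2l//.
    rewrite powRD ?(gt_eqF (r0 _)) ?implybT// powRr1 ?(ltW (r0 _))//.
    have d01 : 0 < d < 1 by apply/andP; lra.
    have := ler_wpM2l (ltW (r0 c')) (@powR_le_affine _ _ _ (ltW (r0 c')) d01).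
    by move=> /le_trans; apply; rewrite le_eqVlt; apply/orP; left; apply/eqP; ring.
  have EE c' : expR (E K) * (1 + (2 * (y (ch c' K) - y K) -
      (1 - d) * (r c' - 1) + (1 - d) / (4 * N) * (r c' - 1) ^+ 2)) <= expR (E (ch c' K)).
    have -> : expR (E (ch c' K)) = expR (E K) * expR (E (ch c' K) - E K).
      by rewrite -expRD [E K + _]addrC subrK.
    rewrite ler_pM2l ?expR_gt0//.
    apply: le_trans (expR_ge1Dx _); rewrite lerD2l /E.
    have -> : ln (x (ch c' K)) = ln (x K) + ln (r c').
      rewrite -lnM ?posrE//; congr ln.
      by rewrite /r mulrCA divff ?gt_eqF// mulr1.
    have := @ln_le_quadratic _ _ _ (r0 c') (rN c') N1.
    have d1 : 0 <= 1 - d by lra.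
    by move=> /(ler_wpM2l d1); lra.
  have avgx : avg (fun c => x (ch c K) `^ (1 + d)) <= P * (1 + d * D).
    apply: (@le_trans _ _ (avg (fun c => P * (r c + d * ((r c - 1) + (r c - 1) ^+ 2))))).
      exact: ler_avg.
    by rewrite avgZ avgD avgZ avgD avgB (avg_cst T_gt0) avgr subrr add0r.
  have avgE : expR (E K) * (1 + (1 - d) / (4 * N) * D) <= avg (fun c => expR (E (ch c K))).
    apply: le_trans; last by apply: (ler_avg T_gt0) => c'; exact: EE.
    rewrite avgZ !avgD avgN avgZ avgB !(avg_cst T_gt0) -addy avgZ avgB (avg_cst T_gt0) avgr avgZ.
    by rewrite !subrr !mulr0 subrr add0r.
  have EP : P * expR (- (2 * c)) <= expR (E K).
    by rewrite /P xE -expRD ler_expR /E; have := xy K; lra.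
  rewrite avgB avgZ /F -/P.
  have key : 2 * P * d * D <= expR (E K) * ((1 - d) / (4 * N) * D).
    rewrite [leRHS]mulrA ler_wpM2r//.
    apply: le_trans (ler_wpM2r _ EP); last first.
      by rewrite divr_ge0 ?mulr_ge0 ?(ltW N0)//; lra.
    rewrite [2 * P]mulrC -!mulrA ler_pM2l// expRN.
    have e0 := expR_gt0 (2 * c).
    rewrite ler_pdivlMl// ler_pdivlMr ?mulr_gt0//.
    move: dN; set Z := expR _; rewrite (_ : d * _ = 2 * (Z * (2 * d) * (4 * N))); last by ring.
    lra.
  lra.
move=> m K; apply: (@le_trans _ _ (F K)); last by rewrite gerBl expR_ge0.
elim: m K => [|m IH] K //=; apply: le_trans (F_avg K).
by apply: (ler_avg T_gt0) => c'; exact: IH.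
Qed.

End TreeTheorems.

(** * From small exceptional sets to a strong bound *)

Section TreePrinciple.
Variables (R : realType) (T : finType) (C : Type) (ch : T -> C -> C).
Hypothesis T_gt0 : (0 < #|T|)%N.
Variables (X : C -> R) (s : R).
Hypotheses (X_gt0 : forall K, 0 < X K) (martX : martingale ch X) (s_gt1 : 1 < s).

(** In the application X is the average of g^(p') and s = p'/r, and this mean
    stands for the average of g^r, which it dominates. *)
Definition root_avg m K := level_avg ch m (fun K => X K `^ s^-1) K.

Lemma root_avg_gt0 m K : 0 < root_avg m K.
Proof. by apply: level_avg_gt0 => // K'; rewrite powR_gt0. Qed.

Lemma root_avg0 K : root_avg 0 K `^ s = X K.
Proof.
have s0 : s != 0 by rewrite gt_eqF// (lt_trans _ s_gt1).
by rewrite /root_avg /= -powRrM mulVf// powRr1// ltW.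
Qed.

(** Hoelder's inequality on the branches that are never stopped, in tangent
    form. *)
Lemma stopsum_rest (b : C -> R) h m v K t : 0 <= t ->
  s * t `^ (s - 1) * (root_avg m K - stopsum ch b h root_avg m v K) - (s - 1) * t `^ s
  <= X K - stopsum ch b h (fun _ => X) m v K.
Proof.
move=> t0; have s0 : 0 <= s - 1 by rewrite subr_ge0 ltW.
elim: m v K => [|m IH] v K; rewrite [stopsum ch b h root_avg _ _ _]/=
  [stopsum ch b h (fun _ => X) _ _ _]/=; case: ifP => _.
- by rewrite !subrr mulr0 sub0r oppr_le0 mulr_ge0 ?powR_ge0.
- by rewrite !subr0 -[leRHS]root_avg0 powR_tangent// ltW// root_avg_gt0.
- by rewrite !subrr mulr0 sub0r oppr_le0 mulr_ge0 ?powR_ge0.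
rewrite martX -avgB [root_avg _ _]/= -avgB -avgZ -[X in _ - X](avg_cst T_gt0) -avgB.
by apply: (ler_avg T_gt0) => c; exact: IH.
Qed.

(** Hoelder's inequality on the stopped nodes, in tangent form. *)
Lemma stopsum_tangent (b : C -> R) h m v K t : (forall K, 0 <= b K) -> 0 <= t ->
  s * t `^ (s - 1) * stopsum ch b h root_avg m v K -
    (s - 1) * t `^ s * path_avg ch b (fun u => (h < u)%R%:R) m v K
  <= stopsum ch b h (fun m K => root_avg m K `^ s) m v K.
Proof.
move=> b0 t0; rewrite -stopsum1// -mulNr -!stopsumZ -stopsumD.
apply: ler_stopsum => // m' K'; rewrite mulr1.
by rewrite powR_tangent// ltW// root_avg_gt0.
Qed.

Variables (b : C -> R) (k A eta c0 : R).
Hypotheses (b_ge0 : forall K, 0 <= b K) (k_gt0 : 0 < k) (A_ge0 : 0 <= A).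
Hypotheses (eta8 : eta <= 8^-1).
Hypothesis etaL : (s - 1) * (6 `^ (s - 1)^-1) `^ s * eta <= 1.
Hypothesis c0_ge0 : 0 <= c0.
Hypothesis powD : forall t v, 0 <= t -> 0 <= v ->
  (t + v) `^ k <= 3 / 2 * t `^ k + c0 * v `^ k.
Let thr m K := A * root_avg m K `^ (s / k).
Hypothesis small : forall m K,
  path_avg ch b (fun u => (thr m K < u)%R%:R) m 0 K <= eta.

(** Below a node, stop where the sum exceeds h, the threshold thr of the node.
    Before that, the sum is at most t + h; the k-th power of what is added later
    is controlled by induction at the stopped nodes, of portion at most
    eta <= 1/8. The induction carries the term - x^s in the claim P below: the
    cost c0 h^k of the threshold is proportional to x^s, and sparse_gain pays
    for it with the masses of X and the powers x^s at the stopped nodes. *)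
Lemma stopping_iteration : forall m K, path_avg ch b (fun u => u `^ k) m 0 K <=
  5 / 4 * (c0 * A `^ k) * (2 * 2 `^ s) * X K.
Proof.
have s1 := s_gt1; have e8 := eta8; have s0 : 0 < s by lra.
have ek : 5 / 4 * (c0 * A `^ k) >= 0 by rewrite !mulr_ge0 ?powR_ge0//; lra.
pose B1 := 5 / 4 * (c0 * A `^ k).
pose B := 2 * 2 `^ s : R.
have B0 : 2 <= B.
  have : 2 `^ 0 <= 2 `^ s :> R by apply: ler_powR; rewrite ?ler1n// ltW.
  by rewrite powRr0 /B; lra.
pose P m := forall K t, 0 <= t -> path_avg ch b (fun u => u `^ k) m t K <=
   2 * t `^ k + B1 * (B * X K - root_avg m K `^ s).
(* the induction hypothesis summed over the stopped nodes; v is the part of the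
   running sum gathered since the starting node *)
have inner m0 h t : (forall m, (m <= m0)%N -> P m) -> 0 <= t -> 0 <= h ->
  forall m v K, (m <= m0)%N -> 0 <= v -> v <= h ->
  path_avg ch b (fun u => u `^ k) m (t + v) K <=
  (t + h) `^ k + 2 * (t + h) `^ k * path_avg ch b (fun u => (h < u)%R%:R) m v K
  + B1 * (B * stopsum ch b h (fun _ => X) m v K
          - stopsum ch b h (fun m K => root_avg m K `^ s) m v K).
  move=> HP t0 h0; have th0 : 0 <= (t + h) `^ k by rewrite powR_ge0.
  have pmon v : 0 <= v -> v <= h -> (t + v) `^ k <= (t + h) `^ k.
    move=> v0 vh; apply: ge0_ler_powR; rewrite ?nnegrE ?addr_ge0 ?lerD2l//.
    exact: ltW.
  have stop m v K : (m <= m0)%N -> 0 <= v -> v <= h -> h < v + b K ->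
     path_avg ch b (fun u => u `^ k) m (t + v) K <=
     (t + h) `^ k + 2 * (t + h) `^ k + B1 * (B * X K - root_avg m K `^ s).
    move=> mm v0 vh _; apply: (le_trans (HP _ mm K _ (addr_ge0 t0 v0))).
    by have := pmon _ v0 vh; lra.
  elim=> [|m IH] v K mm v0 vh.
    have := stop 0%N v K mm v0 vh; rewrite /=; case: ltP => [hv /(_ isT)|hv _].
      by rewrite mulr1.
    by rewrite !mulr0 !addr0 subrr mulr0 addr0 -addrA pmon// addr_ge0.
  have [hv|hv] := ltP h (v + b K).
    have := stop _ _ _ mm v0 vh hv.
    by rewrite path_avg_exceed// mulr1 /= hv.
  rewrite /= ltNge hv/=.
  apply: (@le_trans _ _ (avg (fun c => (t + h) `^ k +
      2 * (t + h) `^ k * path_avg ch b (fun u => (h < u)%R%:R) m (v + b K) (ch c K)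
      + B1 * (B * stopsum ch b h (fun _ => X) m (v + b K) (ch c K)
          - stopsum ch b h (fun m K => root_avg m K `^ s) m (v + b K) (ch c K))))).
    by apply: (ler_avg T_gt0) => c; rewrite -addrA; apply: IH => //; rewrite ?addr_ge0// ltnW.
  by rewrite !avgD (avg_cst T_gt0) !avgZ avgB avgZ.
have HP m1 : P m1.
  elim/ltn_ind: m1 => m1 IH K1 t t0.
  set h := thr m1 K1.
  have h0 : 0 <= h by rewrite mulr_ge0// powR_ge0.
  have hk : h `^ k = A `^ k * root_avg m1 K1 `^ s.
    by rewrite /h /thr powRM ?powR_ge0// -powRrM divfK// gt_eqF.
  have bK : b K1 <= h.
    rewrite leNgt; apply/negP => hb; have := small m1 K1.
    by rewrite path_avg_exceed ?add0r// => /le_trans/(_ eta8); lra.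
  have x0 := root_avg_gt0 m1 K1.
  have gain := sparse_gain s_gt1 (ltW x0) (small m1 K1) etaL
    (fun t => @stopsum_tangent b h m1 0 K1 t b_ge0) (@stopsum_rest b h m1 0 K1).
  have pm : (t + h) `^ k <= 3 / 2 * t `^ k + c0 * h `^ k by exact: powD.
  have p0 : 0 <= (t + h) `^ k by rewrite powR_ge0.
  have step : path_avg ch b (fun u => u `^ k) m1 t K1 <=
    (t + h) `^ k + 2 * (t + h) `^ k * path_avg ch b (fun u => (h < u)%R%:R) m1 0 K1
    + B1 * (B * stopsum ch b h (fun _ => X) m1 0 K1
          - stopsum ch b h (fun m K => root_avg m K `^ s) m1 0 K1).
    (* the starting node itself is not stopped (bK), so every stopped node has
       smaller depth and the induction hypothesis applies to it *)
    case: m1 @h h0 hk bK {x0 gain} pm p0 IH => [|m1] h h0 hk bK pm p0 IH.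
      rewrite /= add0r ltNge bK/= mulr0 addr0 mulr0 subrr mulr0 addr0.
      by apply: ge0_ler_powR; rewrite ?nnegrE ?addr_ge0 ?lerD2l// ltW.
    rewrite /= add0r ltNge bK/=.
    apply: (@le_trans _ _ (avg (fun c => (t + h) `^ k +
      2 * (t + h) `^ k * path_avg ch b (fun u => (h < u)%R%:R) m1 (b K1) (ch c K1)
      + B1 * (B * stopsum ch b h (fun _ => X) m1 (b K1) (ch c K1)
          - stopsum ch b h (fun m K => root_avg m K `^ s) m1 (b K1) (ch c K1))))).
      by apply: (ler_avg T_gt0) => c; apply: (inner m1) => // m1' mm; apply: IH.
    by rewrite !avgD (avg_cst T_gt0) !avgZ avgB avgZ.
  apply: (le_trans step).
  set sg := path_avg ch b (fun u => (h < u)%R%:R) m1 0 K1.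
  have sg8 : sg <= 8^-1 by rewrite (le_trans (small m1 K1)).
  have e1 : 2 * (t + h) `^ k * sg <= (t + h) `^ k * 4^-1.
    have := ler_wpM2l p0 sg8; lra.
  have e2 : 5 / 4 * (c0 * h `^ k) = B1 * root_avg m1 K1 `^ s.
    by rewrite hk /B1; ring.
  have e3 := ler_wpM2l ek gain; rewrite -/B1 -/B in e3.
  have t0k : 0 <= t `^ k by rewrite powR_ge0.
  move: e1 e2 e3 pm; lra.
move=> m K; apply: le_trans (HP m K 0 (lexx _)) _.
rewrite powR0 ?gt_eqF// mulr0 add0r -[leRHS]mulrA ler_wpM2l//.
by rewrite gerBl powR_ge0.
Qed.

End TreePrinciple.

(** * Complex vectors and functions of a positive matrix *)

Section ComplexVectors.
Variable R : realType.
Local Notation normc := ComplexField.Normc.normc.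

Lemma sqr_normc_Re_Im (z : R[i]) : normc z ^+ 2 = complex.Re z ^+ 2 + complex.Im z ^+ 2.
Proof. by case: z => a b /=; rewrite sqr_sqrtr// addr_ge0// sqr_ge0. Qed.

Lemma normc_ge0 (z : R[i]) : 0 <= normc z.
Proof. by case: z => a b /=; rewrite sqrtr_ge0. Qed.

Lemma normc_conj (z : R[i]) : normc (z^*)%C = normc z.
Proof. by case: z => a b /=; rewrite sqrrN. Qed.

Lemma normc_sum (I : Type) (r : seq I) (F : I -> R[i]) :
  normc (\sum_(i <- r) F i) <= \sum_(i <- r) normc (F i).
Proof.
elim/big_ind2 : _ => //; first by rewrite ComplexField.Normc.normc0.
by move=> x y z t xy zt; rewrite (le_trans (le_normcD _ _))// lerD.
Qed.

Lemma sumr_sqr_CS (I : finType) (a b : I -> R) :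
  (\sum_i a i * b i) ^+ 2 <= (\sum_i a i ^+ 2) * (\sum_i b i ^+ 2).
Proof.
set S := \sum_i a i * b i; set A := \sum_i a i ^+ 2; set B := \sum_i b i ^+ 2.
have B0 : 0 <= B by apply: sumr_ge0 => i _; rewrite sqr_ge0.
have := B0; rewrite le_eqVlt => /predU1P[B00|Bgt0].
  have b0 i : b i = 0.
    apply/eqP; rewrite -sqrf_eq0; apply/eqP.
    by move/esym/psumr_eq0P : B00 => /(_ (fun i _ => sqr_ge0 _)); exact.
  by rewrite /S big1 ?expr0n ?mulr_ge0//= => [|i _]; rewrite ?b0 ?mulr0//;
    apply: sumr_ge0 => i _; rewrite sqr_ge0.
have : 0 <= \sum_i (B * a i - S * b i) ^+ 2 by apply: sumr_ge0 => i _; rewrite sqr_ge0.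
rewrite (eq_bigr (fun i => B ^+ 2 * a i ^+ 2 + (- (2 * B * S) * (a i * b i)
    + S ^+ 2 * b i ^+ 2))); last by move=> i _; ring.
rewrite !big_split/= -!mulr_sumr -/A -/B -/S.
rewrite (_ : _ + _ = B * (A * B - S ^+ 2)); last by ring.
by rewrite pmulr_rge0// subr_ge0.
Qed.

Section Vectors.
Variable n : nat.
Implicit Types u v e : 'cV[R[i]]_n.

Lemma cnorm_ge0 v : 0 <= cnorm v.
Proof. exact: sqrtr_ge0. Qed.

Lemma sqr_cnorm v : cnorm v ^+ 2 = \sum_i normc (v i 0) ^+ 2.
Proof. by rewrite sqr_sqrtr// sumr_ge0// => i _; rewrite sqr_ge0. Qed.

Lemma normc_le_cnorm v i : normc (v i 0) <= cnorm v.
Proof.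
rewrite -(@ler_pXn2r _ 2)// ?nnegrE ?cnorm_ge0 ?normc_ge0// sqr_cnorm.
by rewrite (bigD1 i)//= lerDl sumr_ge0// => j _; rewrite sqr_ge0.
Qed.

Lemma cnorm0 : cnorm (0 : 'cV[R[i]]_n) = 0.
Proof.
by rewrite /cnorm big1 ?sqrtr0// => i _; rewrite mxE ComplexField.Normc.normc0 expr0n.
Qed.

Lemma cnorm_gt0 v : v != 0 -> 0 < cnorm v.
Proof.
apply: contraNT; rewrite -leNgt => v0; apply/eqP/matrixP => i j.
rewrite ord1 mxE; apply: ComplexField.Normc.eq0_normc; apply/eqP; rewrite eq_le normc_ge0 andbT.
exact: le_trans (normc_le_cnorm v i) v0.
Qed.

Lemma cnorm_neq0 v : 0 < cnorm v -> v != 0.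
Proof. by apply: contraTneq => ->; rewrite cnorm0 ltxx. Qed.

Lemma cnorm_real_scale (a : R) v : cnorm (a%:C *: v) = `|a| * cnorm v.
Proof.
rewrite /cnorm; under eq_bigr do rewrite mxE ComplexField.Normc.normcM exprMn.
rewrite -mulr_sumr sqrtrM ?sqr_ge0//= expr0n/= addr0 !sqrtr_sqr normr_id//.
Qed.

Definition cdot u v : R[i] := (u^t*%sesqui *m v) 0 0.

Lemma cdotE u v : cdot u v = \sum_i (u i 0)^*%C * v i 0.
Proof. by rewrite /cdot mxE; apply: eq_bigr => i _; rewrite !mxE. Qed.

Lemma cdot_CS u v : normc (cdot u v) <= cnorm u * cnorm v.
Proof.
have -> : cnorm u * cnorm v = Num.sqrt ((\sum_i normc (u i 0) ^+ 2) * (\sum_i normc (v i 0) ^+ 2)).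
  by rewrite -!sqr_cnorm sqrtrM ?sqr_ge0// !sqrtr_sqr !ger0_norm ?cnorm_ge0.
rewrite cdotE (le_trans (normc_sum _ _))//.
rewrite (eq_bigr (fun i => normc (u i 0) * normc (v i 0))); last first.
  by move=> i _; rewrite ComplexField.Normc.normcM normc_conj.
set S := \sum_i _; have S0 : 0 <= S.
  by apply: sumr_ge0 => i _; rewrite mulr_ge0 ?normc_ge0.
rewrite -(ger0_norm S0).
by rewrite -sqrtr_sqr; apply: ler_wsqrtr; exact: sumr_sqr_CS.
Qed.

Lemma cdotvv v : cdot v v = (cnorm v ^+ 2)%:C.
Proof.
rewrite cdotE sqr_cnorm raddf_sum/=; apply: eq_bigr => i _.
rewrite sqr_normc_Re_Im; case: (v i 0) => a b.
by apply/eqP; rewrite eq_complex /=; apply/andP; split; apply/eqP; ring.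
Qed.

Lemma cdot_delta (j : 'I_n) v : cdot (delta_mx j 0) v = v j 0.
Proof.
rewrite cdotE (bigD1 j)//= mxE !eqxx/= big1 ?addr0; last first.
  by move=> i ij; rewrite mxE (negbTE ij)/= oppr0 mul0r.
by rewrite oppr0 mul1r.
Qed.

Lemma cnorm_delta (j : 'I_n) : cnorm (delta_mx j 0 : 'cV[R[i]]_n) = 1.
Proof.
rewrite /cnorm (bigD1 j)//= mxE !eqxx/= big1 ?addr0; last first.
  by move=> i ij; rewrite mxE (negbTE ij)/= expr0n/= addr0 sqrtr0 expr0n.
by rewrite expr0n/= addr0 expr1n sqrtr1 expr1n sqrtr1.
Qed.

Lemma cdot_adj (A : 'M[R[i]]_n) u v : cdot (A *m u) v = cdot u (A^t*%sesqui *m v).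
Proof. by rewrite /cdot trmx_mul map_mxM mulmxA. Qed.

(** The operator norm is at most the Hilbert-Schmidt norm, which only involves
    the images of the basis vectors. *)
Lemma sqr_cnorm_mul_le (M : 'M[R[i]]_n) u :
  cnorm (M *m u) ^+ 2 <= (\sum_j cnorm (M *m delta_mx j 0) ^+ 2) * cnorm u ^+ 2.
Proof.
have colE j i : (M *m (delta_mx j 0 : 'cV_n)) i 0 = M i j.
  by rewrite -colE mxE.
under eq_bigr do rewrite sqr_cnorm.
rewrite exchange_big/= sqr_cnorm mulr_suml; apply: ler_sum => i _.
rewrite [X in normc X]mxE; rewrite sqr_cnorm.
under [X in _ <= X * _]eq_bigr do rewrite colE.
apply: le_trans (sumr_sqr_CS _ _).
have S0 : 0 <= \sum_j normc (M i j) * normc (u j 0).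
  by apply: sumr_ge0 => j _; rewrite mulr_ge0 ?normc_ge0.
rewrite lerXn2r ?nnegrE ?normc_ge0//.
rewrite (le_trans (normc_sum _ _))//; apply: ler_sum => j _.
by rewrite ComplexField.Normc.normcM.
Qed.

End Vectors.

Section Matrices.
Variable n : nat.
Implicit Types A : 'M[R[i]]_n.

Definition selfadjoint A := A^t*%sesqui = A.

Lemma hermsymmx_selfadjoint A : A \is hermsymmx -> selfadjoint A.
Proof. by move/is_hermitianmxP => hA; rewrite /selfadjoint [RHS]hA expr0 scale1r. Qed.

Lemma cdot_selfadjoint A u v : selfadjoint A -> cdot (A *m u) v = cdot u (A *m v).
Proof. by move=> sA; rewrite cdot_adj sA. Qed.

Lemma posdef_unit A : posdefmx A -> A \in unitmx.
Proof.
case=> hA pA; rewrite -row_free_unit -kermx_eq0; apply/negPn/negP => /rowV0Pn[v].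
move=> /sub_kermxP vA v0.
have /pA : v^t*%sesqui != 0 by rewrite map_mx_eq0 trmx_eq0.
by rewrite trmxCK vA mul0mx mxE ltxx.
Qed.

Lemma selfadjoint_inv A : A \in unitmx -> selfadjoint A -> selfadjoint (invmx A).
Proof. by move=> uA sA; rewrite /selfadjoint trmx_inv map_invmx sA. Qed.

Definition fcalc (phi : R -> R) A : 'M[R[i]]_n := let P := spectralmx A in
  invmx P *m diag_mx (map_mx (fun z => (phi (complex.Re z))%:C) (spectral_diag A)) *m P.

Lemma powmx_fcalc A s : powmx A s = fcalc (fun t => t `^ s) A.
Proof. by []. Qed.

Definition eigv A (j : 'I_n) : R := complex.Re (spectral_diag A 0 j).

(** The values of phi at the eigenvalues enter linearly, so that limits in phi
    pass to the matrix entries. *)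
Lemma fcalcE phi A i j : fcalc phi A i j =
  \sum_l (phi (eigv A l))%:C * (invmx (spectralmx A) i l * spectralmx A l j).
Proof.
rewrite /fcalc mxE; apply: eq_bigr => l _; rewrite mul_mx_diag !mxE.
by rewrite mulrAC mulrC.
Qed.

Lemma fcalcM phi psi A :
  fcalc (fun t => phi t * psi t) A = fcalc phi A *m fcalc psi A.
Proof.
rewrite /fcalc -!mulmxA; congr (_ *m _).
rewrite [spectralmx A *m _]mulmxA mulmxV ?spectral_unit// mul1mx !mulmxA.
congr (_ *m _); rewrite mulmx_diag; congr diag_mx.
by apply/rowP => j; rewrite !mxE rmorphM.
Qed.

Lemma fcalc_cst a A : fcalc (fun=> a) A = a%:C%:M.
Proof.
rewrite /fcalc (_ : map_mx _ _ = const_mx a%:C); last by apply/rowP => j; rewrite !mxE.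
by rewrite diag_const_mx mul_mx_scalar -scalemxAl mulVmx ?spectral_unit// scalemx1.
Qed.

Lemma fcalc_id A : A \is hermsymmx -> fcalc id A = A.
Proof.
move=> hA; rewrite [RHS](orthomx_spectralP (hermitian_normalmx hA)) /fcalc.
congr (_ *m diag_mx _ *m _); apply/rowP => j; rewrite !mxE.
have /mxOverP/(_ 0 j) := hermitian_spectral_diag_real hA.
exact: RRe_real.
Qed.

Lemma fcalc_selfadjoint phi A : selfadjoint (fcalc phi A).
Proof.
rewrite /selfadjoint /fcalc invmx_unitary ?spectral_unitarymx//.
rewrite !trmx_mul !map_mxM tr_diag_mx map_diag_mx trmxCK mulmxA.
congr (_ *m diag_mx _ *m _); apply/rowP => j; rewrite !mxE; exact: conjc_real.
Qed.

Lemma eigv_gt0 A j : posdefmx A -> 0 < eigv A j.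
Proof.
case=> hA pA; pose P := spectralmx A.
have uP : P \in unitmx by exact: spectral_unit.
have dA := orthomx_spectralP (hermitian_normalmx hA).
pose v : 'cV[R[i]]_n := invmx P *m delta_mx j 0.
have v0 : v != 0.
  apply/eqP => /(congr1 (mulmx P)); rewrite mulKVmx// mulmx0 => /matrixP/(_ j 0).
  by rewrite !mxE !eqxx/= => /eqP; rewrite oner_eq0.
have := pA v v0; rewrite [X in _ *m X *m _]dA -/P /v trmx_mul map_mxM -!mulmxA mulKVmx//.
rewrite {1}invmx_unitary ?spectral_unitarymx// trmxCK.
rewrite mulKVmx//.
rewrite -[X in 0 < X -> _]/(cdot _ _) cdot_delta mul_diag_mx mxE mxE !eqxx mulr1 ltcE.
by case/andP.
Qed.

Lemma eq_fcalc phi psi A : posdefmx A -> (forall t, 0 < t -> phi t = psi t) ->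
  fcalc phi A = fcalc psi A.
Proof.
move=> pA e; apply/matrixP => i j; rewrite !fcalcE; apply: eq_bigr => l _.
by rewrite e// eigv_gt0.
Qed.

Lemma powmxN_mul A s : posdefmx A -> powmx A s *m powmx A (- s) = 1%:M.
Proof.
move=> pA; rewrite !powmx_fcalc -fcalcM -[1%:M](fcalc_cst 1 A); apply: eq_fcalc => // t t0.
by rewrite powRN mulfV// gt_eqF// powR_gt0.
Qed.

Lemma powmx_unit A s : posdefmx A -> powmx A s \in unitmx.
Proof. move=> pA; exact: (mulmx1_unit (powmxN_mul s pA)).1. Qed.

(** The duality between W^(1/p) and W^(-1/p). *)
Lemma cdot_powmx A s e v : posdefmx A ->
  cdot e v = cdot (powmx A (- s) *m e) (powmx A s *m v).
Proof.
move=> pA; rewrite (cdot_selfadjoint _ _ (fcalc_selfadjoint (fun t => t `^ (- s)) A)).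
have := powmxN_mul (- s) pA; rewrite opprK => h.
by rewrite mulmxA h mul1mx.
Qed.

Lemma cnorm_mul_gt0 A e : A \in unitmx -> e != 0 -> 0 < cnorm (A *m e).
Proof.
move=> uA e0; apply: cnorm_gt0; apply: contra e0 => /eqP Ae.
by rewrite -[e](mulKmx uA) Ae mulmx0.
Qed.

End Matrices.
End ComplexVectors.

(** * Measurability of the powers of a matrix weight *)

Section NewtonLogarithm.
Variable R : realType.

(** Newton's iteration for ln t, written for the error: after one step the error
    is nonnegative, then it decreases, and its limit is a fixed point. *)
Lemma newton_cvg0 (u : R^nat) :
  (forall k, u k.+1 = u k - 1 + expR (- u k)) -> u @ \oo --> 0.
Proof.
move=> uS.
have pos k : 0 <= u k.+1.
  by rewrite uS; have := expR_ge1Dx (- u k); lra.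
have dec k : u k.+2 <= u k.+1.
  have : expR (- u k.+1) <= 1 by rewrite -expR0 ler_expR oppr_le0.
  by rewrite [u k.+2]uS; lra.
pose v := [sequence u (k + 1)%N]_k.
have vE k : v k = u k.+1 by rewrite /v /= addn1.
rewrite -(cvg_shiftn 1) -/v.
have cv : cvgn v.
  apply: nonincreasing_is_cvgn.
    by apply/nonincreasing_seqP => k; rewrite !vE.
  by exists 0 => _ [k _ <-]; rewrite vE.
set l := limn v; have vl : v @ \oo --> l by [].
suff l0 : l = 0 by move: vl; rewrite l0; apply.
have v1 : [sequence v (k + 1)%N]_k @ \oo --> l by rewrite (cvg_shiftn 1).
have v2 : [sequence v (k + 1)%N]_k @ \oo --> l - 1 + expR (- l).
  rewrite (_ : [sequence v (k + 1)%N]_k = (fun k => v k - 1 + expR (- v k))).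
    apply: cvgD; first by apply: cvgB => //; exact: cvg_cst.
    by apply: (continuous_cvg _ (@continuous_expR R _)); exact: cvgN.
  by apply/funext => k; rewrite /= !vE addn1 [in LHS]uS.
have : l = l - 1 + expR (- l) by exact: (cvg_unique _ v1 v2).
move=> e; have : expR (- l) = 1 by lra.
by rewrite -expR0 => /expR_inj/eqP; rewrite oppr_eq0 => /eqP.
Qed.

Fixpoint newton_ln k (t : R) : R :=
  if k is k'.+1 then newton_ln k' t - 1 + t * expR (- newton_ln k' t) else 0.

Lemma newton_ln_cvg (t : R) : 0 < t -> newton_ln ^~ t @ \oo --> ln t.
Proof.
move=> t0.
have h : (fun k => newton_ln k t - ln t) @ \oo --> 0.
  apply: newton_cvg0 => k /=.
  rewrite opprB addrC expRD expRN lnK ?posrE// -/newton_ln; ring.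
rewrite (_ : newton_ln ^~ t = (fun k => newton_ln k t - ln t + ln t)).
  rewrite -[X in _ --> X]add0r; apply: cvgD => //; exact: cvg_cst.
by apply/funext => k; rewrite subrK.
Qed.

End NewtonLogarithm.

Local Opaque fcalc powmx.

Section MeasurableMatrices.
Variables (R : realType) (dT : measure_display) (T : measurableType dT).

Definition measurable_cmx m k (F : T -> 'M[R[i]]_(m, k)) := forall i j,
  measurable_fun setT (fun x => complex.Re (F x i j)) /\
  measurable_fun setT (fun x => complex.Im (F x i j)).

Lemma measurable_cmx_mul m k l (F : T -> 'M[R[i]]_(m, k)) (G : T -> 'M[R[i]]_(k, l)) :
  measurable_cmx F -> measurable_cmx G -> measurable_cmx (fun x => F x *m G x).
Proof.
move=> mF mG i j; split.
- rewrite (_ : (fun _ => _) = (fun x => \sum_h (complex.Re (F x i h) * complex.Re (G x h j)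
      - complex.Im (F x i h) * complex.Im (G x h j)))).
    apply: measurable_sum => h; have [m1 m2] := mF i h; have [m3 m4] := mG h j.
    by apply: measurable_funB; exact: measurable_funM.
  by apply/funext => x; rewrite mxE raddf_sum/=; apply: eq_bigr => h _;
    case: (F x i h) => a b; case: (G x h j).
- rewrite (_ : (fun _ => _) = (fun x => \sum_h (complex.Re (F x i h) * complex.Im (G x h j)
      + complex.Im (F x i h) * complex.Re (G x h j)))).
    apply: measurable_sum => h; have [m1 m2] := mF i h; have [m3 m4] := mG h j.
    by apply: measurable_funD; exact: measurable_funM.
  by apply/funext => x; rewrite mxE raddf_sum/=; apply: eq_bigr => h _;
    case: (F x i h) => a b; case: (G x h j).
Qed.

Lemma measurable_cmx_cst m k (A : 'M[R[i]]_(m, k)) : measurable_cmx (fun=> A).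
Proof. by move=> i j; split; exact: measurable_cst. Qed.

Lemma measurable_cnorm k (F : T -> 'cV[R[i]]_k) :
  measurable_cmx F -> measurable_fun setT (fun x => cnorm (F x)).
Proof.
move=> mF; rewrite (_ : (fun _ => _) = (fun x =>
  (\sum_i (complex.Re (F x i 0) * complex.Re (F x i 0) +
           complex.Im (F x i 0) * complex.Im (F x i 0))) `^ 2^-1)).
  apply: (measurableT_comp (measurable_powR _)); apply: measurable_sum => i.
  have [m1 m2] := mF i 0.
  by apply: measurable_funD; exact: measurable_funM.
apply/funext => x; rewrite powR12_sqrt; last first.
  by apply: sumr_ge0 => i _; rewrite -!expr2 addr_ge0 ?sqr_ge0.
by rewrite /cnorm; congr Num.sqrt; apply: eq_bigr => i _; rewrite sqr_normc_Re_Im !expr2.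
Qed.

Section Calculus.
Variables (n : nat) (W : T -> 'M[R[i]]_n).
Hypotheses (mW : measurable_cmx W) (pW : forall x, posdefmx (W x)).

Let coef x i l j := invmx (spectralmx (W x)) i l * spectralmx (W x) l j.

Let Re_calc (phi : R -> R) i j x : R :=
  \sum_l phi (eigv (W x) l) * complex.Re (coef x i l j).

Let Im_calc (phi : R -> R) i j x : R :=
  \sum_l phi (eigv (W x) l) * complex.Im (coef x i l j).

Let Re_fcalc phi x i j : complex.Re (fcalc phi (W x) i j) = Re_calc phi i j x.
Proof.
rewrite fcalcE raddf_sum/=; apply: eq_bigr => l _; rewrite -/(coef x i l j).
by case: (coef x i l j) => a b /=; rewrite mul0r subr0.
Qed.

Let Im_fcalc phi x i j : complex.Im (fcalc phi (W x) i j) = Im_calc phi i j x.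
Proof.
rewrite fcalcE raddf_sum/=; apply: eq_bigr => l _; rewrite -/(coef x i l j).
by case: (coef x i l j) => a b /=; rewrite mul0r addr0.
Qed.

(** The spectral decomposition of W x need not depend measurably on x. But the
    functions phi for which phi(W) is measurable form an algebra closed under
    pointwise limits; it contains the identity, hence the exponential series,
    hence ln through Newton's iteration, hence all powers. The definition uses
    the sums over eigenvalues, for which these limits are immediate. *)
Definition calculable (phi : R -> R) := forall i j,
  measurable_fun setT (Re_calc phi i j) /\ measurable_fun setT (Im_calc phi i j).

Lemma calculableP phi : measurable_cmx (fun x => fcalc phi (W x)) <-> calculable phi.
Proof.
split=> h i j; have [h1 h2] := h i j; split.
- by apply: eq_measurable_fun h1 => x _; exact: Re_fcalc.
- by apply: eq_measurable_fun h2 => x _; exact: Im_fcalc.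
- by apply: eq_measurable_fun h1 => x _; exact/esym/Re_fcalc.
- by apply: eq_measurable_fun h2 => x _; exact/esym/Im_fcalc.
Qed.

Lemma calculable_cvg (phi_ : nat -> R -> R) phi : (forall k, calculable (phi_ k)) ->
  (forall t, 0 < t -> phi_ ^~ t @ \oo --> phi t) -> calculable phi.
Proof.
move=> mphi cphi i j; split.
- apply: (@measurable_fun_cvg _ _ _ _ (fun k => Re_calc (phi_ k) i j)) => [k|x _].
    by have [] := mphi k i j.
  apply: cvg_big => [|l _]; first exact: add_continuous.
  by apply: cvgM; [apply: cphi; exact: eigv_gt0|exact: cvg_cst].
- apply: (@measurable_fun_cvg _ _ _ _ (fun k => Im_calc (phi_ k) i j)) => [k|x _].
    by have [] := mphi k i j.
  apply: cvg_big => [|l _]; first exact: add_continuous.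
  by apply: cvgM; [apply: cphi; exact: eigv_gt0|exact: cvg_cst].
Qed.

Lemma calculable_eq phi psi : (forall t, 0 < t -> phi t = psi t) ->
  calculable phi -> calculable psi.
Proof.
move=> e mphi; apply: (calculable_cvg (phi_ := fun=> phi)) => // t t0.
by rewrite e//; exact: cvg_cst.
Qed.

Lemma calculableM phi psi : calculable phi -> calculable psi ->
  calculable (fun t => phi t * psi t).
Proof.
move=> /calculableP m1 /calculableP m2; apply/calculableP.
have m12 := measurable_cmx_mul m1 m2.
by move=> i j; have [h1 h2] := m12 i j; split; [apply: eq_measurable_fun h1|
  apply: eq_measurable_fun h2] => x _; rewrite fcalcM.
Qed.

Lemma calculableD phi psi : calculable phi -> calculable psi ->
  calculable (fun t => phi t + psi t).
Proof.
move=> m1 m2 i j; have [h1 h2] := m1 i j; have [h3 h4] := m2 i j; split.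
- apply: (@eq_measurable_fun _ _ _ _ setT (fun x => Re_calc phi i j x + Re_calc psi i j x)).
    by move=> x _; rewrite /Re_calc -big_split/=; apply: eq_bigr => l _; rewrite mulrDl.
  exact: measurable_funD.
- apply: (@eq_measurable_fun _ _ _ _ setT (fun x => Im_calc phi i j x + Im_calc psi i j x)).
    by move=> x _; rewrite /Im_calc -big_split/=; apply: eq_bigr => l _; rewrite mulrDl.
  exact: measurable_funD.
Qed.

Lemma calculable_cst a : calculable (fun=> a).
Proof.
apply/calculableP => i j; split.
- apply: (@eq_measurable_fun _ _ _ _ setT (fun=> complex.Re ((a%:C%:M : 'M[R[i]]_n) i j))).
    by move=> x _; rewrite fcalc_cst.
  exact: measurable_cst.
- apply: (@eq_measurable_fun _ _ _ _ setT (fun=> complex.Im ((a%:C%:M : 'M[R[i]]_n) i j))).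
    by move=> x _; rewrite fcalc_cst.
  exact: measurable_cst.
Qed.

Lemma calculable_id : calculable id.
Proof.
apply/calculableP => i j; have [h1 h2] := mW i j.
have hW x : W x \is hermsymmx by case: (pW x).
by split; [apply: eq_measurable_fun h1|apply: eq_measurable_fun h2] => x _; rewrite fcalc_id.
Qed.

Lemma calculable_expR phi : calculable phi -> calculable (fun t => expR (phi t)).
Proof.
move=> mphi.
have mX k : calculable (fun t => phi t ^+ k).
  elim: k => [|k IH]; first exact: calculable_cst.
  by under eq_fun do rewrite exprS; exact: calculableM.
apply: (calculable_cvg (phi_ := fun k t => series (exp_coeff (phi t)) k)); last first.
  by move=> t _; exact: is_cvg_series_exp_coeff.
elim=> [|k IH].
  rewrite (_ : (fun t => _) = (fun=> 0)); first exact: calculable_cst.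
  by apply/funext => t; rewrite /series /= big_geq.
rewrite (_ : (fun t => _) =
    (fun t => series (exp_coeff (phi t)) k + phi t ^+ k * (k`!%:R)^-1)).
  by apply: calculableD => //; apply: calculableM => //; exact: calculable_cst.
by apply/funext => t; rewrite /series/= big_nat_recr.
Qed.

Lemma calculable_ln : calculable (@ln R).
Proof.
apply: (calculable_cvg (phi_ := @newton_ln R)); last exact: newton_ln_cvg.
elim=> [|k IH] /=; first exact: calculable_cst.
apply: calculableD.
  by apply: calculableD => //; exact: calculable_cst.
apply: calculableM; first exact: calculable_id.
apply: calculable_expR; under eq_fun do rewrite -mulN1r.
by apply: calculableM => //; exact: calculable_cst.
Qed.

Lemma measurable_powmx s : measurable_cmx (fun x => powmx (W x) s).
Proof.
have h : calculable (fun t => t `^ s).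
  apply: (calculable_eq (phi := fun t => expR (s * ln t))).
    by move=> t t0; rewrite /powR gt_eqF.
  apply: calculable_expR; apply: calculableM; last exact: calculable_ln.
  exact: calculable_cst.
move/calculableP: h => h i j; have [h1 h2] := h i j.
by split; [apply: eq_measurable_fun h1|apply: eq_measurable_fun h2] => x _; rewrite powmx_fcalc.
Qed.

End Calculus.
End MeasurableMatrices.

(** * Children of a cube and Haar functions *)

Section DyadicChildren.
Variables (R : realType) (d : nat).
Local Notation T := {ffun 'I_d -> bool}.
Local Notation mu := (leb R d).
Implicit Types (K : cube R d) (c : T) (x : Rspace R d).

Definition child c K : cube R d :=
  ([tuple corner K i + (c i)%:R * (side K / 2) | i < d], (K.2%:num / 2)%:pos).

Lemma card_children : (0 < #|{: T}|)%N.
Proof. by rewrite card_ffun card_bool expn_gt0. Qed.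

Lemma card_childrenE : #|{: T}|%:R = 2 ^+ d :> R.
Proof. by rewrite card_ffun card_bool card_ord natrX. Qed.

Lemma side_child c K : side (child c K) = side K / 2.
Proof. by []. Qed.

Lemma side_gt0 K : 0 < side K.
Proof. by rewrite /side. Qed.

Lemma corner_child c K i : corner (child c K) i = corner K i + (c i)%:R * (side K / 2).
Proof. by rewrite /corner tnth_mktuple. Qed.

Definition half K x : T := [ffun i => corner K i + side K / 2 <= tnth x i].

Lemma mem_child c K x : cubeset (child c K) x <-> cubeset K x /\ c = half K x.
Proof.
have s0 := side_gt0 K; split.
- move=> xc; split=> [i|].
    by have := xc i; rewrite corner_child side_child;
      case: (c i) => /= /andP[h1 h2]; apply/andP; split; lra.
  apply/ffunP => i; rewrite ffunE; have := xc i; rewrite corner_child side_child.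
  by case: (c i) => /= /andP[h1 h2]; apply/esym; [|apply/negbTE; rewrite -ltNge]; lra.
- move=> [xK ->] i; have /andP[h1 h2] := xK i; rewrite corner_child side_child ffunE.
  by have [h|h] := leP (corner K i + side K / 2) (tnth x i : R) => /=; apply/andP; split; lra.
Qed.

Lemma child_sub c K : cubeset (child c K) `<=` cubeset K.
Proof. by move=> x /mem_child[]. Qed.

Lemma mem_child_half K x : cubeset K x -> cubeset (child (half K x) K) x.
Proof. by move=> xK; apply/mem_child. Qed.

Lemma cubeset_children K :
  cubeset K = \big[setU/set0]_(c <- index_enum T) cubeset (child c K).
Proof.
rewrite -bigcup_seq; apply/seteqP; split=> [x xK|x [c _]].
  by exists (half K x); [rewrite /= mem_index_enum|exact: mem_child_half].
exact: child_sub.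
Qed.

Lemma trivIset_children K D : trivIset D (fun c : T => cubeset (child c K)).
Proof. by move=> c c' _ _ [x [/mem_child[_ ->] /mem_child[_ ->]]]. Qed.

Lemma measurable_cubeset K : measurable (cubeset K).
Proof.
rewrite (_ : cubeset K = \bigcap_(i in [set: 'I_d])
   ((fun x : Rspace R d => tnth x i) @^-1` `[corner K i, corner K i + side K[)).
  apply: fin_bigcap_measurable => // i _; rewrite -[X in measurable X]setTI.
  by apply: measurable_tnth => //; exact: measurable_itv.
apply/seteqP; split => x /= H i; first by move=> _; rewrite /= in_itv /=.
by have := H i Logic.I; rewrite /= in_itv.
Qed.

Lemma volE K : vol K = side K ^+ d.
Proof. by rewrite /vol leb_cubeset. Qed.

Lemma leb_vol K : mu (cubeset K) = (vol K)%:E.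
Proof. by rewrite volE leb_cubeset. Qed.

Lemma vol_gt0 K : 0 < vol K.
Proof. by rewrite volE exprn_gt0// side_gt0. Qed.

Lemma vol_child c K : vol (child c K) = vol K / 2 ^+ d.
Proof. by rewrite !volE side_child expr_div_n. Qed.

Definition haar_sign (eps : T) c : R :=
  \prod_(i < d) (if eps i then 1 else if c i then -1 else 1).

Lemma haar1_half (a l t : R) (e b : bool) : 0 < l ->
  a + b%:R * (l / 2) <= t < a + b%:R * (l / 2) + l / 2 ->
  haar1 a l e t = (Num.sqrt l)^-1 * (if e then 1 else if b then -1 else 1).
Proof.
move=> l0 H; rewrite /haar1 !indicE; congr (_ * _); move: H.
have mem (x y : R) : (t \in [set` `[x, y[]) = (x <= t < y) by rewrite mem_setE in_itv.
rewrite !mem; case: b => /= /andP[h1 h2].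
  have -> : a <= t < a + l by apply/andP; split; lra.
  have -> : a <= t < a + l / 2 = false by apply/negbTE/negP => /andP[]; lra.
  have -> : a + l / 2 <= t < a + l by apply/andP; split; lra.
  by case: e; rewrite /= ?sub0r.
have -> : a <= t < a + l by apply/andP; split; lra.
have -> : a <= t < a + l / 2 by apply/andP; split; lra.
have -> : a + l / 2 <= t < a + l = false by apply/negbTE/negP => /andP[]; lra.
by case: e; rewrite /= ?subr0.
Qed.

Lemma haar1_out (a l t : R) (e : bool) : 0 < l -> ~~ (a <= t < a + l) ->
  haar1 a l e t = 0.
Proof.
move=> l0; rewrite /haar1 !indicE negb_and -!real_ltNge ?num_real// -!real_leNgt ?num_real// => /orP h.
have mem (x y : R) : (t \in [set` `[x, y[]) = (x <= t < y) by rewrite mem_setE in_itv.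
rewrite !mem.
have -> : a <= t < a + l = false by apply/negbTE/negP => /andP[]; case: h; lra.
have -> : a <= t < a + l / 2 = false by apply/negbTE/negP => /andP[]; case: h; lra.
have -> : a + l / 2 <= t < a + l = false by apply/negbTE/negP => /andP[]; case: h; lra.
by case: e; rewrite ?subrr mulr0.
Qed.

Lemma haar_child K (eps : T) c x : cubeset (child c K) x ->
  haar K eps x = (Num.sqrt (side K))^-1 ^+ d * haar_sign eps c.
Proof.
move=> xc; rewrite /haar /haar_sign -[d in _ ^+ d]card_ord -prodr_const -big_split/=.
apply: eq_bigr => i _; apply: haar1_half; first exact: side_gt0.
by have := xc i; rewrite corner_child side_child.
Qed.

Lemma haar_out K (eps : T) x : ~ cubeset K x -> haar K eps x = 0.
Proof.
move=> xK; have [i xi] : exists i, ~~ (corner K i <= tnth x i < corner K i + side K).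
  by apply/existsP; rewrite -negb_forall; apply/negP => /forallP.
by rewrite /haar (bigD1 i)//= haar1_out ?side_gt0// mul0r.
Qed.

(** Cancellation in a coordinate in which the Haar function oscillates. *)
Lemma sum_haar_sign (eps : T) : Sig eps -> \sum_c haar_sign eps c = 0.
Proof.
move=> Se; rewrite /haar_sign.
rewrite -(bigA_distr_bigA (fun i (b : bool) => if eps i then 1 else if b then -1 else 1 : R)).
have [i ei] : exists i, ~~ eps i.
  apply/existsP; rewrite -negb_forall; apply: contra Se => /forallP e.
  by apply/eqP/ffunP => i; rewrite ffunE e.
by rewrite (bigD1 i)//= big_bool (negbTE ei) /= addNr mul0r.
Qed.

Lemma sqr_haar_sign (eps : T) c : haar_sign eps c ^+ 2 = 1.
Proof.
rewrite /haar_sign -prodrXl big1// => i _.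
by case: (eps i); case: (c i); rewrite ?sqrrN expr1n.
Qed.

End DyadicChildren.

(** * Averages over cubes *)

Section LocalAverages.
Variables (R : realType) (d : nat).
Local Notation T := {ffun 'I_d -> bool}.
Local Notation mu := (leb R d).
Local Notation N := (#|{: {ffun 'I_d -> bool}}|%:R : R).
Implicit Types (K : cube R d) (h g : Rspace R d -> R).

Definition locint h := forall K, mu.-integrable (cubeset K) (EFin \o h).

Definition cube_avg h K : R := (vol K)^-1 * \int[mu]_(x in cubeset K) h x.

Lemma locint_measurable h K : locint h -> measurable_fun (cubeset K) h.
Proof. by move=> /(_ K) /integrableP[/measurable_EFinP]. Qed.

Lemma locint_le h g : measurable_fun setT h -> (forall x, `|h x| <= g x) ->
  locint g -> locint h.
Proof.
move=> mh hg ig K; apply: le_integrable (ig K); first exact: measurable_cubeset.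
  by apply/measurable_EFinP; exact: measurable_funTS.
by move=> x _; rewrite !abse_EFin lee_fin (le_trans (hg x))// ler_norm.
Qed.

Lemma locintD h g : locint h -> locint g -> locint (fun x => h x + g x).
Proof.
by move=> ih ig K; apply: (integrableD (measurable_cubeset K) (ih K) (ig K)).
Qed.

Lemma locintZ a h : locint h -> locint (fun x => a * h x).
Proof.
move=> ih K; apply: eq_integrable (integrableZl (measurable_cubeset K) a (ih K)).
  exact: measurable_cubeset.
by move=> x _.
Qed.

Lemma locint_cst a : locint (fun=> a).
Proof.
move=> K; apply/integrableP; split; first by apply/measurable_EFinP.
rewrite /= integral_cst; last exact: measurable_cubeset.
by rewrite [X in (_ * X)%E](leb_vol K) -EFinM ltry.
Qed.

Lemma locint_sum (I : Type) (s : seq I) (h : I -> Rspace R d -> R) :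
  (forall i, locint (h i)) -> locint (fun x => \sum_(i <- s) h i x).
Proof.
move=> ih; elim: s => [|i s IH].
  by under eq_fun do rewrite big_nil; exact: locint_cst.
by under eq_fun do rewrite big_cons; exact: locintD.
Qed.

Lemma measurable_fun_children dU (U : measurableType dU) (f : Rspace R d -> U) K :
  (forall c, measurable_fun (cubeset (child c K)) f) -> measurable_fun (cubeset K) f.
Proof.
move=> mf _ Y mY; rewrite cubeset_children -bigcup_seq setI_bigcupl.
apply: fin_bigcup_measurable => [|c _].
  exact: finite_seq.
by apply: mf => //; exact: measurable_cubeset.
Qed.

Lemma Rintegral_children h K : locint h ->
  \int[mu]_(x in cubeset K) h x =
  \sum_(c : T) \int[mu]_(x in cubeset (child c K)) h x.
Proof.
move=> ih; rewrite /Rintegral cubeset_children integral_bigsetU_EFin//.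
- rewrite -sum_fine// => c _; by apply: integrable_fin_num => //; exact: measurable_cubeset.
- by move=> c; exact: measurable_cubeset.
- exact: index_enum_uniq.
- exact: trivIset_children.
- by rewrite -cubeset_children; apply/measurable_EFinP; exact: locint_measurable.
Qed.

Lemma cube_avg_martingale h : locint h -> martingale (@child R d) (cube_avg h).
Proof.
move=> ih K; rewrite /cube_avg Rintegral_children// /avg mulr_sumr mulr_suml.
apply: eq_bigr => c _; rewrite vol_child card_childrenE.
have := vol_gt0 K; have : 0 < 2 ^+ d :> R by rewrite exprn_gt0.
by move=> p v; field; rewrite !gt_eqF.
Qed.

Lemma le_cube_avg h g K : locint h -> locint g -> (forall x, h x <= g x) ->
  cube_avg h K <= cube_avg g K.
Proof.
move=> ih ig hg; rewrite /cube_avg ler_pM2l ?invr_gt0 ?vol_gt0//.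
by apply: le_Rintegral => //; exact: measurable_cubeset.
Qed.

Lemma cube_avgD h g K : locint h -> locint g ->
  cube_avg (fun x => h x + g x) K = cube_avg h K + cube_avg g K.
Proof.
move=> ih ig; rewrite /cube_avg (RintegralD (measurable_cubeset K) (ih K) (ig K)).
exact: mulrDr.
Qed.

Lemma cube_avgZ a h K : locint h -> cube_avg (fun x => a * h x) K = a * cube_avg h K.
Proof.
move=> ih; rewrite /cube_avg (RintegralZl a (measurable_cubeset K) (ih K)).
exact: mulrCA.
Qed.

Lemma cube_avg_cst a K : cube_avg (fun=> a) K = a.
Proof.
rewrite /cube_avg Rintegral_cst -/(vol K); last exact: measurable_cubeset.
by rewrite mulrC mulfK// gt_eqF// vol_gt0.
Qed.

Lemma cube_avg_sum (I : Type) (s : seq I) (h : I -> Rspace R d -> R) K :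
  (forall i, locint (h i)) ->
  cube_avg (fun x => \sum_(i <- s) h i x) K = \sum_(i <- s) cube_avg (h i) K.
Proof.
move=> ih; elim: s => [|i s IH].
  by under eq_fun do rewrite big_nil; rewrite big_nil cube_avg_cst.
under eq_fun do rewrite big_cons.
by rewrite big_cons cube_avgD ?IH//; exact: locint_sum.
Qed.

Lemma cube_avg_ge0 h K : (forall x, 0 <= h x) -> 0 <= cube_avg h K.
Proof.
by move=> h0; rewrite /cube_avg mulr_ge0 ?invr_ge0 ?(ltW (vol_gt0 K))// Rintegral_ge0.
Qed.

Lemma norm_cube_avg_le h g K : locint h -> locint g -> (forall x, `|h x| <= g x) ->
  `|cube_avg h K| <= cube_avg g K.
Proof.
move=> ih ig hg; rewrite ler_norml -mulN1r -cube_avgZ//; apply/andP; split; apply: le_cube_avg => //.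
- exact: locintZ.
- by move=> x; have := hg x; rewrite ler_norml mulN1r => /andP[].
- by move=> x; have := hg x; rewrite ler_norml => /andP[].
Qed.

Lemma haar_coefficient h K (eps : T) : locint h ->
  \int[mu]_x (h x * haar K eps x) =
  vol K * (Num.sqrt (side K))^-1 ^+ d *
    avg (fun c => haar_sign R eps c * cube_avg h (child c K)).
Proof.
move=> ih.
have E : \int[mu]_x (h x * haar K eps x) = \int[mu]_(x in cubeset K) (h x * haar K eps x).
  rewrite [RHS]Rintegral_mkcond; apply: eq_Rintegral => x _.
  rewrite /patch; case: ifPn => // xK; rewrite haar_out ?mulr0//.
  by move=> xK'; move/negP: xK; apply; rewrite inE.
pose a := (Num.sqrt (side K))^-1 ^+ d.
have E2 c x : cubeset (child c K) x -> h x * haar K eps x = a * haar_sign R eps c * h x.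
  by move=> xc; rewrite (haar_child _ xc) mulrC.
have ihh c : mu.-integrable (cubeset (child c K)) (EFin \o (fun x => h x * haar K eps x)).
  apply: eq_integrable (locintZ (a * haar_sign R eps c) ih (child c K)).
    exact: measurable_cubeset.
  by move=> x; rewrite inE => xc; rewrite /= (E2 c).
rewrite E {1}/Rintegral cubeset_children integral_bigsetU_EFin//; last 4 first.
- by move=> c; exact: measurable_cubeset.
- exact: index_enum_uniq.
- exact: trivIset_children.
- rewrite -cubeset_children; apply: measurable_fun_children => c.
  exact: (measurable_int mu (ihh c)).
rewrite -sum_fine; last first.
  by move=> c _; apply: integrable_fin_num => //; exact: measurable_cubeset.
rewrite /avg mulr_suml mulr_sumr; apply: eq_bigr => c _.
transitivity (\int[mu]_(x in cubeset (child c K)) (a * haar_sign R eps c * h x)).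
  by apply: eq_Rintegral => x; rewrite inE; exact: E2.
rewrite (RintegralZl _ (measurable_cubeset _) (ih _)).
rewrite /cube_avg vol_child card_childrenE /a.
have := vol_gt0 K; have : 0 < 2 ^+ d :> R by rewrite exprn_gt0.
have : 0 < Num.sqrt (side K) by rewrite sqrtr_gt0 side_gt0.
by move=> s p v; field; rewrite !gt_eqF.
Qed.

(** By cancellation the coefficient is a signed average of the martingale
    differences; then the Cauchy-Schwarz inequality applies. *)
Lemma sqr_haar_coefficient_le h K (eps : T) : locint h -> Sig eps ->
  (\int[mu]_x (h x * haar K eps x)) ^+ 2 / vol K <=
  avg (fun c => (cube_avg h (child c K) - cube_avg h K) ^+ 2).
Proof.
move=> ih Se; rewrite haar_coefficient//.
have v0 := vol_gt0 K.
have e : ((Num.sqrt (side K))^-1 ^+ d) ^+ 2 = (vol K)^-1.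
  rewrite -exprM mulnC exprM exprVn sqr_sqrtr; last exact/ltW/side_gt0.
  by rewrite exprVn volE.
have gen (A : R) : (vol K * (Num.sqrt (side K))^-1 ^+ d * A) ^+ 2 / vol K = A ^+ 2.
  rewrite exprMn [(vol K * _) ^+ 2]exprMn e.
  have v1 : vol K != 0 by rewrite gt_eqF.
  by field.
rewrite gen.
have -> : avg (fun c => haar_sign R eps c * cube_avg h (child c K)) =
    avg (fun c => haar_sign R eps c * (cube_avg h (child c K) - cube_avg h K)).
  rewrite /avg; congr (_ / _); under [RHS]eq_bigr do rewrite mulrBr.
  by rewrite sumrB -mulr_suml sum_haar_sign// mul0r subr0.
have N0 : 0 < N by rewrite ltr0n card_children.
rewrite /avg expr_div_n expr2 invfM mulrA ler_pM2r ?invr_gt0// ler_pdivrMr//.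
apply: le_trans (sumr_sqr_CS _ _) _; rewrite mulrC ler_wpM2l//.
  by apply: sumr_ge0 => c _; rewrite sqr_ge0.
by under eq_bigr do rewrite sqr_haar_sign; rewrite sumr_const.
Qed.

(** The function on K whose distribution and moments path_avg gives. *)
Fixpoint pathsum (b : cube R d -> R) m t K x : R :=
  if m is m'.+1 then pathsum b m' (t + b K) (child (half K x) K) x else t + b K.

Lemma measurable_pathsum b m t K (F : R -> R) :
  measurable_fun (cubeset K) (fun x => F (pathsum b m t K x)).
Proof.
elim: m t K => [|m IH] t K /=; first exact: measurable_cst.
apply: measurable_fun_children => c.
apply: eq_measurable_fun (IH (t + b K) (child c K)).
by move=> x; rewrite inE => /mem_child[_ <-].
Qed.

Lemma integral_pathsum b m t K (F : R -> R) : (forall u, 0 <= F u) ->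
  (\int[mu]_(x in cubeset K) (F (pathsum b m t K x))%:E =
   (vol K * path_avg (@child R d) b F m t K)%:E)%E.
Proof.
move=> F0; elim: m t K => [|m IH] t K.
  rewrite /= integral_cst; last exact: measurable_cubeset.
  by rewrite [X in (_ * X)%E](leb_vol K) -EFinM mulrC.
rewrite [in LHS]cubeset_children ge0_integral_bigsetU//; last 5 first.
- by move=> c; exact: measurable_cubeset.
- exact: index_enum_uniq.
- exact: trivIset_children.
- by rewrite -cubeset_children; apply/measurable_EFinP; exact: (@measurable_pathsum b m.+1).
- by move=> x _; rewrite lee_fin.
rewrite [path_avg _ _ _ _ _ _]/= /avg mulr_suml mulr_sumr -sumEFin.
apply: eq_bigr => c _.
rewrite (eq_integral (fun x => (F (pathsum b m (t + b K) (child c K) x))%:E)); last first.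
  by move=> x; rewrite inE => /mem_child[_ ->].
rewrite IH vol_child card_childrenE; congr EFin; rewrite mulrA mulrAC.
by rewrite mulrAC.
Qed.

End LocalAverages.

(** * Changes on null sets *)

Section NullSets.
Variables (R : realType) (dT : measure_display) (T : measurableType dT).
Variable mu : {measure set T -> \bar R}.
Import HBNNSimple.

(** The integral is a supremum over simple functions, and a simple function can be
    set to 0 on N at no cost. *)
Lemma ge0_le_integral_null (f g : T -> \bar R) (N : set T) : measurable N -> mu N = 0%E ->
  (forall x, 0 <= f x)%E -> (forall x, 0 <= g x)%E -> (forall x, ~ N x -> f x <= g x)%E ->
  (\int[mu]_x f x <= \int[mu]_x g x)%E.
Proof.
move=> mN N0 f0 g0 fg; rewrite !ge0_integralTE//.
apply: ub_ereal_sup => _ /= [h hf <-].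
have mNC : measurable (~` N) by exact: measurableC.
apply: ereal_sup_ge; exists (sintegral mu (proj_nnsfun h mNC)).
  exists (proj_nnsfun h mNC) => // x /=.
  have [xN|xN] := pselect (N x).
    by rewrite mindicE memNset ?mulr0//=; exact.
  by rewrite mindicE mem_set// mulr1 (le_trans (hf x))// fg.
rewrite -!integralT_nnsfun.
have -> : (\int[mu]_x (h x)%:E = \int[mu]_(x in ~` N) (h x)%:E)%E.
  rewrite -setTD; apply: ge0_negligible_integral => //.
    exact/measurable_EFinP.
  by move=> x _; rewrite lee_fin.
rewrite integral_mkcond; apply: ge0_le_integral => //.
- by move=> x _; rewrite /patch; case: ifP => _; rewrite ?lee_fin.
- by apply/(measurable_restrictT _ mNC); apply: measurable_funTS; exact/measurable_EFinP.
- by apply/measurable_EFinP.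
- move=> x _; rewrite /patch /= mindicE.
  by case: ifP => _; rewrite ?mulr1 ?mulr0.
Qed.

Lemma integral_null_eq (D : set T) (f g : T -> \bar R) (N : set T) :
  measurable N -> mu N = 0%E -> (forall x, ~ N x -> f x = g x) ->
  (\int[mu]_(x in D) f x = \int[mu]_(x in D) g x)%E.
Proof.
move=> mN N0 fg; rewrite [LHS]integral_mkcond [RHS]integral_mkcond.
have fgD x : ~ N x -> (f \_ D) x = (g \_ D) x by move=> /fg; rewrite /patch => ->.
rewrite integralE [RHS]integralE; congr (_ - _)%E; apply/eqP; rewrite eq_le;
  apply/andP; split; apply: (ge0_le_integral_null mN N0) => // x /fgD e;
  by rewrite ?funeposE ?funenegE e.
Qed.

Lemma Rintegral_null_eq (D : set T) (f g : T -> R) (N : set T) :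
  measurable N -> mu N = 0%E -> (forall x, ~ N x -> f x = g x) ->
  \int[mu]_(x in D) f x = \int[mu]_(x in D) g x.
Proof.
by move=> mN N0 fg; congr fine; apply: (integral_null_eq _ mN N0) => x /fg ->.
Qed.

(** For each rational q the set where q < g is Borel up to a null set. Off the
    union N of these countably many null sets, g is determined by Borel
    sets. *)
Lemma completed_measurable_modify (g : T -> R) :
  (forall Y : set R, measurable Y -> completed_algebra_gen mu (g @^-1` Y)) ->
  exists N, [/\ measurable N, mu N = 0%E & forall M c, measurable M -> N `<=` M ->
    measurable_fun setT (fun x => if x \in M then c else g x)].
Proof.
move=> mg.
have /choice[A AP] (q : rat) : exists A : set T * set T,
    [/\ measurable A.1, measurable A.2, mu A.2 = 0%E &
     forall x, ~ A.2 x -> A.1 x <-> ratr q < g x].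
  have := mg `]ratr q, +oo[%classic (measurable_itv _) => -[B mB [N' [N [mN N0 NN]] e]].
  exists (B, N); split => //= x xN.
  have -> : (ratr q < g x) = (g @^-1` `]ratr q, +oo[%classic) x :> Prop.
    by rewrite /= in_itv/= andbT.
  by rewrite -e; split; [left|case=> // /NN].
pose qn k : rat := odflt 0%Q (unpickle k).
pose N := \bigcup_k (A (qn k)).2.
have mN : measurable N by apply: bigcupT_measurable => k; case: (AP (qn k)).
have N0 : mu N = 0%E.
  apply/negligibleP => //; apply: negligible_bigcup => k; apply/negligibleP.
    by case: (AP (qn k)).
  by case: (AP (qn k)).
have AN q : (A q).2 `<=` N by move=> x Ax; exists (pickle q) => //; rewrite /qn pickleK.
exists N; split => // M c mM NM.
apply: (measurability _ (RGenOInfty.measurableE R)) => // _ [_ [a ->] <-].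
rewrite setTI (_ : _ @^-1` _ = (M `&` [set _ | a < c]) `|`
   \bigcup_(q : rat) (if a < ratr q then (A q).1 `\` M else set0)).
  apply: measurableU.
    apply: measurableI => //; have [ac|ac] := boolP (a < c).
      by rewrite (_ : mkset _ = setT)//; apply/seteqP.
    by rewrite (_ : mkset _ = set0)//; apply/seteqP; split => x //=; rewrite (negbTE ac).
  apply: bigcupT_measurable_rat => q; case: ifP => // _; apply: measurableD => //.
  by case: (AP q).
apply/seteqP; split => x /=.
- rewrite in_itv/= andbT; case: ifPn => [/set_mem xM ac|xM ag]; first by left.
  right; have [q] := rat_in_itvoo ag; rewrite in_itv/= => /andP[aq qg].
  exists q => //; rewrite aq; split; last by move=> /mem_set; exact/negP.
  have [_ _ _ Aq] := AP q; apply/Aq => // /AN/NM/mem_set; exact/negP.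
- rewrite in_itv/= andbT => -[[/mem_set -> //]|[q _]].
  case: ifP => // aq [Aq1 xM]; rewrite memNset//.
  have [_ _ _ Aq] := AP q; apply: (lt_trans aq); apply/Aq => // /AN/NM; exact: xM.
Qed.

End NullSets.

(** * The tree structure of a dyadic grid *)

Lemma ler_sum_uniq_sub (R : numDomainType) (I : eqType) (s t : seq I) (f : I -> R) :
  (forall i, 0 <= f i) -> uniq s -> {subset s <= t} ->
  \sum_(i <- s) f i <= \sum_(i <- t) f i.
Proof.
move=> f0; elim: s t => [|y s IH] t /=.
  by rewrite big_nil => _ _; apply: sumr_ge0.
move=> /andP[ys us] st; have yt : y \in t by apply: st; rewrite mem_head.
rewrite big_cons (big_rem y yt)/= lerD2l; apply: IH => // z zs.
have := st z; rewrite inE zs orbT => /(_ isT); rewrite (perm_mem (perm_to_rem yt)).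
by rewrite inE => /predU1P[zy|//]; move: ys; rewrite -zy zs.
Qed.

Section Grid.
Variables (R : realType) (d : nat).
Local Notation T := {ffun 'I_d -> bool}.
Local Notation mu := (leb R d).
Implicit Types (K I J : cube R d) (x : Rspace R d).

Lemma corner_mem K : cubeset K K.1.
Proof. by move=> i; rewrite -/(corner K i) lexx ltrDl side_gt0. Qed.

Variables (D : set (cube R d)) (gridD : dyadic_grid D).

Lemma grid_at (k : int) x : {I : cube R d | [/\ D I, side I = 2 ^ k, cubeset I x &
  forall J, D J -> side J = 2 ^ k -> cubeset J x -> J = I]}.
Proof.
have [_ /(_ k x) h _] := gridD; apply: cid; case: h => I [[DI sI xI] u].
by exists I; split=> // J DJ sJ xJ; rewrite (u J).
Qed.

Definition gcube k x : cube R d := sval (grid_at k x).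

Lemma gcubeP k x : [/\ D (gcube k x), side (gcube k x) = 2 ^ k, cubeset (gcube k x) x &
  forall J, D J -> side J = 2 ^ k -> cubeset J x -> J = gcube k x].
Proof. exact: svalP (grid_at k x). Qed.

Lemma gcube_eq k x y : cubeset (gcube k x) y -> gcube k y = gcube k x.
Proof.
move=> h; have [D1 s1 m1 u1] := gcubeP k x; have [_ _ _ u2] := gcubeP k y.
exact/esym/u2.
Qed.

Lemma two_expzB1 (k : int) : 2 ^ (k - 1) = 2 ^ k / 2 :> R.
Proof. by rewrite expfzDr// exprz_inv. Qed.

Definition setcoord x (i : 'I_d) (t : R) : Rspace R d :=
  [tuple if j == i then t else tnth x j | j < d].

Lemma setcoord_mem K x i t : cubeset K x ->
  corner K i <= t < corner K i + side K -> cubeset K (setcoord x i t).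
Proof.
by move=> xK tK j; rewrite tnth_mktuple; case: eqP => [->|_] //; exact: xK.
Qed.

(** By nestedness I lies in K; moving one coordinate of the corner inside I, or
    inside K, tests both bounds. *)
Lemma grid_half_sub (k : int) I K x : D I -> D K -> side K = 2 ^ k -> side I = 2 ^ (k - 1) ->
  cubeset I x -> cubeset K x -> forall i,
  corner K i <= corner I i <= corner K i + side K / 2.
Proof.
move=> DI DK sK sI xI xK i; have K0 := side_gt0 K.
have sIK : side I = side K / 2 by rewrite sI sK two_expzB1.
have IK : cubeset I `<=` cubeset K.
  have [_ _ /(_ I K DI DK)] := gridD; case=> h.
  - by move=> y yI; have [] : (cubeset I `&` cubeset K) y by rewrite h.
  - exfalso; have KI y : cubeset K y -> cubeset I y.
      by move=> yK; have [] : (cubeset I `&` cubeset K) y by rewrite h.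
    have /andP[h1 _] : corner I i <= corner K i < corner I i + side I.
      exact: KI _ (corner_mem K) i.
    have /KI/(_ i) : cubeset K (setcoord K.1 i (corner K i + side K * (3 / 4))).
      by apply: setcoord_mem; [exact: corner_mem|apply/andP; split; lra].
    by rewrite tnth_mktuple eqxx sIK => /andP[_ h3]; lra.
  - by have : (cubeset I `&` cubeset K) x by []; rewrite h.
have /andP[h1 h1'] : corner K i <= corner I i < corner K i + side K.
  exact: IK _ (corner_mem I) i.
apply/andP; split => //; rewrite leNgt; apply/negP => h2.
have /IK/(_ i) : cubeset I (setcoord I.1 i (corner K i + side K)).
  by apply: setcoord_mem; [exact: corner_mem|apply/andP; split; lra].
by rewrite tnth_mktuple eqxx ltxx andbF.
Qed.

(** A grid is only given by the partition of each generation and nestedness. Let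
    I be the grid cube of half the side of K that contains the corner y of the
    child. Its corner is coordinatewise between that of K and the midpoint. If
    it were below the midpoint where y is at the midpoint, the grid cube of the
    same generation at the projection of y to the lower face of K would overlap
    I, being long enough to reach it, and hence would equal it, although it
    starts at the lower face and y lies outside of it. *)
Lemma grid_child (k : int) K (c : T) : D K -> side K = 2 ^ k -> D (child c K).
Proof.
move=> DK sK; have K0 := side_gt0 K.
pose y := (child c K).1.
have yc : cubeset (child c K) y by exact: corner_mem.
have yK : cubeset K y by exact: child_sub yc.
have [DI sI yI _] := gcubeP (k - 1) y; set I := gcube (k - 1) y in DI sI yI.
have sIK : side I = side K / 2 by rewrite sI sK two_expzB1.
have yE i : tnth y i = corner K i + (c i)%:R * (side K / 2) :> R.
  by rewrite -corner_child.
suff cI i : corner I i = corner (child c K) i.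
  suff -> : child c K = I by [].
  have e1 : (child c K).1 = I.1.
    by apply/eq_from_tnth => i; have := cI i; rewrite /corner => ->.
  have e2 : (child c K).2 = I.2.
    by apply/val_inj; rewrite /= -/(side K) -sIK.
  by rewrite [LHS]surjective_pairing e1 e2 -surjective_pairing.
have /andP[h1 h2] := grid_half_sub DI DK sK sI yI yK i.
have /andP[h3 h4] := yI i; rewrite yE in h3 h4; rewrite corner_child.
case ci : (c i); rewrite ci /= in h3 h4 *; last first.
  by apply/eqP; rewrite eq_le; apply/andP; split; lra.
apply/eqP; rewrite eq_le h3/= leNgt; apply/negP => h5.
pose z := setcoord y i (corner K i).
have zK : cubeset K z.
  by apply: setcoord_mem => //; apply/andP; split; lra.
have [DJ sJ zJ _] := gcubeP (k - 1) z; set J := gcube (k - 1) z in DJ sJ zJ.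
have sJK : side J = side K / 2 by rewrite sJ sK two_expzB1.
have /andP[j1 j2] := grid_half_sub DJ DK sK sJ zJ zK i.
have /andP[j3 j4] := zJ i; rewrite tnth_mktuple eqxx in j3 j4.
pose w := setcoord y i (corner I i).
have wI : cubeset I w.
  by apply: setcoord_mem => //; apply/andP; split; lra.
have wJ : cubeset J w.
  have -> : w = setcoord z i (corner I i).
    by apply/eq_from_tnth => j; rewrite !tnth_mktuple; case: eqP.
  by apply: setcoord_mem => //; apply/andP; split; lra.
have IJ : I = J by rewrite /I /J -(gcube_eq wI) -(gcube_eq wJ).
by move: h4; rewrite IJ; lra.
Qed.

Lemma gcube_half (k : int) x : child (half (gcube k x) x) (gcube k x) = gcube (k - 1) x.
Proof.
have [DK sK xK _] := gcubeP k x; have [_ _ _ u] := gcubeP (k - 1) x; apply: u.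
- exact: grid_child sK.
- by rewrite side_child sK two_expzB1.
- exact: mem_child_half.
Qed.

Lemma pathsum_gcube (b : cube R d -> R) m t (k : int) x :
  pathsum b m t (gcube k x) x = t + \sum_(0 <= j < m.+1) b (gcube (k - j%:Z) x).
Proof.
elim: m t k => [|m IH] t k; first by rewrite big_nat1 /= subr0.
rewrite /= gcube_half IH [in RHS]big_nat_recl// subr0 addrA; congr (_ + _).
apply: eq_bigr => j _; congr (b (gcube _ _)); rewrite -addn1 PoszD; ring.
Qed.

End Grid.

(** * From single cubes to the whole grid *)

Section GridIntegral.
Variables (R : realType) (d : nat).
Local Notation mu := (leb R d).
Implicit Types (K I J : cube R d) (x : Rspace R d).

(** Countably many points that meet every cube. *)
Definition ratpt (j : nat) : Rspace R d :=
  [tuple ratr (tnth (odflt [tuple 0 | i < d] (unpickle j)) i) | i < d].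

Lemma ratpt_dense K : exists j, cubeset K (ratpt j).
Proof.
have /choice[q qP] (i : 'I_d) : exists q : rat, corner K i < ratr q < corner K i + side K.
  have /rat_in_itvoo[q] : corner K i < corner K i + side K by rewrite ltrDl side_gt0.
  by rewrite in_itv/= => ?; exists q.
exists (pickle [tuple q i | i < d]) => i.
rewrite tnth_mktuple pickleK/= tnth_mktuple.
by have /andP[/ltW -> ->] := qP i.
Qed.

Variables (D : set (cube R d)) (gridD : dyadic_grid D).
Local Notation gcube := (gcube gridD).

(* the cubes of generation k, listed with repetitions *)
Let P (k : int) (j : nat) := cubeset (gcube k (ratpt j)).

Let mP k j : measurable (P k j). Proof. exact: measurable_cubeset. Qed.

Let P_cover k : \bigcup_j P k j = setT.
Proof.
apply/seteqP; split=> // x _; have [D1 s1 m1 u1] := gcubeP gridD k x.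
by have [j jx] := ratpt_dense (gcube k x); exists j => //; rewrite /P (gcube_eq jx).
Qed.

(* two cubes of one generation are equal or disjoint, so removing the earlier
   ones from the list leaves a cube or nothing *)
Let P_seqDU k j : seqDU (P k) j = P k j \/ seqDU (P k) j = set0.
Proof.
rewrite /seqDU -bigcup_mkord.
have [[i ij Pij]|nP] := pselect (exists2 i, (i < j)%N & P k i = P k j).
  by right; rewrite setD_eq0 => y yj; exists i => //; rewrite Pij.
left; apply/setDidPl; rewrite -subset0 => y [yj [i /= ij yi]]; apply: nP; exists i => //.
by rewrite /P -(gcube_eq yi) -(gcube_eq yj).
Qed.

Lemma integral_grid_le (k : int) (h g : Rspace R d -> \bar R) (c : R) :
  measurable_fun setT h -> measurable_fun setT g ->
  (forall x, 0 <= h x)%E -> (forall x, 0 <= g x)%E -> 0 <= c ->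
  (forall y, \int[mu]_(x in cubeset (gcube k y)) h x <=
             c%:E * \int[mu]_(x in cubeset (gcube k y)) g x)%E ->
  (\int[mu]_x h x <= c%:E * \int[mu]_x g x)%E.
Proof.
move=> mh mg h0 g0 c0 hg.
have mF j : measurable (seqDU (P k) j) by apply: seqDU_measurable; exact: mP.
rewrite -(P_cover k) seqDU_bigcup_eq.
rewrite !ge0_integral_bigcup//; try exact: measurable_funTS.
rewrite -nneseriesZl//; last by move=> j _; apply: integral_ge0.
apply: lee_nneseries => [j _ _|j _]; first by apply: integral_ge0.
by case: (P_seqDU k j) => ->; [exact: hg|rewrite !integral_set0 mule0].
Qed.

Variables (b : cube R d -> R) (b_ge0 : forall K, 0 <= b K).

(** The generations from -k to k above a point, as a path sum that starts at the
    largest cube. *)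
Definition gridsum (k : nat) x : R := pathsum b (2 * k) 0 (gcube k%:Z x) x.

Lemma gridsumE k x : gridsum k x = \sum_(0 <= j < (2 * k).+1) b (gcube (k%:Z - j%:Z) x).
Proof. by rewrite /gridsum pathsum_gcube add0r. Qed.

Lemma gridsum_ge0 k x : 0 <= gridsum k x.
Proof. by rewrite gridsumE sumr_ge0. Qed.

Lemma measurable_gridsum (F : R -> R) k : measurable_fun setT (fun x => F (gridsum k x)).
Proof.
rewrite -(P_cover k%:Z); apply/measurable_fun_bigcup => [j|j]; first exact: mP.
apply: (@eq_measurable_fun _ _ _ _ _ (fun x => F (pathsum b (2 * k) 0 (gcube k%:Z (ratpt j)) x))).
  by move=> x; rewrite inE => xj; rewrite /gridsum (gcube_eq xj).
exact: measurable_pathsum.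
Qed.

Lemma gridsum_nd x : {homo gridsum ^~ x : k l / (k <= l)%N >-> k <= l}.
Proof.
apply: homo_leq => [//|y z t|k]; first exact: le_trans.
have E (f : nat -> R) : \sum_(0 <= j < (2 * k).+3) f j =
    f 0%N + (\sum_(0 <= j < (2 * k).+1) f j.+1 + f (2 * k).+2).
  by rewrite big_nat_recl// big_nat_recr.
rewrite !gridsumE (_ : (2 * k.+1)%N = (2 * k).+2); last by rewrite mulnS.
rewrite E (_ : \sum_(0 <= j < (2 * k).+1) b (gcube (k.+1%:Z - j.+1%:Z) x) =
  \sum_(0 <= j < (2 * k).+1) b (gcube (k%:Z - j%:Z) x)).
  by rewrite addrCA lerDl addr_ge0.
apply: eq_bigr => j _; congr (b (gcube _ _)); rewrite -[k.+1]addn1 -[j.+1]addn1 !PoszD; ring.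
Qed.

Lemma finite_le_gridsum (s : seq (cube R d)) x : uniq s -> (forall I, I \in s -> D I) ->
  exists k, \sum_(I <- s) b I * \1_(cubeset I) x <= gridsum k x.
Proof.
move=> us sD; have [sideD _ _] := gridD.
have [k kP] : exists k : nat, forall I, I \in s ->
    exists2 j : int, side I = 2 ^ j & (`|j| <= k)%N.
  elim: s us sD => [|I s IH] us sD; first by exists 0%N.
  have /andP[_ us'] := us; have [|k kP] := IH us'.
    by move=> J Js; apply: sD; rewrite inE Js orbT.
  have [j jI] := sideD I (sD I (mem_head _ _)).
  exists (maxn k `|j|%N) => J; rewrite inE => /predU1P[->|/kP[i si ik]].
    by exists j => //; rewrite leq_maxr.
  by exists i => //; rewrite (leq_trans ik)// leq_maxl.
exists k; rewrite gridsumE.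
rewrite (_ : \sum_(I <- s) _ = \sum_(I <- [seq I <- s | x \in cubeset I]) b I); last first.
  rewrite big_filter [RHS]big_mkcond; apply: eq_bigr => I _.
  by rewrite indicE; case: ifP; rewrite ?mulr1 ?mulr0.
rewrite -(big_map (fun j : nat => gcube (k%:Z - j%:Z) x) predT b).
apply: ler_sum_uniq_sub => //; first exact: filter_uniq.
move=> I; rewrite mem_filter => /andP[/set_mem xI Is].
have [j sj jk] := kP I Is.
have [_ _ _ u] := gcubeP gridD j x.
rewrite (u I (sD I Is) sj xI); apply/mapP; exists `|k%:Z - j|%N.
  by rewrite mem_index_iota; lia.
by congr (gcube _ _); lia.
Qed.

Lemma esum_le_gridsum x (M : R) : (forall k, gridsum k x <= M) ->
  (\esum_(I in D) (b I * \1_(cubeset I) x)%:E <= M%:E)%E.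
Proof.
move=> hM; apply: ub_ereal_sup => _ /= [A [finA AD] <-].
rewrite fsbig_finite//= sumEFin lee_fin.
have [|k hk] := @finite_le_gridsum (finmap.enum_fset (fset_set A)) x (finmap.fset_uniq _).
  by move=> I IA; apply: AD; rewrite -(fset_setK finA).
exact: le_trans hk (hM k).
Qed.

(** Each truncated sum is handled on the cubes of its top generation, and the
    truncations increase to the sum over the grid. *)
Lemma grid_integral_le (kappa c : R) (g : Rspace R d -> \bar R) : 0 < kappa -> 0 <= c ->
  measurable_fun setT g -> (forall x, 0 <= g x)%E ->
  (forall K m, \int[mu]_(x in cubeset K) (pathsum b m 0 K x `^ kappa)%:E <=
     c%:E * \int[mu]_(x in cubeset K) g x)%E ->
  (\int[mu]_x ((\esum_(I in D) (b I * \1_(cubeset I) x)%:E) `^ kappa)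
    <= c%:E * \int[mu]_x g x)%E.
Proof.
move=> k0 c0 mg g0 hg.
pose h k x := (gridsum k x `^ kappa)%:E.
have mh k : measurable_fun setT (h k).
  by apply/measurable_EFinP; exact: (measurable_gridsum (fun u => u `^ kappa)).
have h0 k x : (0 <= h k x)%E by rewrite lee_fin powR_ge0.
have ndh x : nondecreasing_seq (h ^~ x).
  move=> k l kl; rewrite lee_fin ge0_ler_powR ?nnegrE ?gridsum_ge0 ?(ltW k0)//.
  exact: gridsum_nd.
have hk k : (\int[mu]_x h k x <= c%:E * \int[mu]_x g x)%E.
  apply: (integral_grid_le (k := k%:Z)) => // y.
  rewrite (eq_integral (fun x => (pathsum b (2 * k) 0 (gcube k%:Z y) x `^ kappa)%:E)).
    exact: hg.
  by move=> x; rewrite inE => xj; rewrite /h /gridsum (gcube_eq xj).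
have cvgh x : cvgn (h ^~ x) by exact: ereal_nondecreasing_is_cvgn.
apply: (@le_trans _ _ (\int[mu]_x limn (h ^~ x))%E); last first.
  rewrite monotone_convergence//; apply: lime_le; last exact: nearW.
  apply: ereal_nondecreasing_is_cvgn => k l kl; apply: ge0_le_integral => //.
  by move=> x _; exact: ndh.
have lim_ge x k : (h k x <= limn (h ^~ x))%E.
  rewrite (cvg_lim _ (ereal_nondecreasing_cvgn (ndh x)))//.
  by apply: ereal_sup_ubound; exists k.
have lim0 x : (0 <= limn (h ^~ x))%E by exact: le_trans (h0 0%N x) (lim_ge x 0%N).
apply: (ge0_le_integral_null measurable0 (measure0 _)) => // [x|x _]; first exact: poweR_ge0.
have := lim_ge x; have := lim0 x; case: (limn (h ^~ x)) => [M|_ _|//]; last exact: leey.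
rewrite lee_fin => M0 hM.
have -> : M%:E = ((M `^ kappa^-1)%:E `^ kappa)%E.
  by rewrite poweR_EFin -powRrM mulVf ?gt_eqF// powRr1.
apply: gt0_ler_poweR; first exact: ltW.
- rewrite in_itv/= leey andbT; apply: esum_ge0 => I _.
  by rewrite lee_fin mulr_ge0// indicE.
- by rewrite in_itv/= leey andbT lee_fin powR_ge0.
apply: esum_le_gridsum => k.
have -> : gridsum k x = (gridsum k x `^ kappa) `^ kappa^-1.
  by rewrite -powRrM mulfV ?gt_eqF// powRr1// gridsum_ge0.
by apply: ge0_ler_powR; rewrite ?nnegrE ?powR_ge0 ?invr_ge0 ?(ltW k0)// -lee_fin hM.
Qed.

End GridIntegral.

(** * Logarithmic averages and reverse Hoelder for the weight *)

Section ScalarLogarithms.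
Variable R : realType.
Implicit Types t a : R.

Lemma ln_le_tangent t a : 0 < t -> 0 < a -> ln t <= a^-1 * t + (ln a - 1).
Proof.
move=> t0 a0; have ta : 0 < t / a by rewrite divr_gt0.
have : ln (t / a) <= t / a - 1.
  by rewrite -[X in ln X](subrK 1) [in leLHS]addrC le_ln1Dx// ltrBrDl subrr.
by rewrite ln_div ?posrE//; rewrite [t / a]mulrC; lra.
Qed.

Lemma ln_le_powR t a : 0 < t -> 1 <= a -> ln t <= t `^ a.
Proof.
move=> t0 a1; have [t1|t1] := leP 1 t.
  apply: le_trans (le1r_powR t1 a1); have := ln_le_tangent t0 ltr01.
  by rewrite ln1 invr1; lra.
by apply: (@le_trans _ _ 0); [exact/ln_le0/ltW|exact: powR_ge0].
Qed.

Lemma ln_sqr_le t a b : 0 < t -> 0 < a -> 0 < b -> t ^+ 2 <= a * b ->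
  2 * ln t <= ln a + ln b.
Proof.
move=> t0 a0 b0; rewrite -lnM ?posrE// mulr_natl -lnXn// ler_ln ?posrE ?exprn_gt0//.
exact: mulr_gt0.
Qed.

End ScalarLogarithms.

(** Used with the exponents 1/p and -1/p, which give dual norms on C^n. *)
HB.lock Definition weight_norm (R : realType) (n d : nat)
    (W : Rspace R d -> 'M[R[i]]_n) (s : R) (v : 'cV[R[i]]_n) (x : Rspace R d) : R :=
  cnorm (powmx (W x) s *m v).

Section WeightHypotheses.
Variables (R : realType) (n d : nat).
Implicit Types (W : Rspace R d -> 'M[R[i]]_n) (V : cube R d -> 'M[R[i]]_n).

Definition reducing_upper (p c : R) W V := forall I (e : 'cV[R[i]]_n),
  ((vol I `^ (- p^-1))%:E *
    Lnorm_vec p (fun x => (\1_(cubeset I) x : R)%:C *: (powmx (W x) p^-1 *m e))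
    <= (c * cnorm (V I *m e))%:E)%E.

Definition Apinfty_bound (p c : R) W V := forall (I : cube R d) (e : 'cV[R[i]]_n), e != 0 ->
  (expeR ((vol I)^-1%:E *
     \int[leb R d]_(x in cubeset I) (ln (cnorm (powmx (W x) (- p^-1) *m e)))%:E)
   <= (c * cnorm (invmx (V I) *m e))%:E)%E.

End WeightHypotheses.

Section MatrixWeight.
Variables (R : realType) (n d : nat) (p c2 C0 : R).
Local Notation mu := (leb R d).
Variables (W : Rspace R d -> 'M[R[i]]_n) (V : cube R d -> 'M[R[i]]_n).
Hypotheses (mW : measurable_cmx W) (pW : forall x, posdefmx (W x)).
Hypotheses (p_gt1 : 1 < p) (c2_gt0 : 0 < c2) (C0_gt0 : 0 < C0).
Hypothesis pV : forall I, posdefmx (V I).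
Hypotheses (upperV : reducing_upper p c2 W V) (ApinfV : Apinfty_bound p C0 W V).
Implicit Types (K : cube R d) (e v : 'cV[R[i]]_n).

Let p_gt0 : 0 < p. Proof. exact: lt_trans ltr01 p_gt1. Qed.
Let p_neq0 : p != 0. Proof. by rewrite gt_eqF. Qed.

Lemma weight_normE s v x : weight_norm W s v x = cnorm (powmx (W x) s *m v).
Proof. by rewrite unlock. Qed.

Lemma measurable_weight_norm s v : measurable_fun setT (weight_norm W s v).
Proof.
rewrite (funext (weight_normE s v)).
apply: measurable_cnorm; apply: measurable_cmx_mul; last exact: measurable_cmx_cst.
exact: measurable_powmx.
Qed.

Lemma weight_norm_ge0 s v x : 0 <= weight_norm W s v x.
Proof. by rewrite weight_normE cnorm_ge0. Qed.

Lemma weight_norm_gt0 s v x : v != 0 -> 0 < weight_norm W s v x.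
Proof. by move=> v0; rewrite weight_normE; apply: cnorm_mul_gt0 => //; apply: powmx_unit. Qed.

Local Notation posnorm := (weight_norm W p^-1).
Local Notation negnorm := (weight_norm W (- p^-1)).

Lemma normc_cdot_le e v x :
  ComplexField.Normc.normc (cdot e v) <= negnorm e x * posnorm v x.
Proof. by rewrite !weight_normE (cdot_powmx p^-1 e v (pW x)) cdot_CS. Qed.

(** The upper bound in the definition of the reducing matrices, with the p-th
    powers undone. *)
Lemma integral_posnorm_le K v : (\int[mu]_(x in cubeset K) (posnorm v x `^ p)%:E
  <= (vol K * (c2 * cnorm (V K *m v)) `^ p)%:E)%E.
Proof.
have v0 := vol_gt0 K.
set X := (\int[mu]_(x in cubeset K) (posnorm v x `^ p)%:E)%E.
have X0 : (0 <= X)%E by apply: integral_ge0 => x _; rewrite lee_fin powR_ge0.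
have := upperV K v.
have -> : Lnorm_vec p (fun x => (\1_(cubeset K) x : R)%:C *: (powmx (W x) p^-1 *m v)) =
   (X `^ p^-1)%E.
  rewrite /Lnorm_vec /X [in RHS]integral_mkcond; congr (poweR _ _).
  apply: eq_integral => x _; rewrite /patch cnorm_real_scale indicE.
  case: ifP => xK; first by rewrite normr1 mul1r weight_normE.
  by rewrite normr0 mul0r powR0.
have c0 : 0 <= c2 * cnorm (V K *m v) by rewrite mulr_ge0 ?cnorm_ge0// ltW.
move=> h.
have : (((vol K `^ (- p^-1))%:E * X `^ p^-1) `^ p <= ((c2 * cnorm (V K *m v))%:E) `^ p)%E.
  apply: gt0_ler_poweR => //; first exact: ltW.
  - by rewrite in_itv/= leey andbT mule_ge0// ?lee_fin ?powR_ge0// poweR_ge0.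
  - by rewrite in_itv/= leey andbT lee_fin.
rewrite poweRM ?lee_fin ?powR_ge0 ?poweR_ge0// -poweRrM mulVf// poweRe1//.
rewrite !poweR_EFin -powRrM mulNr mulVf// powRN powRr1 ?(ltW v0)//.
by rewrite EFinM lee_pdivrMl.
Qed.

Lemma ApinfV_negnorm K e : e != 0 -> (expeR ((vol K)^-1%:E *
    \int[mu]_(x in cubeset K) (ln (negnorm e x))%:E)
  <= (C0 * cnorm (invmx (V K) *m e))%:E)%E.
Proof. by under eq_integral do rewrite weight_normE; exact: ApinfV. Qed.

Lemma sqr_cnorm_le e x : cnorm e ^+ 2 <= negnorm e x * posnorm e x.
Proof.
apply: le_trans (normc_cdot_le e e x).
by rewrite cdotvv /= expr0n/= addr0 sqrtr_sqr ger0_norm// sqr_ge0.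
Qed.

Lemma ln_cnorm_le e x : e != 0 ->
  2 * ln (cnorm e) <= ln (negnorm e x) + ln (posnorm e x).
Proof.
move=> e0; apply: ln_sqr_le (sqr_cnorm_le e x); first exact: cnorm_gt0.
- exact: weight_norm_gt0.
- exact: weight_norm_gt0.
Qed.

Lemma locint_posnorm v : locint (fun x => posnorm v x `^ p).
Proof.
move=> K; apply/integrableP; split.
  apply/measurable_EFinP; apply: measurable_funTS.
  exact: (measurableT_comp (measurable_powR _) (measurable_weight_norm p^-1 v)).
apply: le_lt_trans (ltry (vol K * (c2 * cnorm (V K *m v)) `^ p)).
apply: le_trans (integral_posnorm_le K v).
by under eq_integral do rewrite /= ger0_norm ?powR_ge0//.
Qed.

Lemma cube_avg_posnorm_le K v :
  cube_avg (fun x => posnorm v x `^ p) K <= (c2 * cnorm (V K *m v)) `^ p.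
Proof.
have v0 := vol_gt0 K; rewrite /cube_avg mulrC ler_pdivrMr// mulrC.
rewrite -lee_fin fineK ?integral_posnorm_le//.
by apply: integrable_fin_num; [exact: measurable_cubeset|exact: locint_posnorm].
Qed.

Lemma ln_negnorm_ge e x : e != 0 ->
  2 * ln (cnorm e) - posnorm e x `^ p <= ln (negnorm e x).
Proof.
move=> e0; have h := ln_cnorm_le x e0.
by have := ln_le_powR (weight_norm_gt0 p^-1 x e0) (ltW p_gt1); move: h; lra.
Qed.

(** The negative part is integrable because the dual norm |W^(1/p) e| is
    p-integrable; the positive part because the A_(p,infinity) bound is
    finite. *)
Lemma locint_ln_negnorm e : e != 0 -> locint (fun x => ln (negnorm e x)).
Proof.
move=> e0 K; set f := fun x => ln (negnorm e x).
have mK := measurable_cubeset K.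
have mf : measurable_fun (cubeset K) (EFin \o f).
  apply/measurable_EFinP; apply: measurable_funTS.
  exact: (measurableT_comp (@measurable_ln R) (measurable_weight_norm (- p^-1) e)).
pose g x := `|2 * ln (cnorm e)| + posnorm e x `^ p.
have ig : mu.-integrable (cubeset K) (EFin \o g).
  by apply: locintD; [exact: locint_cst|exact: locint_posnorm].
have g0 x : 0 <= g x by rewrite addr_ge0 ?powR_ge0.
have fneg : (\int[mu]_(x in cubeset K) ((EFin \o f)^\- x) < +oo)%E.
  have := ig => /integrableP[mg]; apply: le_lt_trans.
  apply: ge0_le_integral => //.
  - exact: measurable_funeneg.
  - exact: measurableT_comp.
  - move=> x _; rewrite funenegE /= ger0_norm// ge_max !lee_fin g0 andbT.
    have := ln_negnorm_ge x e0; rewrite /g /f.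
    by have := ler_norm (- (2 * ln (cnorm e))); rewrite normrN; lra.
have fpos : (\int[mu]_(x in cubeset K) ((EFin \o f)^\+ x) < +oo)%E.
  rewrite ltNge leye_eq; apply/negP => /eqP foo.
  have := ApinfV_negnorm K e0; rewrite -/f.
  have -> : (\int[mu]_(x in cubeset K) (f x)%:E)%E = +oo%E.
    rewrite integralE foo; move: fneg.
    have : (0 <= \int[mu]_(x in cubeset K) ((EFin \o f)^\- x))%E by exact: integral_ge0.
    by case: (\int[mu]_(x in cubeset K) ((EFin \o f)^\- x))%E.
  by rewrite gt0_muley ?lte_fin ?invr_gt0 ?vol_gt0//= leye_eq.
apply/integrableP; split => //.
rewrite (_ : (fun x => _) = (fun x => (EFin \o f)^\+ x + (EFin \o f)^\- x)%E); last first.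
  by apply/funext => x; rewrite -[LHS]/((abse \o (EFin \o f)) x) fune_abse.
rewrite ge0_integralD//; first exact: lte_add_pinfty.
- exact: measurable_funepos.
- exact: measurable_funeneg.
Qed.

Lemma cube_avg_ln_negnorm_le K e : e != 0 ->
  cube_avg (fun x => ln (negnorm e x)) K <= ln (C0 * cnorm (invmx (V K) *m e)).
Proof.
move=> e0; have i0 := locint_ln_negnorm e0 K.
have := ApinfV_negnorm K e0.
have -> : (\int[mu]_(x in cubeset K) (ln (negnorm e x))%:E)%E =
   (\int[mu]_(x in cubeset K) ln (negnorm e x))%:E.
  by rewrite /Rintegral fineK//; apply: (integrable_fin_num _ i0); exact: measurable_cubeset.
rewrite -EFinM /= lee_fin -/(cube_avg _ K) => h.
have c0 : 0 < C0 * cnorm (invmx (V K) *m e) by exact: lt_le_trans (expR_gt0 _) h.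
by rewrite -ler_expR lnK ?posrE.
Qed.

Lemma ln_posnorm_bound v x : v != 0 ->
  `|ln (posnorm v x)| <= `|2 * ln (cnorm v)| + `|ln (negnorm v x)| + posnorm v x `^ p.
Proof.
move=> v0; have h2 := ln_cnorm_le x v0.
have h3 := ln_le_powR (weight_norm_gt0 p^-1 x v0) (ltW p_gt1).
have h4 : 0 <= posnorm v x `^ p by exact: powR_ge0.
have h5 := ler_norm (- (2 * ln (cnorm v))); rewrite normrN in h5.
have h6 := ler_norm (ln (negnorm v x)).
have h7 := normr_ge0 (2 * ln (cnorm v)).
have h8 := normr_ge0 (ln (negnorm v x)).
by rewrite ler_norml; apply/andP; split; lra.
Qed.

Lemma locint_ln_posnorm v : v != 0 -> locint (fun x => ln (posnorm v x)).
Proof.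
move=> v0; apply: (locint_le (g := fun x =>
  `|2 * ln (cnorm v)| + `|ln (negnorm v x)| + posnorm v x `^ p)).
- exact: (measurableT_comp (@measurable_ln R) (measurable_weight_norm p^-1 v)).
- by move=> x; exact: ln_posnorm_bound.
- apply: locintD; last exact: locint_posnorm.
  apply: locintD; first exact: locint_cst.
  by move=> K; apply: integrable_norm; exact: locint_ln_negnorm.
Qed.

(** Jensen's inequality, through the tangent of ln at the left-hand side. *)
Lemma expR_cube_avg_ln_posnorm_le K v : v != 0 ->
  expR (p * cube_avg (fun x => ln (posnorm v x)) K) <= cube_avg (fun x => posnorm v x `^ p) K.
Proof.
move=> v0; have ip := locint_posnorm v; have il := locint_ln_posnorm v0.
pose y := p * cube_avg (fun x => ln (posnorm v x)) K.
pose a := expR y; have a0 : 0 < a by exact: expR_gt0.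
have : cube_avg (fun x => p * ln (posnorm v x)) K <=
    cube_avg (fun x => a^-1 * posnorm v x `^ p + (ln a - 1)) K.
  apply: le_cube_avg; [exact: locintZ|by apply: locintD; [exact: locintZ|exact: locint_cst]|].
  move=> x; rewrite -ln_powR; apply: ln_le_tangent => //.
  by rewrite powR_gt0// weight_norm_gt0.
rewrite cube_avgZ// cube_avgD ?cube_avg_cst ?cube_avgZ//; [|exact: locintZ|exact: locint_cst].
rewrite -/y /a expRK => h.
have : 1 <= (expR y)^-1 * cube_avg (fun x => posnorm v x `^ p) K by lra.
by rewrite mulrC ler_pdivlMr ?expR_gt0// mul1r.
Qed.

Lemma cube_avg_posnorm_gt0 K v : v != 0 -> 0 < cube_avg (fun x => posnorm v x `^ p) K.
Proof. by move=> v0; exact: lt_le_trans (expR_gt0 _) (expR_cube_avg_ln_posnorm_le K v0). Qed.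

Lemma cube_avg_ln_posnorm_le K v : v != 0 ->
  p * cube_avg (fun x => ln (posnorm v x)) K <= ln (cube_avg (fun x => posnorm v x `^ p) K).
Proof.
move=> v0; rewrite -ler_expR lnK ?posrE ?cube_avg_posnorm_gt0//.
exact: expR_cube_avg_ln_posnorm_le.
Qed.

(** The pairing inequality in logarithmic average form; it converts bounds for one
    of the two dual norms into bounds for the other. *)
Lemma ln_cdot_le K e v : e != 0 -> v != 0 -> cdot e v != 0 ->
  ln (ComplexField.Normc.normc (cdot e v)) <=
  cube_avg (fun x => ln (negnorm e x)) K + cube_avg (fun x => ln (posnorm v x)) K.
Proof.
move=> e0 v0 ev0; rewrite -cube_avgD; [|exact: locint_ln_negnorm|exact: locint_ln_posnorm].
rewrite -[leLHS](cube_avg_cst _ K); apply: le_cube_avg.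
- exact: locint_cst.
- by apply: locintD; [exact: locint_ln_negnorm|exact: locint_ln_posnorm].
move=> x; rewrite -lnM ?posrE ?weight_norm_gt0 ?weight_norm_gt0//.
rewrite ler_ln ?posrE ?mulr_gt0 ?weight_norm_gt0 ?weight_norm_gt0 ?normc_cdot_le//.
rewrite lt_neqAle normc_ge0 andbT eq_sym; apply: contra ev0 => /eqP.
by move/ComplexField.Normc.eq0_normc => ->.
Qed.

(** Test the pairing with e = V_K V_K v, for which <e, v> = |V_K v|^2 and
    |V_K^(-1) e| = |V_K v|. *)
Lemma cube_avg_ln_posnorm_ge K v : v != 0 ->
  ln (cnorm (V K *m v)) - ln C0 <= cube_avg (fun x => ln (posnorm v x)) K.
Proof.
move=> v0; have uV := posdef_unit (pV K).
have sV : selfadjoint (V K) by apply: hermsymmx_selfadjoint; case: (pV K).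
pose e := V K *m (V K *m v).
have Vv := cnorm_mul_gt0 uV v0.
have Vv0 := cnorm_neq0 Vv.
have e0 : e != 0 := cnorm_neq0 (cnorm_mul_gt0 uV Vv0).
have E : cdot e v = (cnorm (V K *m v) ^+ 2)%:C by rewrite /e cdot_selfadjoint// cdotvv.
have ev0 : cdot e v != 0.
  rewrite E eq_complex /= negb_and; apply/orP; left.
  by rewrite sqrf_eq0 gt_eqF.
have h1 := ln_cdot_le K e0 v0 ev0.
rewrite E /= expr0n/= addr0 sqrtr_sqr ger0_norm ?sqr_ge0// lnXn// mulr2n in h1.
have h2 := cube_avg_ln_negnorm_le K e0.
rewrite /e mulKmx// lnM ?posrE// -/e in h2.
by move: h1 h2; lra.
Qed.

(** Test the pairing with v = V_K^(-1) V_K^(-1) e, for which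
    <e, v> = |V_K^(-1) e|^2 and |V_K v| = |V_K^(-1) e|. *)
Lemma ln_invV_le K e : e != 0 ->
  ln (cnorm (invmx (V K) *m e)) <= cube_avg (fun x => ln (negnorm e x)) K + ln c2.
Proof.
move=> e0; have uV := posdef_unit (pV K).
have sV : selfadjoint (invmx (V K)).
  by apply: selfadjoint_inv => //; apply: hermsymmx_selfadjoint; case: (pV K).
have uVi : invmx (V K) \in unitmx by rewrite unitmx_inv.
pose v := invmx (V K) *m (invmx (V K) *m e).
have Ve := cnorm_mul_gt0 uVi e0.
have Ve0 := cnorm_neq0 Ve.
have v0 : v != 0 := cnorm_neq0 (cnorm_mul_gt0 uVi Ve0).
have E : cdot e v = (cnorm (invmx (V K) *m e) ^+ 2)%:C.
  by rewrite /v -cdot_selfadjoint// cdotvv.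
have ev0 : cdot e v != 0.
  rewrite E eq_complex /= negb_and; apply/orP; left.
  by rewrite sqrf_eq0 gt_eqF.
have h1 := ln_cdot_le K e0 v0 ev0.
rewrite E /= expr0n/= addr0 sqrtr_sqr ger0_norm ?sqr_ge0// lnXn// mulr2n in h1.
have h2 := cube_avg_ln_posnorm_le K v0.
have h3 : ln (cube_avg (fun x => posnorm v x `^ p) K) <= p * ln (c2 * cnorm (invmx (V K) *m e)).
  have c0 : 0 < (c2 * cnorm (invmx (V K) *m e)) `^ p by rewrite powR_gt0// mulr_gt0.
  rewrite -ln_powR ler_ln ?posrE ?cube_avg_posnorm_gt0//.
  by apply: le_trans (cube_avg_posnorm_le K v) _; rewrite /v mulKVmx.
have h4 := le_trans h2 h3; rewrite ler_pM2l// lnM ?posrE// in h4.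
lra.
Qed.

(** The exponent is the same for all v, since c depends on the constants c2, C0
    and p only. *)
Lemma reverse_hoelder_posnorm : exists2 del : R, 0 < del & forall v, v != 0 ->
  forall m K, level_avg (@child R d) m (fun K => cube_avg (fun x => posnorm v x `^ p) K `^ (1 + del)) K
   <= 2 * cube_avg (fun x => posnorm v x `^ p) K `^ (1 + del).
Proof.
pose c := p * (ln c2 + ln C0).
pose N : R := #|{: {ffun 'I_d -> bool}}|%:R.
have N0 : 0 < N by rewrite ltr0n card_children.
pose D := 16 * N * expR (2 * c).
have D0 : 0 < D by rewrite !mulr_gt0// expR_gt0.
exists (Num.min 2^-1 D^-1).
  by rewrite lt_min invr_gt0 ltr0n/= invr_gt0.
move=> v v0; apply: (tree_reverse_hoelder (card_children d)
   (y := fun K => p * cube_avg (fun x => ln (posnorm v x)) K) (c := c)).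
- exact/cube_avg_martingale/locint_posnorm.
- move=> K; rewrite (cube_avg_martingale (locint_ln_posnorm v0)) -avgZ//.
- by move=> K; exact: cube_avg_posnorm_gt0.
- move=> K; rewrite cube_avg_ln_posnorm_le//=.
  have h1 := cube_avg_ln_posnorm_ge K v0.
  have Vv := cnorm_mul_gt0 (posdef_unit (pV K)) v0.
  have : ln (cube_avg (fun x => posnorm v x `^ p) K) <= p * ln (c2 * cnorm (V K *m v)).
    have c0 : 0 < (c2 * cnorm (V K *m v)) `^ p by rewrite powR_gt0// mulr_gt0.
    by rewrite -ln_powR ler_ln ?posrE ?cube_avg_posnorm_gt0 ?cube_avg_posnorm_le.
  move=> /le_trans; apply; rewrite /c -mulrDr ler_pM2l// lnM ?posrE//; lra.
- by rewrite lt_min ge_min lexx invr_gt0 ltr0n/= invr_gt0 D0.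
- rewrite -/N -/D -[leRHS](mulVf (x := D)) ?gt_eqF// ler_pM2r// ge_min lexx orbT//.
Qed.

End MatrixWeight.

(** * Pairing the weight with the function *)

(** Integrating this inequality, with a and b bounds for the means of u^p and
    w^q, gives Hoelder's inequality. *)
Lemma hoelder_pointwise (R : realType) (p q u w a b : R) : 0 < p -> 0 < q ->
  p^-1 + q^-1 = 1 -> 0 <= u -> 0 <= w -> 0 < a -> 0 < b ->
  u * w <= a `^ p^-1 * b `^ q^-1 * (a^-1 * p^-1) * u `^ p +
           a `^ p^-1 * b `^ q^-1 * (b^-1 * q^-1) * w `^ q.
Proof.
move=> p0 q0 pq1 u0 w0 a0 b0.
have root (c t r : R) : 0 < c -> 0 <= t -> 0 < r -> (t / c `^ r^-1) `^ r = t `^ r / c.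
  move=> c0 t0 r0; have C0 : 0 < c `^ r^-1 by rewrite powR_gt0.
  have Cr : (c `^ r^-1) `^ r = c by rewrite -powRrM mulVf ?gt_eqF// powRr1// ltW.
  apply: (mulIf (x := c)); first by rewrite gt_eqF.
  rewrite divfK ?gt_eqF// -{2}Cr -powRM ?divr_ge0 ?(ltW C0)// divfK// gt_eqF//.
set A := a `^ p^-1; set B := b `^ q^-1.
have A0 : 0 < A by rewrite powR_gt0.
have B0 : 0 < B by rewrite powR_gt0.
have := conjugate_powR (divr_ge0 u0 (ltW A0)) (divr_ge0 w0 (ltW B0)) p0 q0 pq1.
rewrite !root// => /(ler_wpM2l (ltW (mulr_gt0 A0 B0))).
have -> : A * B * (u / A * (w / B)) = u * w by field; rewrite !gt_eqF.
move=> /le_trans; apply.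
by rewrite le_eqVlt; apply/orP; left; apply/eqP; ring.
Qed.

Section WeightedFunction.
Variables (R : realType) (n d : nat) (p q : R).
Local Notation mu := (leb R d).
Local Notation T := {ffun 'I_d -> bool}.
Variables (W : Rspace R d -> 'M[R[i]]_n) (f : Rspace R d -> 'cV[R[i]]_n).
Hypotheses (mW : measurable_cmx W) (pW : forall x, posdefmx (W x)).
Hypotheses (mf : measurable_cmx f).
Hypotheses (p_gt0 : 0 < p) (q_gt0 : 0 < q) (pq1 : p^-1 + q^-1 = 1).
Hypothesis locint_pos : forall v, locint (fun x => weight_norm W p^-1 v x `^ p).
Local Notation posnorm := (weight_norm W p^-1).

Definition dualnorm x : R := cnorm (powmx (W x) (- p^-1) *m f x).

Hypothesis dual_fin : (\int[mu]_x (dualnorm x `^ q)%:E < +oo)%E.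

Lemma dualnorm_ge0 x : 0 <= dualnorm x. Proof. exact: cnorm_ge0. Qed.

Lemma measurable_dualnorm : measurable_fun setT dualnorm.
Proof.
apply: measurable_cnorm; apply: (measurable_cmx_mul _ mf).
exact: measurable_powmx.
Qed.

Lemma measurable_dualnorm_powR : measurable_fun setT (fun x => dualnorm x `^ q).
Proof. exact: (measurableT_comp (measurable_powR _) measurable_dualnorm). Qed.

Lemma locint_dualnorm : locint (fun x => dualnorm x `^ q).
Proof.
move=> K; apply: (@integrableS _ _ _ _ setT) => //; first exact: measurable_cubeset.
apply/integrableP; split; first by apply/measurable_EFinP; exact: measurable_dualnorm_powR.
rewrite (eq_integral (fun x => (dualnorm x `^ q)%:E)) => [|x _]; first exact: dual_fin.
by rewrite /= ger0_norm ?powR_ge0.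
Qed.

Lemma posnorm_dualnorm_le v x : posnorm v x * dualnorm x <=
  posnorm v x `^ p + dualnorm x `^ q.
Proof.
have := conjugate_powR (weight_norm_ge0 W p^-1 v x) (dualnorm_ge0 x) p_gt0 q_gt0 pq1.
move=> /le_trans; apply; apply: lerD.
- rewrite ler_pdivrMr// ler_peMr ?powR_ge0//.
  by rewrite -(invrK p) -[leLHS]invr1 lef_pV2 ?posrE ?invr_gt0// -pq1 lerDl invr_ge0 ltW.
- rewrite ler_pdivrMr// ler_peMr ?powR_ge0//.
  by rewrite -(invrK q) -[leLHS]invr1 lef_pV2 ?posrE ?invr_gt0// -pq1 lerDr invr_ge0 ltW.
Qed.

Lemma measurable_posnorm_dualnorm v : measurable_fun setT (fun x => posnorm v x * dualnorm x).
Proof.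
by apply: measurable_funM; [exact: measurable_weight_norm|exact: measurable_dualnorm].
Qed.

Lemma locint_posnorm_dualnorm v : locint (fun x => posnorm v x * dualnorm x).
Proof.
apply: (locint_le (g := fun x => posnorm v x `^ p + dualnorm x `^ q)).
- exact: measurable_posnorm_dualnorm.
- move=> x; rewrite ger0_norm ?posnorm_dualnorm_le//.
  by rewrite mulr_ge0 ?weight_norm_ge0 ?dualnorm_ge0.
- by apply: locintD => //; exact: locint_dualnorm.
Qed.

Lemma cube_avg_posnorm_dualnorm_le v K (a b : R) : 0 < a -> 0 < b ->
  cube_avg (fun x => posnorm v x `^ p) K <= a -> cube_avg (fun x => dualnorm x `^ q) K <= b ->
  cube_avg (fun x => posnorm v x * dualnorm x) K <= a `^ p^-1 * b `^ q^-1.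
Proof.
move=> a0 b0 ha hb.
set A := a `^ p^-1; set B := b `^ q^-1.
have i1 : locint (fun x => (A * B * (a^-1 * p^-1)) * posnorm v x `^ p).
  exact: locintZ.
have i2 : locint (fun x => (A * B * (b^-1 * q^-1)) * dualnorm x `^ q).
  by apply: locintZ; exact: locint_dualnorm.
apply: (@le_trans _ _ (cube_avg (fun x => (A * B * (a^-1 * p^-1)) * posnorm v x `^ p +
    (A * B * (b^-1 * q^-1)) * dualnorm x `^ q) K)).
  apply: le_cube_avg; [exact: locint_posnorm_dualnorm|exact: locintD|].
  by move=> x; apply: hoelder_pointwise; rewrite ?weight_norm_ge0 ?dualnorm_ge0.
rewrite cube_avgD// cube_avgZ// cube_avgZ; last exact: locint_dualnorm.
have AB : 0 <= A * B by rewrite mulr_ge0 ?powR_ge0.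
rewrite -[leRHS]mulr1 -pq1 mulrDr -!(mulrA (A * B)).
apply: lerD; apply: ler_wpM2l => //; rewrite mulrAC; apply: ler_piMl.
- by rewrite invr_ge0 ltW.
- by rewrite ler_pdivrMl// mulr1.
- by rewrite invr_ge0 ltW.
- by rewrite ler_pdivrMl// mulr1.
Qed.

Lemma normc_cdot_dualnorm_le v x :
  ComplexField.Normc.normc (cdot v (f x)) <= posnorm v x * dualnorm x.
Proof.
rewrite (cdot_powmx (- p^-1) v (f x) (pW x)) opprK.
by rewrite weight_normE cdot_CS.
Qed.

End WeightedFunction.

(** * Haar coefficients of vector functions *)

Section HaarLinear.
Variables (R : realType) (d : nat).
Local Notation mu := (leb R d).

Lemma haar_coefficient_sum (I : finType) (u : I -> Rspace R d -> R) (a : I -> R) K eps :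
  (forall i, locint (u i)) ->
  \int[mu]_x ((\sum_i a i * u i x) * haar K eps x) =
  \sum_i a i * \int[mu]_x (u i x * haar K eps x).
Proof.
move=> iu; have iau i : locint (fun x => a i * u i x) by exact: locintZ.
rewrite haar_coefficient; last exact: locint_sum.
set c := vol K * _.
rewrite (eq_bigr (fun i => c * (a i * avg (fun e => haar_sign R eps e * cube_avg (u i) (child e K))))).
  rewrite -mulr_sumr; congr (_ * _).
  under eq_bigr do rewrite -avgZ.
  rewrite -avg_sumr; apply: eq_avg => e.
  rewrite cube_avg_sum// mulr_sumr; apply: eq_bigr => i _.
  by rewrite cube_avgZ// mulrCA.
by move=> i _; rewrite haar_coefficient// mulrCA.
Qed.

End HaarLinear.

Section ComplexComponents.
Variable R : realType.
Local Notation normc := ComplexField.Normc.normc.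

Definition reim (b : bool) (z : R[i]) : R := if b then complex.Re z else complex.Im z.

Lemma reim_le_normc b (z : R[i]) : `|reim b z| <= normc z.
Proof.
rewrite -[leRHS]ger0_norm ?normc_ge0// -ler_sqr ?nnegrE// !real_normK ?num_real//.
by rewrite sqr_normc_Re_Im; case: b; rewrite /= ?lerDl ?lerDr sqr_ge0.
Qed.

(** The matrix of the multiplication by z in the real basis (1, i). *)
Definition reim_mul (b c : bool) (z : R[i]) : R :=
  match b, c with
  | true, true => complex.Re z | true, false => - complex.Im z
  | false, true => complex.Im z | false, false => complex.Re z
  end.

Lemma reimM b (z w : R[i]) : reim b (z * w) = \sum_c reim_mul b c z * reim c w.
Proof. by rewrite big_bool; case: b; case: z => ? ?; case: w => ? ? /=; ring. Qed.

Lemma reim_mulmx b n (A : 'M[R[i]]_n) (u : 'cV[R[i]]_n) j :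
  reim b ((A *m u) j 0) = \sum_(l : 'I_n * bool) reim_mul b l.2 (A j l.1) * reim l.2 (u l.1 0).
Proof.
rewrite -(pair_bigA _ (fun k c => reim_mul b c (A j k) * reim c (u k 0)))/= mxE.
have -> : reim b (\sum_k A j k * u k 0) = \sum_k reim b (A j k * u k 0).
  by case: b => /=; rewrite raddf_sum.
by apply: eq_bigr => k _; exact: reimM.
Qed.

Lemma sqr_cnorm_reim n (u : 'cV[R[i]]_n) :
  cnorm u ^+ 2 = \sum_(l : 'I_n * bool) reim l.2 (u l.1 0) ^+ 2.
Proof.
rewrite -(pair_bigA _ (fun k c => reim c (u k 0) ^+ 2))/= sqr_cnorm.
by apply: eq_bigr => k _; rewrite big_bool sqr_normc_Re_Im.
Qed.

Lemma measurable_reim dT (U : measurableType dT) m k (F : U -> 'M[R[i]]_(m, k)) b i j :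
  measurable_cmx F -> measurable_fun setT (fun x => reim b (F x i j)).
Proof. by move=> mF; have [h1 h2] := mF i j; case: b. Qed.

End ComplexComponents.

Section HaarComponents.
Variables (R : realType) (n d : nat).
Local Notation mu := (leb R d).
Variables (f : Rspace R d -> 'cV[R[i]]_n).
Hypothesis locint_f : forall k b, locint (fun x => reim b (f x k 0)).

(** A constant matrix commutes with taking Haar coefficients: the coefficients of
    V^(-1) f are those of a scalar function in each real component. *)
Lemma reim_haar_coef (M : 'M[R[i]]_n) K eps b j :
  reim b ((M *m haar_coef f K eps) j 0) =
  \int[mu]_x (reim b ((M *m f x) j 0) * haar K eps x).
Proof.
rewrite reim_mulmx.
under [RHS]eq_Rintegral do rewrite reim_mulmx.
rewrite haar_coefficient_sum; last by move=> l; exact: locint_f.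
by apply: eq_bigr => -[k c] _; congr (_ * _); rewrite mxE; case: c.
Qed.

Lemma sqr_cnorm_haar_coef_le (M : 'M[R[i]]_n) K eps : Sig eps ->
  (forall k b, locint (fun x => reim b ((M *m f x) k 0))) ->
  cnorm (M *m haar_coef f K eps) ^+ 2 / vol K <=
  \sum_(l : 'I_n * bool) avg (fun c =>
     (cube_avg (fun x => reim l.2 ((M *m f x) l.1 0)) (child c K) -
      cube_avg (fun x => reim l.2 ((M *m f x) l.1 0)) K) ^+ 2).
Proof.
move=> Se iM; rewrite sqr_cnorm_reim mulr_suml; apply: ler_sum => -[j b] _ /=.
by rewrite reim_haar_coef; exact: (sqr_haar_coefficient_le K (iM j b) Se).
Qed.

End HaarComponents.

(** * Replacing the reducing matrices by that of one ancestor *)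

Lemma norm_ln_le (R : realType) (u t a : R) : 0 < u -> 0 < t -> 1 <= a ->
  1 <= u * t -> `|ln u| <= ln u + 2 * t `^ a.
Proof.
move=> u0 t0 a1 ut.
have := @ln_sqr_le _ 1 _ _ ltr01 u0 t0; rewrite expr1n ln1 mulr0 => /(_ ut) h.
have h3 := ln_le_powR t0 a1; have h4 := powR_ge0 t a.
by rewrite ler_norml; apply/andP; split; lra.
Qed.

Section LocalEstimate.
Variables (R : realType) (n d : nat) (p c2 C0 : R).
Local Notation mu := (leb R d).
Local Notation T := {ffun 'I_d -> bool}.
Variables (W : Rspace R d -> 'M[R[i]]_n) (V : cube R d -> 'M[R[i]]_n).
Hypotheses (mW : measurable_cmx W) (pW : forall x, posdefmx (W x)).
Hypotheses (p_gt1 : 1 < p) (c2_gt0 : 0 < c2) (C0_gt0 : 0 < C0).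
Hypothesis pV : forall I, posdefmx (V I).
Hypotheses (upperV : reducing_upper p c2 W V) (ApinfV : Apinfty_bound p C0 W V).
Local Notation posnorm := (weight_norm W p^-1).
Local Notation negnorm := (weight_norm W (- p^-1)).
Local Notation delta j := (delta_mx j 0 : 'cV[R[i]]_n).
Implicit Types (J K : cube R d).

Let p_gt0 : 0 < p. Proof. exact: lt_trans ltr01 p_gt1. Qed.
Let lpos := locint_posnorm mW pW p_gt1 c2_gt0 upperV.
Let lneg := locint_ln_negnorm mW pW p_gt1 c2_gt0 upperV ApinfV.

Lemma delta_neq0 j : delta j != 0.
Proof. by apply: cnorm_neq0; rewrite cnorm_delta. Qed.

Lemma V_delta_neq0 J j : V J *m delta j != 0.
Proof. exact/cnorm_neq0/(cnorm_mul_gt0 (posdef_unit (pV J)))/delta_neq0. Qed.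

Lemma invV_delta_neq0 J j : invmx (V J) *m delta j != 0.
Proof.
by apply/cnorm_neq0/cnorm_mul_gt0; [rewrite unitmx_inv; exact: posdef_unit|exact: delta_neq0].
Qed.

Lemma invV_selfadjoint J : selfadjoint (invmx (V J)).
Proof.
apply: selfadjoint_inv; first exact: posdef_unit.
by apply: hermsymmx_selfadjoint; case: (pV J).
Qed.

(** The nonnegative martingale in K that controls how much larger V_K^(-1) can be
    than V_J^(-1). *)
Definition logosc J K : R :=
  \sum_i cube_avg (fun x => `|ln (negnorm (V J *m delta i) x)|) K.

Let labs J i : locint (fun x => `|ln (negnorm (V J *m delta i) x)|).
Proof. by move=> K; apply: integrable_norm; exact: lneg (V_delta_neq0 J i) K. Qed.

Lemma logosc_martingale J : martingale (@child R d) (logosc J).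
Proof.
by move=> K; rewrite /logosc avg_sumr; apply: eq_bigr => i _; exact: cube_avg_martingale.
Qed.

Lemma logosc_ge0 J K : 0 <= logosc J K.
Proof. by apply: sumr_ge0 => i _; apply: cube_avg_ge0 => x. Qed.

(** The average of the logarithm itself is bounded at J by the A_(p,infinity)
    condition, and that of its negative part by the pairing with V_J^(-1) e_i,
    whose product with V_J e_i is 1. *)
Lemma logosc_root J : logosc J J <= n%:R * (`|ln C0| + 2 * c2 `^ p).
Proof.
rewrite /logosc -[n in n%:R]card_ord mulr_natl -sumr_const; apply: ler_sum => i _.
have uV := posdef_unit (pV J).
set e := V J *m delta i; set e' := invmx (V J) *m delta i.
have e0 : e != 0 by exact: V_delta_neq0.
have e'0 : e' != 0 by exact: invV_delta_neq0.
apply: (@le_trans _ _ (cube_avg (fun x => ln (negnorm e x) + 2 * posnorm e' x `^ p) J)).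
  apply: le_cube_avg; first exact: labs.
    exact: (locintD (lneg e0) (locintZ 2 (lpos e'))).
  move=> x; have u0 := weight_norm_gt0 pW (- p^-1) x e0.
  have u'0 := weight_norm_gt0 pW p^-1 x e'0.
  have h1 : 1 <= negnorm e x * posnorm e' x.
    apply: le_trans (normc_cdot_le p pW e e' x).
    rewrite /e (cdot_selfadjoint _ _ (hermsymmx_selfadjoint (pV J).1)) /e' mulKVmx//.
    by rewrite cdotvv cnorm_delta expr1n /= expr0n/= addr0 expr1n sqrtr1.
  exact: norm_ln_le (ltW p_gt1) h1.
rewrite (cube_avgD J (lneg e0) (locintZ 2 (lpos e'))) (cube_avgZ 2 J (lpos e')).
apply: lerD.
  apply: le_trans (cube_avg_ln_negnorm_le mW pW p_gt1 c2_gt0 upperV ApinfV J e0) _.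
  by rewrite /e mulKmx// cnorm_delta mulr1 ler_norm.
rewrite ler_pM2l//; apply: le_trans (cube_avg_posnorm_le mW pW p_gt1 c2_gt0 upperV J e') _.
by rewrite /e' mulKVmx// cnorm_delta mulr1.
Qed.

(** Write V_K^(-1) u as V_K^(-1) V_J applied to V_J^(-1) u. The columns of
    V_K^(-1) V_J are V_K^(-1) applied to the vectors V_J e_i, and ln_invV_le
    bounds them by the logarithmic averages that logosc sums up. *)
Lemma invV_comparison J K (L : R) (u : 'cV[R[i]]_n) : logosc J K < L ->
  cnorm (invmx (V K) *m u) ^+ 2 <=
  n%:R * expR (L + ln c2) ^+ 2 * cnorm (invmx (V J) *m u) ^+ 2.
Proof.
move=> yL; have uV := posdef_unit (pV J).
have -> : invmx (V K) *m u = (invmx (V K) *m V J) *m (invmx (V J) *m u).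
  by rewrite -mulmxA mulKVmx.
apply: le_trans (sqr_cnorm_mul_le _ _) _; rewrite ler_wpM2r ?sqr_ge0//.
rewrite -[n in n%:R]card_ord mulr_natl -sumr_const; apply: ler_sum => i _.
rewrite lerXn2r ?nnegrE ?cnorm_ge0 ?expR_ge0// -mulmxA.
set e := V J *m delta i; have e0 : e != 0 by exact: V_delta_neq0.
have Ve : 0 < cnorm (invmx (V K) *m e).
  by apply: cnorm_mul_gt0 => //; rewrite unitmx_inv; exact: posdef_unit.
rewrite -[leLHS]lnK ?posrE// ler_expR.
apply: le_trans (ln_invV_le mW pW p_gt1 c2_gt0 pV upperV ApinfV K e0) _.
rewrite lerD2r; apply: le_trans (ltW yL).
apply: (@le_trans _ _ (cube_avg (fun x => `|ln (negnorm e x)|) K)).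
  by apply: le_cube_avg; [exact: lneg|exact: labs|move=> x; exact: ler_norm].
rewrite /logosc (bigD1 i)//= lerDl; apply: sumr_ge0 => j _.
by apply: cube_avg_ge0 => x.
Qed.

Section OneFunction.
Let q := p / (p - 1).
Variable f : Rspace R d -> 'cV[R[i]]_n.
Hypothesis mf : measurable_cmx f.
Local Notation g := (dualnorm p W f).
Hypothesis dual_fin : (\int[mu]_x (g x `^ q)%:E < +oo)%E.

Let q_gt0 : 0 < q. Proof. by rewrite divr_gt0// subr_gt0. Qed.
Let pq1 : p^-1 + q^-1 = 1.
Proof. by rewrite /q invf_div; field; rewrite gt_eqF. Qed.
Let lprod := locint_posnorm_dualnorm mW pW mf p_gt0 q_gt0 pq1 lpos dual_fin.
Let ldual := locint_dualnorm mW pW mf dual_fin.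

Lemma locint_component (M : 'M[R[i]]_n) j b : selfadjoint M ->
  locint (fun x => reim b ((M *m f x) j 0)) /\
  forall x, `|reim b ((M *m f x) j 0)| <= posnorm (M *m delta j) x * g x.
Proof.
move=> sM.
have hM x : `|reim b ((M *m f x) j 0)| <= posnorm (M *m delta j) x * g x.
  apply: le_trans (reim_le_normc _ _) _.
  rewrite -(cdot_delta j) -cdot_selfadjoint//.
  exact: normc_cdot_dualnorm_le.
split => //; apply: locint_le (hM) (lprod _).
by apply: measurable_reim; apply: (measurable_cmx_mul _ mf); exact: measurable_cmx_cst.
Qed.

Let locint_f k b : locint (fun x => reim b (f x k 0)).
Proof.
have [|h _] := @locint_component 1%:M k b.
  by rewrite /selfadjoint trmx1 map_mx1.
by move=> K; have := h K; under eq_fun do rewrite mul1mx.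
Qed.

Definition coefsq (M : 'M[R[i]]_n) K : R :=
  \sum_(eps : T | Sig eps) cnorm (M *m haar_coef f K eps) ^+ 2 / vol K.

Lemma coefsq_ge0 M K : 0 <= coefsq M K.
Proof.
by apply: sumr_ge0 => eps _; rewrite divr_ge0 ?sqr_ge0// ltW// vol_gt0.
Qed.

(** The average of a function that dominates every entry of V_J^(-1) f, by the
    pairing inequality. *)
Definition majorant J K : R :=
  cube_avg (fun x => \sum_j posnorm (invmx (V J) *m delta j) x * g x) K.

Let lmaj J : locint (fun x => \sum_j posnorm (invmx (V J) *m delta j) x * g x).
Proof. by apply: locint_sum => j; exact: lprod. Qed.

Lemma majorant_ge0 J K : 0 <= majorant J K.
Proof.
apply: cube_avg_ge0 => x; apply: sumr_ge0 => j _.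
by rewrite mulr_ge0 ?weight_norm_ge0 ?dualnorm_ge0.
Qed.

(** For the fixed matrix V_J^(-1), the coefficients are martingale differences of
    the real and imaginary parts of the entries of V_J^(-1) f. *)
Lemma coefsq_weak_type J m K h t : 0 < h -> 0 < t ->
  path_avg (@child R d) (coefsq (invmx (V J))) (fun u => (t < u)%R%:R) m 0 K <=
  majorant J K / h +
  #|{: T}|%:R / t * (2 * #|{: T}|%:R * h * #|{: 'I_n * bool}|%:R * majorant J K).
Proof.
move=> h0 t0.
have sM := invV_selfadjoint J.
have iM k b := (locint_component k b sM).1.
apply: (weak_type_square (card_children d)
  (phi := fun l K => cube_avg (fun x => reim l.2 ((invmx (V J) *m f x) l.1 0)) K)) => //.
- exact: coefsq_ge0.
- exact: majorant_ge0.
- exact/cube_avg_martingale/lmaj.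
- by move=> l; exact/cube_avg_martingale/iM.
- move=> [j b] K'; apply: norm_cube_avg_le; [exact: iM|exact: lmaj|].
  move=> x; apply: le_trans ((locint_component j b sM).2 x) _.
  rewrite (bigD1 j)//= lerDl sumr_ge0// => i _.
  by rewrite mulr_ge0 ?weight_norm_ge0 ?dualnorm_ge0.
- move=> K'; rewrite /coefsq mulr_natl -sumr_const.
  rewrite [leRHS](bigID (@Sig d))/=.
  rewrite ler_wpDr//.
    apply: sumr_ge0 => eps _; apply: sumr_ge0 => l _.
    by apply: (avg_ge0 (card_children d)) => c; exact: sqr_ge0.
  by apply: ler_sum => eps Se; exact: sqr_cnorm_haar_coef_le.
Qed.

End OneFunction.
End LocalEstimate.

(** * The exponent gain *)

Lemma young_scale (R : realType) (r' r u w a : R) : 0 < r' -> 0 < r -> r'^-1 + r^-1 = 1 ->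
  0 <= u -> 0 <= w -> 0 < a -> u * w <= a * (u `^ r' + w `^ r / a `^ r).
Proof.
move=> r'0 r0 rr u0 w0 a0.
have ar : 0 < a `^ r by rewrite powR_gt0.
have wa : (w / a) `^ r = w `^ r / a `^ r.
  by apply: (mulIf (x := a `^ r)); rewrite ?gt_eqF// -powRM ?divr_ge0 ?(ltW a0)// !divfK ?gt_eqF.
have r'1 : 1 <= r'.
  by rewrite -(invrK r') -[leLHS]invr1 lef_pV2 ?posrE ?invr_gt0// -rr lerDl invr_ge0 ltW.
have r1 : 1 <= r.
  by rewrite -(invrK r) -[leLHS]invr1 lef_pV2 ?posrE ?invr_gt0// -rr lerDr invr_ge0 ltW.
have := conjugate_powR u0 (divr_ge0 w0 (ltW a0)) r'0 r0 rr.
rewrite wa => h; have -> : u * w = a * (u * (w / a)) by field; rewrite gt_eqF.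
rewrite ler_wpM2l ?(ltW a0)//; apply: le_trans h _; apply: lerD.
- by rewrite ler_pdivrMr// ler_peMr ?powR_ge0.
- by rewrite ler_pdivrMr// ler_peMr// divr_ge0 ?powR_ge0.
Qed.

Section LocalSquareFunction.
Variables (R : realType) (n d : nat) (p c2 C0 : R).
Local Notation mu := (leb R d).
Local Notation T := {ffun 'I_d -> bool}.
Variables (W : Rspace R d -> 'M[R[i]]_n) (V : cube R d -> 'M[R[i]]_n).
Hypothesis n_gt0 : (0 < n)%N.
Hypotheses (mW : measurable_cmx W) (pW : forall x, posdefmx (W x)).
Hypotheses (p_gt1 : 1 < p) (c2_gt0 : 0 < c2) (C0_gt0 : 0 < C0).
Hypothesis pV : forall I, posdefmx (V I).
Hypotheses (upperV : reducing_upper p c2 W V) (ApinfV : Apinfty_bound p C0 W V).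
Local Notation posnorm := (weight_norm W p^-1).
Local Notation delta j := (delta_mx j 0 : 'cV[R[i]]_n).
Local Notation q := (p / (p - 1)).
Implicit Types (J K : cube R d).

Let p_gt0 : 0 < p. Proof. exact: lt_trans ltr01 p_gt1. Qed.
Let q_gt0 : 0 < q. Proof. by rewrite divr_gt0// subr_gt0. Qed.
Let pq1 : p^-1 + q^-1 = 1.
Proof. by rewrite invf_div; field; rewrite gt_eqF. Qed.
Let lpos := locint_posnorm mW pW p_gt1 c2_gt0 upperV.

Variables (del r s : R).
Hypotheses (del_gt0 : 0 < del) (r_gt0 : 0 < r) (rr : (p * (1 + del))^-1 + r^-1 = 1).
Hypothesis sE : s = q / r.
Hypothesis revH : forall v, v != 0 -> forall m K,
  level_avg (@child R d) m (fun K => cube_avg (fun x => posnorm v x `^ p) K `^ (1 + del)) K <=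
  2 * cube_avg (fun x => posnorm v x `^ p) K `^ (1 + del).

Let s_gt1 : 1 < s.
Proof.
rewrite sE ltr_pdivlMr// mul1r -ltf_pV2 ?posrE//.
have d1 : (p * (1 + del))^-1 < p^-1.
  by rewrite ltf_pV2 ?posrE ?mulr_gt0 ?addr_gt0// ltr_pMr// ltrDl.
by move: rr pq1 d1; lra.
Qed.

Section OneFunction.
Variable f : Rspace R d -> 'cV[R[i]]_n.
Hypothesis mf : measurable_cmx f.
Local Notation g := (dualnorm p W f).
Hypothesis dual_fin : (\int[mu]_x (g x `^ q)%:E < +oo)%E.
Variable e : R.
Hypothesis e_gt0 : 0 < e.

Let ldual := locint_dualnorm mW pW mf dual_fin.

(** The summand e keeps the martingale positive where f vanishes; it tends to 0
    at the end. *)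
Definition gmass K : R := cube_avg (fun x => g x `^ q) K + e.

Lemma gmass_gt0 K : 0 < gmass K.
Proof. by rewrite ltr_wpDl// cube_avg_ge0// => x; exact: powR_ge0. Qed.

Lemma gmass_martingale : martingale (@child R d) gmass.
Proof.
move=> K; rewrite /gmass avgD (avg_cst (card_children d)).
by rewrite (cube_avg_martingale ldual).
Qed.

Lemma majorant_le_sum J K : majorant p W V f J K <=
  \sum_j cube_avg (fun x => posnorm (invmx (V J) *m delta j) x `^ p) K `^ p^-1 *
         gmass K `^ q^-1.
Proof.
rewrite /majorant cube_avg_sum; last first.
  by move=> j; exact: (locint_posnorm_dualnorm mW pW mf p_gt0 q_gt0 pq1 lpos dual_fin).
apply: ler_sum => j _.
apply: (cube_avg_posnorm_dualnorm_le mW pW mf p_gt0 q_gt0 pq1 lpos dual_fin) => //.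
- apply: (cube_avg_posnorm_gt0 mW pW p_gt1 c2_gt0 upperV ApinfV).
  exact: invV_delta_neq0.
- exact: gmass_gt0.
- by rewrite /gmass lerDl ltW.
Qed.

(** On each descendant of generation m, Hoelder's inequality and then Young's
    inequality with the exponents p (1+del) and r separate the weight from g;
    the scale a is the r-th root of the mean, so that both terms are of size a.
    The mean of the (1+del)-th powers of the weight averages returns to J by the
    reverse Hoelder inequality, and the weight average at J is a constant
    because |V_J V_J^(-1) e_j| = 1. *)
Lemma majorant_root J m : majorant p W V f J J <=
  n%:R * (2 * c2 `^ (p * (1 + del)) + 1) * root_avg (@child R d) gmass s m J `^ r^-1.
Proof.
have mM : martingale (@child R d) (majorant p W V f J).
  apply: cube_avg_martingale; apply: locint_sum => j.
  exact: (locint_posnorm_dualnorm mW pW mf p_gt0 q_gt0 pq1 lpos dual_fin).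
rewrite -(level_avg_martingale m J mM).
set x := root_avg _ _ _ _ _.
have x0 : 0 < x.
  by apply: (level_avg_gt0 _ (card_children d)) => K; rewrite powR_gt0// gmass_gt0.
set a := x `^ r^-1; have a0 : 0 < a by rewrite powR_gt0.
have ar : a `^ r = x by rewrite /a -powRrM mulVf ?gt_eqF// powRr1// ltW.
have r'0 : 0 < p * (1 + del) by rewrite mulr_gt0// addr_gt0.
pose w j K := cube_avg (fun x => posnorm (invmx (V J) *m delta j) x `^ p) K.
have w0 j K : 0 <= w j K by apply: cube_avg_ge0 => y; exact: powR_ge0.
apply: (@le_trans _ _ (level_avg (@child R d) m (fun K =>
    \sum_(j < n) (a * (w j K `^ (1 + del)) + a * x^-1 * gmass K `^ s^-1)) J)).
  apply: (ler_level_avg _ (card_children d)) => K; apply: le_trans (majorant_le_sum J K) _.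
  apply: ler_sum => j _.
  have := young_scale r'0 r_gt0 rr (powR_ge0 (w j K) p^-1) (powR_ge0 (gmass K) q^-1) a0.
  rewrite ar -!powRrM mulrA mulVf ?gt_eqF// mul1r => /le_trans; apply.
  have si : s^-1 = q^-1 * r by rewrite sE invfM invrK.
  by rewrite mulrDr lerD2l si -[leRHS]mulrA [x^-1 * _]mulrC.
rewrite level_avg_sumr -[n in n%:R]card_ord -mulrA mulr_natl -sumr_const.
apply: ler_sum => j _; rewrite level_avgD !level_avgZ -/(root_avg _ _ _ _ _) -/x.
rewrite -mulrA mulVf ?gt_eqF// mulr1 mulrC mulrDl mul1r lerD2r ler_pM2r//.
apply: (@le_trans _ _ (2 * w j J `^ (1 + del))).
  by apply: revH; exact: invV_delta_neq0.
rewrite ler_pM2l// powRrM; apply: ge0_ler_powR; rewrite ?nnegrE ?powR_ge0//.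
  by rewrite addr_ge0// ltW.
apply: le_trans (cube_avg_posnorm_le mW pW p_gt1 c2_gt0 upperV J _) _.
by rewrite mulKVmx ?cnorm_delta ?mulr1//; exact: posdef_unit.
Qed.

End OneFunction.
End LocalSquareFunction.

(** * The square function below one cube *)

(** The constant that makes the second term of the weak-type bound equal to
    eta/4. *)
Lemma threshold_balance (F : realFieldType) (N l H nL K1 eta a : F) :
  N != 0 -> l != 0 -> H != 0 -> nL != 0 -> K1 != 0 -> eta != 0 -> a != 0 ->
  N / (8 * N ^+ 2 * l * H * nL * K1 / eta * a ^+ 2 / l) *
    (2 * N * (H * a) * nL * (K1 * a)) = eta / 4.
Proof. by move=> *; field; do ![apply/andP; split]. Qed.

Section LocalSquareEstimate.
Variables (R : realType) (n d : nat) (p c2 C0 : R).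
Local Notation mu := (leb R d).
Local Notation T := {ffun 'I_d -> bool}.
Variables (W : Rspace R d -> 'M[R[i]]_n) (V : cube R d -> 'M[R[i]]_n).
Hypothesis n_gt0 : (0 < n)%N.
Hypotheses (mW : measurable_cmx W) (pW : forall x, posdefmx (W x)).
Hypotheses (p_gt1 : 1 < p) (c2_gt0 : 0 < c2) (C0_gt0 : 0 < C0).
Hypothesis pV : forall I, posdefmx (V I).
Hypotheses (upperV : reducing_upper p c2 W V) (ApinfV : Apinfty_bound p C0 W V).
Local Notation posnorm := (weight_norm W p^-1).
Local Notation q := (p / (p - 1)).
Implicit Types (J K : cube R d).

Definition coefsum f K : R := coefsq f (invmx (V K)) K.

Section Exceed.
Variables (del r s : R).
Hypotheses (del_gt0 : 0 < del) (r_gt0 : 0 < r) (rr : (p * (1 + del))^-1 + r^-1 = 1).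
Hypothesis sE : s = q / r.
Hypothesis revH : forall v, v != 0 -> forall m K,
  level_avg (@child R d) m (fun K => cube_avg (fun x => posnorm v x `^ p) K `^ (1 + del)) K <=
  2 * cube_avg (fun x => posnorm v x `^ p) K `^ (1 + del).

(** The portion eta splits into eta/2 for the cubes where V_K^(-1) is not dominated
    by lam V_J^(-1), which fixes Ly, then eta/4 for the set where the majorant
    exceeds H a, which fixes H, and eta/4 for the square sum, which fixes A. *)
Lemma exceed_small (eta : R) : 0 < eta -> exists2 A, 0 <= A &
  forall f, measurable_cmx f ->
  (\int[mu]_x (dualnorm p W f x `^ q)%:E < +oo)%E ->
  forall e, 0 < e -> forall m J,
  path_avg (@child R d) (coefsum f) (fun u =>
    (A * root_avg (@child R d) (gmass p W f e) s m J `^ (s / (q / 2)) < u)%R%:R) m 0 J <= eta.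
Proof.
move=> eta0.
pose K2 : R := n%:R * (`|ln C0| + 2 * c2 `^ p).
have K20 : 0 <= K2 by rewrite mulr_ge0// addr_ge0// mulr_ge0// powR_ge0.
pose Ly := 2 * (K2 + 1) / eta.
have Ly0 : 0 < Ly by rewrite divr_gt0// mulr_gt0// ltr_wpDl.
pose lam : R := n%:R * expR (Ly + ln c2) ^+ 2.
have lam0 : 0 < lam by rewrite mulr_gt0 ?ltr0n// exprn_gt0// expR_gt0.
pose K1 : R := n%:R * (2 * c2 `^ (p * (1 + del)) + 1).
have K10 : 0 < K1 by rewrite mulr_gt0 ?ltr0n// ltr_wpDl// mulr_ge0// powR_ge0.
pose H := 4 * K1 / eta.
have H0 : 0 < H by rewrite divr_gt0// mulr_gt0.
pose N : R := #|{: T}|%:R.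
have N0 : 0 < N by rewrite ltr0n card_children.
pose nL : R := #|{: 'I_n * bool}|%:R.
have nL0 : 0 < nL by rewrite ltr0n card_prod card_ord card_bool muln_gt0 n_gt0.
pose A := 8 * N ^+ 2 * lam * H * nL * K1 / eta.
have A0 : 0 < A.
  apply: divr_gt0 => //; apply: mulr_gt0 K10; apply: mulr_gt0 nL0; apply: mulr_gt0 H0.
  by apply: mulr_gt0 lam0; rewrite mulr_gt0// exprn_gt0.
exists A; first exact: ltW.
move=> f mf ff e e0 m J.
set x := root_avg _ _ _ _ _.
have x0 : 0 < x.
  by apply: (level_avg_gt0 _ (card_children d)) => K; rewrite powR_gt0// gmass_gt0.
set a := x `^ r^-1; have a0 : 0 < a by rewrite powR_gt0.
have q0 : 0 < q by rewrite divr_gt0 ?subr_gt0// (lt_trans ltr01).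
have -> : x `^ (s / (q / 2)) = a ^+ 2.
  rewrite /a -powR_mulrn ?powR_ge0// -powRrM; congr (_ `^ _).
  rewrite sE; move: q0 r_gt0; move: (q) => q' q'0 r0.
  by field; rewrite !gt_eqF.
have t0 : 0 < A * a ^+ 2 by rewrite mulr_gt0// exprn_gt0.
have ml : majorant p W V f J J <= K1 * a.
  exact: (majorant_root mW pW p_gt1 c2_gt0 pV upperV ApinfV del_gt0 r_gt0 rr sE revH mf ff e0).
have m0 : 0 <= majorant p W V f J J by exact: majorant_ge0.
have cmp K : logosc p W V J K < Ly ->
    coefsum f K <= lam * coefsq f (invmx (V J)) K.
  move=> yL; rewrite /coefsum /coefsq mulr_sumr; apply: ler_sum => eps _.
  rewrite mulrA ler_pM2r ?invr_gt0 ?vol_gt0//.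
  exact: (invV_comparison mW pW p_gt1 c2_gt0 pV upperV ApinfV).
apply: le_trans (path_avg_comparison (card_children d) lam0 Ly0
  (logosc_ge0 p W V J) (logosc_martingale mW pW p_gt1 c2_gt0 pV upperV ApinfV J) cmp m J _) _.
have h1 : logosc p W V J J / Ly <= eta / 2.
  rewrite ler_pdivrMr//; apply: le_trans (logosc_root mW pW p_gt1 c2_gt0 pV upperV ApinfV J) _.
  rewrite -/K2 /Ly (_ : eta / 2 * _ = K2 + 1); last by field; rewrite gt_eqF.
  by rewrite lerDl.
have h2 := coefsq_weak_type mW pW p_gt1 c2_gt0 pV upperV mf ff J m J
  (mulr_gt0 H0 a0) (divr_gt0 t0 lam0).
have Ha0 : 0 < H * a := mulr_gt0 H0 a0.
have E3 : eta / 4 * (H * a) = K1 * a by rewrite /H; field; rewrite gt_eqF.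
have h3 : majorant p W V f J J / (H * a) <= eta / 4 by rewrite ler_pdivrMr// E3.
have E4 : N / (A * a ^+ 2 / lam) * (2 * N * (H * a) * nL * (K1 * a)) = eta / 4.
  by apply: threshold_balance; rewrite gt_eqF.
have two_gt0 : (0 : R) < 2 by [].
have h4 : N / (A * a ^+ 2 / lam) * (2 * N * (H * a) * nL * majorant p W V f J J) <= eta / 4.
  rewrite -E4; apply: ler_wpM2l.
    exact: (divr_ge0 (ltW N0) (ltW (divr_gt0 t0 lam0))).
  apply: ler_wpM2l ml; apply: ltW.
  exact: (mulr_gt0 (mulr_gt0 (mulr_gt0 two_gt0 N0) Ha0) nL0).
apply: le_trans (lerD h1 (le_trans h2 (lerD h3 h4))) _.
by rewrite le_eqVlt; apply/orP; left; apply/eqP; field.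
Qed.

End Exceed.

(** Since the weight has a reverse Hoelder exponent 1 + del > 1, the dual exponent
    r of p (1 + del) is less than p', so s = p'/r > 1 and the iteration
    applies. *)
Lemma local_square_estimate : exists2 Cst, 0 <= Cst & forall f, measurable_cmx f ->
  (\int[mu]_x (dualnorm p W f x `^ q)%:E < +oo)%E -> forall m K,
  path_avg (@child R d) (coefsum f) (fun u => u `^ (q / 2)) m 0 K <=
  Cst * cube_avg (fun x => dualnorm p W f x `^ q) K.
Proof.
have [del del0 revH] := reverse_hoelder_posnorm mW pW p_gt1 c2_gt0 C0_gt0 pV upperV ApinfV.
have p0 : 0 < p by exact: lt_trans ltr01 p_gt1.
have q0 : 0 < q by rewrite divr_gt0// subr_gt0.
have pq1 : p^-1 + q^-1 = 1 by rewrite invf_div; field; rewrite gt_eqF.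
have r'1 : 1 < p * (1 + del).
  by rewrite (lt_trans p_gt1)// ltr_pMr// ltrDl.
pose r := (1 - (p * (1 + del))^-1)^-1.
have r0 : 0 < r by rewrite invr_gt0 subr_gt0 invf_lt1// (lt_trans ltr01).
have rr : (p * (1 + del))^-1 + r^-1 = 1 by rewrite invrK addrC subrK.
pose s := q / r.
have s1 : 1 < s.
  rewrite /s ltr_pdivlMr// mul1r -ltf_pV2 ?posrE//.
  have d1 : (p * (1 + del))^-1 < p^-1.
    by rewrite ltf_pV2 ?posrE ?mulr_gt0 ?addr_gt0// ltr_pMr// ltrDl.
  by move: rr pq1 d1; move: (_^-1) (r^-1) (p^-1) (q^-1) => ? ? ? ?; lra.
have k0 : 0 < q / 2 by rewrite divr_gt0.
have [c0 c00 powD] := powRD_quasi k0.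
pose L := (s - 1) * (6 `^ (s - 1)^-1) `^ s.
have L0 : 0 < L by rewrite mulr_gt0 ?subr_gt0// powR_gt0// powR_gt0.
pose eta := Num.min 8^-1 L^-1.
have eta0 : 0 < eta by rewrite lt_min !invr_gt0 L0 ltr0n.
have [A A0 hA] := exceed_small del0 r0 rr (erefl s) revH eta0.
pose Cst := 5 / 4 * (c0 * A `^ (q / 2)) * (2 * 2 `^ s).
have Cst0 : 0 <= Cst by rewrite !mulr_ge0 ?powR_ge0.
exists Cst => // f mf ff m K.
apply/ler_addgt0Pr => e' e'0.
have C1 : 0 < Cst + 1 by rewrite ltr_wpDl.
pose e := e' / (Cst + 1); have e0 : 0 < e by rewrite divr_gt0.
have eta8 : eta <= 8^-1 by rewrite ge_min lexx.
have etaL : L * eta <= 1.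
  by rewrite mulrC -ler_pdivlMr// mul1r ge_min lexx orbT.
have b0 K' : 0 <= coefsum f K' := coefsq_ge0 f _ K'.
have it := stopping_iteration (card_children d) (gmass_gt0 p W f e0)
  (gmass_martingale mW pW mf ff e) s1 b0 k0 A0 eta8 etaL c00 powD
  (hA f mf ff e e0) m K.
apply: le_trans it _; rewrite -/Cst /gmass mulrDr lerD2l.
have -> : Cst * e = e' * (Cst / (Cst + 1)) by rewrite /e mulrCA.
apply: ler_piMr; first exact: ltW.
by rewrite ler_pdivrMr// mul1r lerDl.
Qed.

End LocalSquareEstimate.

(** * Reduction to Borel data and the theorem *)

Section NullModification.
Variables (R : realType) (dT : measure_display) (T : measurableType dT).
Variable mu : {measure set T -> \bar R}.

Lemma countable_null_cover (I : countType) (N : I -> set T) :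
  (forall i, measurable (N i) /\ mu (N i) = 0%E) ->
  exists M, [/\ measurable M, mu M = 0%E & forall i, N i `<=` M].
Proof.
move=> hN; pose F k := oapp N set0 (unpickle k).
have mF k : measurable (F k).
  by rewrite /F; case: unpickle => [i|] //=; case: (hN i).
exists (\bigcup_k F k); split; first exact: bigcupT_measurable.
- apply/negligibleP; first exact: bigcupT_measurable.
  apply: negligible_bigcup => k; apply/negligibleP => //.
  by rewrite /F; case: unpickle => [i|] /=; [case: (hN i)|rewrite measure0].
- by move=> i x Nx; exists (pickle i) => //; rewrite /F pickleK.
Qed.

End NullModification.

(** One null set serves all entries, and it may be enlarged, here by the set where
    the weight fails to be positive definite. *)
Lemma borel_modification (R : realType) (d m k : nat) (F : Rspace R d -> 'M[R[i]]_(m, k)) :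
  Lebesgue_measurable_mx F ->
  exists N, [/\ measurable N, leb R d N = 0%E & forall M A, measurable M -> N `<=` M ->
    measurable_cmx (fun x => if x \in M then A else F x)].
Proof.
move=> mF.
pose part (t : 'I_m * 'I_k * bool) x : R :=
  if t.2 then complex.Re (F x t.1.1 t.1.2) else complex.Im (F x t.1.1 t.1.2).
have /choice[N hN] t : exists N, [/\ measurable N, leb R d N = 0%E &
    forall M c, measurable M -> N `<=` M ->
    measurable_fun setT (fun x => if x \in M then c else part t x)].
  apply: completed_measurable_modify; case: t => -[i j] [].
  - exact: (mF i j).1.
  - exact: (mF i j).2.
have [|M0 [mM0 M00 NM0]] := @countable_null_cover _ _ _ (leb R d) _ N.
  by move=> t; have [] := hN t.
exists M0; split=> // M A mM M0M i j; split.
- have [_ _ /(_ M (complex.Re (A i j)) mM)] := hN (i, j, true).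
  move=> /(_ (subset_trans (NM0 _) M0M)); apply: eq_measurable_fun => x _ /=.
  by rewrite /part/=; case: ifP.
- have [_ _ /(_ M (complex.Im (A i j)) mM)] := hN (i, j, false).
  move=> /(_ (subset_trans (NM0 _) M0M)); apply: eq_measurable_fun => x _ /=.
  by rewrite /part/=; case: ifP.
Qed.

Lemma Lnorm_vec_null_eq (R : realType) (d n : nat) (s : R) (F G : Rspace R d -> 'cV[R[i]]_n)
  (N : set (Rspace R d)) : measurable N -> leb R d N = 0%E ->
  (forall x, ~ N x -> F x = G x) -> Lnorm_vec s F = Lnorm_vec s G.
Proof.
move=> mN N0 FG.
have FGs x : ~ N x -> (cnorm (F x) `^ s)%:E = (cnorm (G x) `^ s)%:E by move=> /FG ->.
by rewrite /Lnorm_vec (integral_null_eq setT mN N0 FGs).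
Qed.

Lemma posdefmx1 (R : realType) n : posdefmx (1%:M : 'M[R[i]]_n).
Proof.
split=> [|v v0]; first exact: hermitian1mx_subproof.
rewrite mulmx1 -[X in 0 < X]/(cdot v v) cdotvv.
by rewrite ltcR exprn_gt0// cnorm_gt0.
Qed.

Section BorelWeights.
Variables (R : realType) (n d : nat) (p c2 C0 : R).
Local Notation mu := (leb R d).
Variables (W : Rspace R d -> 'M[R[i]]_n) (V : cube R d -> 'M[R[i]]_n).
Hypothesis n_gt0 : (0 < n)%N.
Hypotheses (mW : measurable_cmx W) (pW : forall x, posdefmx (W x)).
Hypotheses (p_gt1 : 1 < p) (c2_gt0 : 0 < c2) (C0_gt0 : 0 < C0).
Hypothesis pV : forall I, posdefmx (V I).
Hypotheses (upperV : reducing_upper p c2 W V) (ApinfV : Apinfty_bound p C0 W V).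
Local Notation q := (p / (p - 1)).

Lemma square_sumE (D : set (cube R d)) f x :
  square_sum V D f x = (\esum_(I in D) (coefsum V f I * \1_(cubeset I) x)%:E)%E.
Proof.
apply: eq_esum => I _; rewrite sumEFin; congr EFin.
by rewrite /coefsum /coefsq mulr_suml.
Qed.

Lemma dual_weight_normE f : dual_weight_norm p W f =
  ((\int[mu]_x (dualnorm p W f x `^ q)%:E) `^ q^-1)%E.
Proof. by rewrite /dual_weight_norm /Lnorm_vec /dualnorm. Qed.

Lemma borel_square_function_bound : exists2 Cst, 0 <= Cst &
  forall D, dyadic_grid D -> forall f, measurable_cmx f ->
  (\int[mu]_x (dualnorm p W f x `^ q)%:E < +oo)%E ->
  ((\int[mu]_x (square_sum V D f x `^ (q / 2))) `^ q^-1
    <= Cst%:E * (\int[mu]_x (dualnorm p W f x `^ q)%:E) `^ q^-1)%E.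
Proof.
have [Cst Cst0 hC] := local_square_estimate n_gt0 mW pW p_gt1 c2_gt0 C0_gt0 pV upperV ApinfV.
have p0 : 0 < p by exact: lt_trans ltr01 p_gt1.
have q0 : 0 < q by rewrite divr_gt0// subr_gt0.
exists (Cst `^ q^-1); first exact: powR_ge0.
move=> D gD f mf ff.
have g0 x : (0 <= (dualnorm p W f x `^ q)%:E)%E by rewrite lee_fin powR_ge0.
have mg : measurable_fun setT (fun x => (dualnorm p W f x `^ q)%:E).
  by apply/measurable_EFinP; exact: measurable_dualnorm_powR mW pW mf.
have b0 K : 0 <= coefsum V f K := coefsq_ge0 f _ K.
have loc K m : (\int[mu]_(x in cubeset K) (pathsum (coefsum V f) m 0 K x `^ (q / 2))%:E <=
    Cst%:E * \int[mu]_(x in cubeset K) (dualnorm p W f x `^ q)%:E)%E.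
  have iK := locint_dualnorm mW pW mf ff K.
  rewrite (integral_pathsum _ _ _ _ (fun u => powR_ge0 u _)).
  rewrite -(fineK (integrable_fin_num (measurable_cubeset K) iK)) -EFinM lee_fin.
  have := hC f mf ff m K; rewrite -(ler_pM2l (vol_gt0 K)) => /le_trans; apply.
  by rewrite /cube_avg mulrCA mulVKf// gt_eqF// vol_gt0.
have k0 : 0 < q / 2 by rewrite divr_gt0.
have G := grid_integral_le gD b0 k0 Cst0 mg g0 loc.
have -> : (\int[mu]_x (square_sum V D f x `^ (q / 2)) =
   \int[mu]_x ((\esum_(I in D) (coefsum V f I * \1_(cubeset I) x)%:E) `^ (q / 2)))%E.
  by apply: eq_integral => x _; rewrite square_sumE.
have I0 : (0 <= \int[mu]_x (dualnorm p W f x `^ q)%:E)%E by exact: integral_ge0.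
have q'0 : 0 <= q^-1 by rewrite invr_ge0 ltW.
have -> : (Cst `^ q^-1)%:E = (Cst%:E `^ q^-1)%E by rewrite poweR_EFin.
rewrite -poweRM ?lee_fin//; apply: gt0_ler_poweR => //; rewrite in_itv/= leey andbT.
  by apply: integral_ge0 => x _; exact: poweR_ge0.
by rewrite mule_ge0 ?lee_fin.
Qed.
End BorelWeights.

(** Changing W and f on null sets changes neither the Haar coefficients, nor the
    norm, nor the hypotheses on the reducing matrices. So W may be taken Borel
    and positive definite everywhere, with the identity as its value on the
    exceptional set, and f Borel. *)
Theorem theorem3p1 (R : realType) (n d : nat) (p c1 c2 : R)
    (W : Rspace R d -> 'M[R[i]]_n) (V : cube R d -> 'M[R[i]]_n)
    (n_gt0 : (0 < n)%N) (d_gt0 : (0 < d)%N) (p_gt1 : 1 < p)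
    (c1_gt0 : 0 < c1) (c2_gt0 : 0 < c2)
    (weightW : matrix_weight W)
    (reducingV : reducing_matrices p c1 c2 W V)
    (ApinftyW : matrix_Apinfty p W V) :
  let p' := p / (p - 1) in
  exists C : R, forall D : set (cube R d), dyadic_grid D ->
    forall f : Rspace R d -> 'cV[R[i]]_n, dual_weight_space p W f ->
      ((\int[leb R d]_x (square_sum V D f x `^ (p' / 2))) `^ p'^-1
         <= C%:E * dual_weight_norm p W f)%E.
Proof.
move=> p'.
have p0 : 0 < p := lt_trans ltr01 p_gt1.
have p1 : 0 < p - 1 by rewrite subr_gt0.
have p'0 : p'^-1 != 0 := invr_neq0 (lt0r_neq0 (divr_gt0 p0 p1)).
have [mW _ [NP [mNP NP0 PNP]]] := weightW.
have [NW [mNW NW0 hW]] := borel_modification mW.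
have NU (A B : set (Rspace R d)) : measurable A -> measurable B ->
    leb R d A = 0%E -> leb R d B = 0%E -> leb R d (A `|` B) = 0%E.
  move=> mA mB A0 B0; apply/negligibleP; first exact: measurableU.
  by apply: negligibleU; apply/negligibleP.
pose M := NW `|` NP.
have mM : measurable M by exact: measurableU.
have M0 : leb R d M = 0%E by exact: NU.
pose W1 x := if x \in M then 1%:M else W x.
have mW1 : measurable_cmx W1 by apply: hW => // x; left.
have WW1 x : ~ M x -> W x = W1 x by move=> xM; rewrite /W1 memNset.
have pW1 x : posdefmx (W1 x).
  rewrite /W1; case: ifPn => [_|/negP xM]; first exact: posdefmx1.
  apply: contrapT => nP; apply: xM; apply/mem_set; right; exact: PNP.
have pV I : posdefmx (V I) by have [] := reducingV I.
have upperV : reducing_upper p c2 W1 V.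
  move=> I e.
  have eN : Lnorm_vec p (fun x => (\1_(cubeset I) x : R)%:C *: (powmx (W x) p^-1 *m e)) =
      Lnorm_vec p (fun x => (\1_(cubeset I) x : R)%:C *: (powmx (W1 x) p^-1 *m e)).
    apply: (Lnorm_vec_null_eq _ mM M0) => x xM.
    exact: (f_equal (fun B => (\1_(cubeset I) x : R)%:C *: (powmx B p^-1 *m e)) (WW1 x xM)).
  by rewrite -eN; have [_ /(_ e)/andP[_]] := reducingV I.
have [C0 hC0] := ApinftyW.
pose C1 := Num.max C0 1.
have C1_gt0 : 0 < C1 by rewrite lt_max ltr01 orbT.
have ApinfV : Apinfty_bound p C1 W1 V.
  move=> I e /(hC0 I) h.
  apply: (@le_trans _ _ (C0 * cnorm (invmx (V I) *m e))%:E).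
    have <- : (\int[leb R d]_(x in cubeset I) (ln (cnorm (powmx (W x) (- p^-1) *m e)))%:E =
        \int[leb R d]_(x in cubeset I) (ln (cnorm (powmx (W1 x) (- p^-1) *m e)))%:E)%E.
      apply: (integral_null_eq _ mM M0) => x xM.
      exact: (f_equal (fun B => (ln (cnorm (powmx B (- p^-1) *m e)))%:E) (WW1 x xM)).
    exact: h.
  by rewrite lee_fin ler_wpM2r ?cnorm_ge0// le_max lexx.
have [Cst Cst0 hC] := borel_square_function_bound n_gt0 mW1 pW1 p_gt1 c2_gt0
  C1_gt0 pV upperV ApinfV.
exists Cst => D gD f [mf ff].
have [Nf [mNf Nf0 hf]] := borel_modification mf.
pose f1 x := if x \in Nf then 0 else f x.
have mf1 : measurable_cmx f1 by apply: hf.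
have ff1 x : ~ Nf x -> f x = f1 x by move=> xN; rewrite /f1 memNset.
have eN : dual_weight_norm p W f = dual_weight_norm p W1 f1.
  rewrite /dual_weight_norm.
  apply: (Lnorm_vec_null_eq _ (measurableU _ _ mM mNf) (NU _ _ mM mNf M0 Nf0)) => x.
  move=> /not_orP[xM xN].
  exact: (f_equal2 (fun B v => powmx B (- p^-1) *m v) (WW1 x xM) (ff1 x xN)).
have fin : (\int[leb R d]_x (dualnorm p W1 f1 x `^ p')%:E < +oo)%E.
  move: ff; rewrite eN dual_weight_normE; apply: lty_poweRy; exact: p'0.
have -> : square_sum V D f = square_sum V D f1.
  have hE I eps : haar_coef f I eps = haar_coef f1 I eps.
    apply/matrixP => j k; rewrite !mxE; congr (_ +i* _);
      by apply: (Rintegral_null_eq _ mNf Nf0) => x /ff1 ->.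
  by apply/funext => x; apply: eq_esum => I _; apply: eq_bigr => eps _; rewrite hE.
rewrite eN dual_weight_normE; exact: (hC D gD f1 mf1 fin).
Qed.
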